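(* Let $(X_t)_{t\ge 0}$ be a non-negatively curved diffusion on a probability space $(E,\mathcal{E},\mu)$, starting from a deterministic point $x\in E$, with spectral gap $\lambda>0$. Then for every $\varepsilon\in\left(0,\frac12\right)$, $$\mathrm{w}_{\mathrm{mix}}(\varepsilon)\ \le\ \frac{3}{\lambda\varepsilon^3}+3\sqrt{\frac{\mathrm{t}_{\mathrm{mix}}(1-\varepsilon)}{\lambda\varepsilon^3}}.$$
   Context: Setting. Let $(E,\mathcal{E},\mu)$ be a probability space and $(P_t)_{t\ge 0}$ a strongly continuous Markov semigroup of self-adjoint operators on $L^2(\mu)$. Its infinitesimal generator is $Lf:=\lim_{t\to 0}\frac{P_tf-f}{t}$, defined for all $f\in L^2(\mu)$ such that the limit exists in $L^2(\mu)$; the set of such $f$ is $\mathrm{Dom}(L)$. The carré du champ operator is $\Gamma(f,g):=\frac12\left(L(fg)-fLg-gLf\right)$ for $f,g\in L^2(\mu)$ with $f,g,fg\in\mathrm{Dom}(L)$, and $\Gamma f:=\Gamma(f,f)$. Non-negatively curved diffusion. Let $x\in E$ be an arbitrary point and let $(X_t)_{t\ge 0}$ be a Markov process with generator $L$ (i.e. with transition semigroup $(P_t)_{t\ge0}$, $P_tf(y)=\mathbb{E}[f(X_t)\mid X_0=y]$) starting from $X_0=x$. It is called a non-negatively curved diffusion if: for each $t>0$, $X_t$ admits a density $f_t$ with respect to $\mu$; both $f_t$ and $\log f_t$ are in $\mathrm{Dom}(L)$, as well as their squares and their product; and the following two conditions hold when $f=f_t$, $g=\log f_t$ and $\phi=\log$,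 for each $t>0$: (i) chain rule: $\Gamma(\phi(f),g)=\phi'(f)\,\Gamma(f,g)$; (ii) non-negative curvature in the $\mathrm{CD}(0,\infty)$ sense: $\Gamma P_s g\le P_s\Gamma g$ for all $s\ge 0$ (the expressions involved being understood to be well defined). Spectral gap. The spectral gap is the largest $\lambda\ge 0$ such that $\|P_tf\|_2\le e^{-\lambda t}\|f\|_2$ (norms in $L^2(\mu)$) for all $t\ge 0$ and all $f\in L^2(\mu)$ with $\mu(f):=\int_E f\,\mathrm{d}\mu=0$. It is assumed to be positive. Mixing times. For an $E$-valued random variable $X$, $\mathrm{TV}(X):=\sup_{A\in\mathcal{E}}|\mathbb{P}(X\in A)-\mu(A)|$. For $\varepsilon\in(0,1)$, $\mathrm{t}_{\mathrm{mix}}(\varepsilon):=\inf\{t>0:\mathrm{TV}(X_t)\le\varepsilon\}$. For $\varepsilon\in(0,1/2)$, the width of the mixing window is $\mathrm{w}_{\mathrm{mix}}(\varepsilon):=\mathrm{t}_{\mathrm{mix}}(\varepsilon)-\mathrm{t}_{\mathrm{mix}}(1-\varepsilon)$.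
   Formalization: The Markov property is assumed with respect to the right-continuous filtration F_{s+}, which gives a zero-one law at the starting point x; with only the plain Markov property the bound fails when x is a mu-null branching point (e.g. added to Ornstein–Uhlenbeck). *)

(* Defs.v *)
From HB Require Import structures.
From mathcomp Require Import all_boot all_order all_algebra.
From mathcomp Require Import all_classical all_reals all_analysis.

Set Implicit Arguments.
Unset Strict Implicit.
Unset Printing Implicit Defensive.

Import Order.TTheory GRing.Theory Num.Theory.
Import numFieldNormedType.Exports.

Local Open Scope classical_set_scope.
Local Open Scope ring_scope.

(* Elements of L^2(mu) are represented by functions f \in Lfun mu 2%:E, and
   equalities or inequalities in L^2 (or L^1) are required mu-almost
   everywhere. *)
Section semigroup.
Context d (R : realType) (E : measurableType d) (mu : probability E R).
Implicit Types (kappa : R -> R.-pker E ~> E) (f g h : E -> R).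

Definition L2norm f : \bar R := ('N[mu]_(2%:E)[EFin \o f])%E.

(* The time index of kappa is a real number; only t >= 0 is ever used. *)
Definition transition_function kappa : Prop :=
  (forall y (A : set E), measurable A -> kappa 0 y A = \d_y A) /\
  (forall s t : R, 0 <= s -> 0 <= t -> forall y (A : set E), measurable A ->
    kappa (s + t) y A = (\int[kappa s y]_z kappa t z A)%E).

(* P_t f (y) = E[f(X_t) | X_0 = y].  Since the integral makes sense for mu-almost
   every y as soon as f is mu-integrable, this is also P_t on L^1(mu). *)
Definition semigroup kappa (t : R) f : E -> R :=
  fun y => \int[kappa t y]_z f z.

Definition symmetric_markov_semigroup kappa : Prop :=
  [/\ transition_function kappa,
      forall (t : R) f, 0 <= t -> f \in Lfun mu 2%:E ->
        semigroup kappa t f \in Lfun mu 2%:E,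
      forall (t : R) f g, 0 <= t -> f \in Lfun mu 2%:E -> g \in Lfun mu 2%:E ->
        \int[mu]_y (semigroup kappa t f y * g y)
        = \int[mu]_y (f y * semigroup kappa t g y)
    & forall f, f \in Lfun mu 2%:E ->
        L2norm (semigroup kappa t f \- f) @[t --> 0^'+] --> 0%E].

Definition is_generator_value kappa f h : Prop :=
  h \in Lfun mu 2%:E /\
  L2norm (fun y => (semigroup kappa t f y - f y) / t - h y) @[t --> 0^'+]
    --> 0%E.

Definition in_dom kappa f : Prop :=
  f \in Lfun mu 2%:E /\ exists h, is_generator_value kappa f h.

(* A representative of the mu-almost everywhere class Lf, meaningful for f in
   Dom(L) only. *)
Definition generator kappa f : E -> R :=
  xget (cst 0) [set h | is_generator_value kappa f h].

Definition carre_du_champ kappa f g : E -> R :=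
  fun y => 2^-1 * (generator kappa (f \* g) y
                   - f y * generator kappa g y - g y * generator kappa f y).

Definition in_dom_carre_du_champ kappa f g : Prop :=
  [/\ in_dom kappa f, in_dom kappa g & in_dom kappa (f \* g)].

Definition chain_rule kappa (phi : R -> R) f g : Prop :=
  \forall y \ae mu, carre_du_champ kappa (phi \o f) g y
                    = derive1 phi (f y) * carre_du_champ kappa f g y.

Definition nonneg_curvature kappa g : Prop :=
  forall s : R, 0 <= s ->
    let Psg := semigroup kappa s g in
    in_dom_carre_du_champ kappa Psg Psg /\
    \forall y \ae mu, carre_du_champ kappa Psg Psg y
                      <= semigroup kappa s (carre_du_champ kappa g g) y.

Definition l2_decay kappa (lam : R) : Prop :=
  0 <= lam /\
  forall (t : R) f, 0 <= t -> f \in Lfun mu 2%:E -> \int[mu]_y f y = 0 ->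
    (L2norm (semigroup kappa t f) <= (expR (- (lam * t)))%:E * L2norm f)%E.

Definition is_spectral_gap kappa (lam : R) : Prop :=
  l2_decay kappa lam /\ forall l, l2_decay kappa l -> l <= lam.

End semigroup.

Section process.
Context d d' (R : realType) (E : measurableType d) (Omega : measurableType d').
Context (mu : probability E R) (Pr : probability Omega R).
Implicit Types (kappa : R -> R.-pker E ~> E) (X : R -> {mfun Omega >-> E}).

(* sigma(X_u, 0 <= u <= s) *)
Definition past X (s : R) : set_system Omega :=
  <<s [set G | exists (u : R) B,
         [/\ 0 <= u <= s, measurable B & G = X u @^-1` B]] >>.

Definition right_past X (s : R) : set_system Omega :=
  \bigcap_(u in [set u | s < u]) past X u.

(* The Markov property is
     E[1_A(X_{s+t}) | F_s] = kappa_t(X_s, A)  a.s.,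
   tested against events G of F_s, where F_s is the right-continuous version of
   the natural filtration (as in the usual conditions).  As E carries no topology,
   this is what ties the point x to the laws of X_t for t > 0: it contains
   Blumenthal's zero-one law, and excludes a mu-negligible branching point x,
   from which the process would jump at time 0+ to a random position. *)
Definition markov_process kappa X (x : E) : Prop :=
  (\forall w \ae Pr, X 0 w = x) /\
  (forall s t : R, 0 <= s -> 0 <= t ->
    forall (G : set Omega) (A : set E), right_past X s G -> measurable A ->
      Pr (G `&` X (s + t) @^-1` A)
      = (\int[Pr]_(w in G) kappa t (X s w) A)%E).

Definition is_density (nu : probability E R) (f : E -> R) : Prop :=
  forall A, measurable A -> nu A = (\int[mu]_(y in A) (f y)%:E)%E.

(* As ln is total, log f in L^2(mu) has to be accompanied by f > 0 a.e. *)
Definition nonneg_curved_diffusion kappa X (x : E) : Prop :=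
  [/\ symmetric_markov_semigroup mu kappa,
      markov_process kappa X x
    & forall t : R, 0 < t -> exists f : E -> R,
        let g := @ln R \o f in
        [/\ is_density (distribution Pr (X t)) f,
            \forall y \ae mu, 0 < f y,
            [/\ in_dom mu kappa f, in_dom mu kappa g,
                in_dom mu kappa (f \* f), in_dom mu kappa (g \* g)
              & in_dom mu kappa (f \* g)],
            chain_rule mu kappa (@ln R) f g
          & nonneg_curvature mu kappa g]].

Local Open Scope ereal_scope.

Definition tv_to_equilibrium (nu : probability E R) : \bar R :=
  ereal_sup [set `|nu A - mu A| | A in measurable].

Definition mixing_time X (eps : R) : \bar R :=
  ereal_inf [set t%:E | t in
    [set t : R | (0 < t)%R /\
                 tv_to_equilibrium (distribution Pr (X t)) <= eps%:E]].

Definition mixing_window X (eps : R) : \bar R :=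
  mixing_time X eps - mixing_time X (1 - eps).

End process.

(* Main.v *)
Require Import Defs.
From mathcomp Require Import all_boot all_order all_algebra.
From mathcomp Require Import all_classical all_reals all_analysis.
From mathcomp Require Import lra ring measurable_realfun.
Import Order.TTheory GRing.Theory Num.Theory.
Import numFieldNormedType.Exports.
Local Open Scope classical_set_scope.
Local Open Scope ring_scope.

(* Let f_t be the density of X_t, D(t) the entropy of f_t and V(t) the variance of
   log f_t under the law of X_t.

   Interpolating s |-> P_s ((P_{a-s} g)^2), the curvature condition gives the local
   Poincare inequality P_a g^2 - (P_a g)^2 <= 2 a P_a (Gamma g).  It holds only
   mu-almost everywhere, whereas X starts from a point: it is integrated against
   the law of X_s, and then s tends to 0, where Blumenthal's zero-one law identifies
   the limit.  With g = log f_t this reads V(t) <= 2 t J(t), where J(t) is the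
   integral of Gamma(log f_t) under the law of X_t, and the chain rule makes J
   the dissipation rate of D.

   As long as the total variation distance is at most 1 - eps, Chebyshev's inequality
   yields eps D <= 1 + sqrt V, so that (eps D - 1)^2 <= - 2 t D'.  Integrating on
   [t0, t0 + s] gives D(t0 + s) <= 1/eps + 2 (t0 + s) / (eps^2 s).  From there, the
   spectral gap brings the distance below eps within time (1 + D) / (eps lambda),
   and s is optimized. *)

Set Implicit Arguments.
Unset Strict Implicit.
Unset Printing Implicit Defensive.

(** Almost everywhere inequalities are tested against indicators of measurable sets. The test
    function P_s 1_B need not lie in the domain of the generator, so the interpolation is not
    differentiated: one-sided difference estimates with an error [e * h] stand in for derivatives,
    here and for the entropy. The carre du champ is only known to be integrable, whereas the
    semigroup is symmetric on L2; symmetry and convergence are therefore extended to a bounded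
    function against an integrable one. When the local Poincare inequality at time t - s is
    integrated against the law of X_s, two of its three terms become integrals against the law of
    X_t, because P_(t-s) transports one law to the other. Only the integral of (P_(t-s) g)^2 keeps
    s. It is the second moment of the martingale P_(t-s) g (X_s), whose limit at time 0+ belongs to
    the right-continuous past at 0, where every event only sees the mean. The power eps^3 combines
    the eps^2 of the differential inequality for eps D - 1 with the eps of the spectral gap. *)

Section nonneg_induction.
Local Open Scope ereal_scope.
Context d (T : measurableType d) (R : realType).
Import HBNNSimple.

(** Monotone class induction: a nonnegative measurable function is an increasing limit of simple
    functions, each a finite nonnegative combination of indicators of its level sets. *)
Lemma nonneg_measurable_ind (P : (T -> \bar R) -> Prop) :
  (forall A, measurable A -> P (EFin \o \1_A)) ->
  (forall (r : R) f, (0 <= r)%R -> (forall x, 0 <= f x) ->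
    measurable_fun setT f -> P f -> P (fun x => r%:E * f x)) ->
  (forall f g, (forall x, 0 <= f x) -> (forall x, 0 <= g x) ->
    measurable_fun setT f -> measurable_fun setT g -> P f -> P g ->
    P (f \+ g)) ->
  (forall (F : (T -> \bar R)^nat), (forall n x, 0 <= F n x) ->
    (forall n, measurable_fun setT (F n)) ->
    (forall x, nondecreasing_seq (F ^~ x)) -> (forall n, P (F n)) ->
    P (fun x => limn (F ^~ x))) ->
  forall f, (forall x, 0 <= f x) -> measurable_fun setT f -> P f.
Proof.
move=> Pind Pscale Padd Plim f f0 mf.
pose F := nnsfun_approx measurableT mf.
have -> : f = (fun x => limn (fun n => (F n x)%:E)).
  by apply/funext => x; apply/esym/cvg_lim => //; exact: cvg_nnsfun_approx.
apply: (Plim (fun n => EFin \o F n)).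
- by move=> n x /=; rewrite lee_fin.
- by move=> n; exact/measurable_EFinP.
- by move=> x m n mn; rewrite /= lee_fin; exact/lefP/nd_nnsfun_approx.
move=> n.
pose s : seq R := finmap.enum_fset (fset_set (range (F n))).
have -> : EFin \o F n = (fun x => \sum_(i < size s) (s`_i)%:E
    * (\1_((F n) @^-1` [set s`_i]) x)%:E).
  apply/funext => x /=; rewrite [in LHS]fimfunE -fsumEFin//.
  rewrite fsbig_finite//= (big_nth 0%R) big_mkord.
  by apply: eq_bigr => i _; rewrite EFinM.
have step (s' : seq R) : (forall r, r \in s' -> (0 <= r)%R) ->
    P (fun x => \sum_(i < size s') (s'`_i)%:E
         * (\1_((F n) @^-1` [set s'`_i]) x)%:E).
  (* The list grows at its end, so that the last summand splits off; the empty sum is the indicator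
     of the empty set. *)
  elim/last_ind: s' => [_|{}s r IH sr].
    under eq_fun do rewrite big_ord0.
    by have := Pind set0 measurable0; rewrite indic0.
  rewrite size_rcons.
  have -> : (fun x => \sum_(i < (size s).+1) ((rcons s r)`_i)%:E
         * (\1_((F n) @^-1` [set (rcons s r)`_i]) x)%:E) =
     (fun x => \sum_(i < size s) (s`_i)%:E
         * (\1_((F n) @^-1` [set s`_i]) x)%:E)
     \+ (fun x => r%:E * (EFin \o (\1_((F n) @^-1` [set r]))) x).
    apply/funext => x; rewrite big_ord_recr/=; congr (_ + _).
      by apply: eq_bigr => i _; rewrite nth_rcons ltn_ord.
    by rewrite nth_rcons ltnn eqxx.
  have s0 r' : r' \in s -> (0 <= r')%R.
    by move=> r's; apply: sr; rewrite mem_rcons inE r's orbT.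
  have r0 : (0 <= r)%R by apply: sr; rewrite mem_rcons inE eqxx.
  have mI (A : set R) : measurable A -> measurable_fun setT (EFin \o \1_(F n @^-1` A) : T -> \bar R).
    move=> mA; apply/measurable_EFinP; apply: measurable_indic.
    by rewrite -[X in measurable X]setTI; exact: measurable_funP.
  apply: Padd.
  - move=> x; apply: sume_ge0 => i _; rewrite mule_ge0// lee_fin// s0//.
    exact: mem_nth.
  - by move=> x; rewrite mule_ge0// lee_fin.
  - by apply: emeasurable_sum => i; apply: measurable_funeM; exact: mI.
  - by apply: measurable_funeM; exact: mI.
  - exact: IH.
  apply: Pscale => //; first by move=> x; rewrite lee_fin.
    exact: mI.
  by apply: Pind; rewrite -[X in measurable X]setTI; exact: measurable_funP.
apply: step => r.
by rewrite in_fset_set// inE => -[x _ <-].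
Qed.

End nonneg_induction.

(** * Integration against a weighted mixture of measures *)

Section integral_mixture.
Local Open Scope ereal_scope.
Context d d' (S : measurableType d) (T : measurableType d') (R : realType).
Variables (m : {measure set S -> \bar R}) (w : S -> R)
  (k : S -> {measure set T -> \bar R}) (nu : {measure set T -> \bar R}).
Hypothesis w0 : forall y, (0 <= w y)%R.
Hypothesis mw : measurable_fun setT w.
Hypothesis mk : forall A, measurable A -> measurable_fun setT (k ^~ A).
Hypothesis nuE : forall A, measurable A ->
  nu A = \int[m]_y ((w y)%:E * k y A).

Let I (q : T -> \bar R) y := (w y)%:E * \int[k y]_x q x.

Let I_ge0 q : (forall x, 0 <= q x) -> forall y, 0 <= I q y.
Proof. by move=> q0 y; rewrite mule_ge0 ?lee_fin ?integral_ge0. Qed.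

Let measurable_I q : (forall x, 0 <= q x) -> measurable_fun setT q ->
  measurable_fun setT (I q).
Proof.
move=> q0 mq; apply: emeasurable_funM; first exact/measurable_EFinP.
exact: measurable_fun_integral_kernel.
Qed.

(** The weight and the kernel are both kept general because three cases are used: weight 1 for the
    composition of kernels, Dirac kernels for a density, and the indicator of an event as weight for
    the Markov property. *)
Lemma integral_mixture (q : T -> \bar R) : (forall x, 0 <= q x) ->
  measurable_fun setT q ->
  \int[nu]_x q x = \int[m]_y ((w y)%:E * \int[k y]_x q x).
Proof.
rewrite -/(I q).
move: q; apply: nonneg_measurable_ind.
- move=> A mA; rewrite integral_indic// setIT nuE//.
  by apply: eq_integral => y _; rewrite integral_indic// setIT.
- move=> r f r0 f0 mf fE.
  rewrite (ge0_integralZl_EFin _ measurableT (fun x _ => f0 x) mf r0) fE.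
  rewrite -(ge0_integralZl_EFin _ measurableT (fun y _ => I_ge0 f0 y)
    (measurable_I f0 mf) r0).
  apply: eq_integral => y _.
  rewrite (ge0_integralZl_EFin _ measurableT (fun x _ => f0 x) mf r0).
  by rewrite muleCA.
- move=> f g f0 g0 mf mg fE gE.
  rewrite (ge0_integralD _ measurableT (fun x _ => f0 x) mf (fun x _ => g0 x) mg).
  rewrite fE gE -(ge0_integralD _ measurableT (fun y _ => I_ge0 f0 y)
    (measurable_I f0 mf) (fun y _ => I_ge0 g0 y) (measurable_I g0 mg)).
  apply: eq_integral => y _.
  rewrite (ge0_integralD _ measurableT (fun x _ => f0 x) mf (fun x _ => g0 x) mg).
  have := @integral_ge0 _ _ _ (k y) setT f (fun x _ => f0 x).
  have := @integral_ge0 _ _ _ (k y) setT g (fun x _ => g0 x).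
  rewrite /I; move: (integral (k y) setT f) (integral (k y) setT g) => a b b0 a0.
  by rewrite ge0_muleDr.
- move=> F F0 mF ndF FE.
  have ndI q1 q2 : (forall x, 0 <= q1 x) -> measurable_fun setT q1 ->
      measurable_fun setT q2 -> (forall x, q1 x <= q2 x) -> forall y,
      \int[k y]_x q1 x <= \int[k y]_x q2 x.
    by move=> q10 mq1 mq2 q12 y; exact: ge0_le_integral.
  rewrite (monotone_convergence _ measurableT mF (fun n x _ => F0 n x)
    (fun x _ => ndF x)).
  have -> : (fun n => \int[nu]_x F n x) = (fun n => \int[m]_y I (F n) y).
    by apply/funext => n; rewrite FE.
  rewrite -(@monotone_convergence _ _ _ m setT measurableT (fun n => I (F n))).
  + apply: eq_integral => y _.
    rewrite (monotone_convergence _ measurableT mF (fun n x _ => F0 n x)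
      (fun x _ => ndF x)).
    rewrite -limeMl//.
    apply: ereal_nondecreasing_is_cvgn => n1 n2 n12.
    by apply: ndI => // x; exact: ndF.
  + by move=> n; exact: measurable_I.
  + by move=> n y _; exact: I_ge0.
  + move=> y _ n1 n2 n12; apply: lee_wpmul2l; first by rewrite lee_fin.
    by apply: ndI => // x; exact: ndF.
Qed.

End integral_mixture.

Notation "m .-L1 f" := (integrable m setT (EFin \o f)) (at level 2, f at level 9).

(** * Real-valued integrals and almost everywhere comparison *)

Section real_integrals.
Context d (T : measurableType d) (R : realType) (m : {measure set T -> \bar R}).
Implicit Types f g : T -> R.

Lemma L1_measurable f : m.-L1 f -> measurable_fun setT f.
Proof. by move=> /measurable_int /measurable_EFinP. Qed.

Lemma L1D f g : m.-L1 f -> m.-L1 g -> m.-L1 (fun x => f x + g x).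
Proof. by move=> mf mg; exact: (integrableD measurableT mf mg). Qed.

Lemma L1B f g : m.-L1 f -> m.-L1 g -> m.-L1 (fun x => f x - g x).
Proof. by move=> mf mg; exact: (integrableB measurableT mf mg). Qed.

Lemma L1Z (r : R) f : m.-L1 f -> m.-L1 (fun x => r * f x).
Proof. by move=> mf; exact: (integrableZl measurableT r mf). Qed.

Lemma L1_norm f : m.-L1 f -> m.-L1 (fun x => `|f x|).
Proof. by move=> mf; exact: (integrable_abse mf). Qed.

Lemma L1_le f g : measurable_fun setT f -> m.-L1 g ->
  (forall x, `|f x| <= g x) -> m.-L1 f.
Proof.
move=> mf ig fg; apply: (le_integrable measurableT _ _ ig).
  exact/measurable_EFinP.
by move=> x _ /=; rewrite lee_fin (le_trans (fg x))// ler_norm.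
Qed.

Lemma L1_ae_eq f g : measurable_fun setT g -> m.-L1 f ->
  (\forall x \ae m, f x = g x) -> m.-L1 g.
Proof.
move=> mg /integrableP[mf fi] fg; apply/integrableP; split.
  exact/measurable_EFinP.
rewrite (@ae_eq_integral _ _ _ m setT (fun x => `|(f x)%:E|)%E)//.
- by apply: measurableT_comp => //; exact/measurable_EFinP.
- exact: measurableT_comp mf.
- by apply: filterS fg => x fgx _ /=; rewrite fgx.
Qed.

Lemma L1_ae_dom f g : measurable_fun setT f -> m.-L1 g ->
  (\forall x \ae m, `|f x| <= g x) -> m.-L1 f.
Proof.
move=> mf /integrableP[mg gi] fg; have mfE : measurable_fun setT (EFin \o f).
  exact/measurable_EFinP.
apply/integrableP; split => //; apply: le_lt_trans gi.
apply: ae_ge0_le_integral => //.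
- exact: measurableT_comp.
- exact: measurableT_comp.
- by apply: filterS fg => x fgx _ /=; rewrite lee_fin (le_trans fgx)// ler_norm.
Qed.

Lemma EFin_Rintegral f : m.-L1 f -> (\int[m]_x f x)%:E = (\int[m]_x (f x)%:E)%E.
Proof. by move=> fi; rewrite /Rintegral fineK//; exact: integrable_fin_num. Qed.

Lemma ae_eq_Rintegral f g : measurable_fun setT f -> measurable_fun setT g ->
  (\forall x \ae m, f x = g x) -> \int[m]_x f x = \int[m]_x g x.
Proof.
move=> mf mg fg; congr fine; apply: ae_eq_integral => //.
- exact/measurable_EFinP.
- exact/measurable_EFinP.
- by apply: filterS fg => x fgx _ /=; rewrite fgx.
Qed.

Lemma ae_le_Rintegral f g : m.-L1 f -> m.-L1 g ->
  (\forall x \ae m, f x <= g x) -> \int[m]_x f x <= \int[m]_x g x.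
Proof.
move=> fi gi fg.
have mf := L1_measurable fi; have mg := L1_measurable gi.
(* The maximum of f and g agrees with g almost everywhere and dominates f at every point, as
   [le_Rintegral] demands. *)
have mx : measurable_fun setT (fun x => Num.max (f x) (g x)).
  exact: measurable_maxr.
have xg : (\forall x \ae m, g x = Num.max (f x) (g x)).
  by apply: filterS fg => x fgx; rewrite max_r.
rewrite (ae_eq_Rintegral mg mx xg); apply: le_Rintegral => //.
  exact: L1_ae_eq xg.
by move=> x _; rewrite le_max lexx.
Qed.

Lemma Rintegral_eq0_ae f : m.-L1 f -> (\forall x \ae m, 0 <= f x) ->
  \int[m]_x f x = 0 -> \forall x \ae m, f x = 0.
Proof.
move=> fi f0 If.
have mf := L1_measurable fi.
have : (\int[m]_x `|(f x)%:E|)%E = 0%E.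
  rewrite (@ae_eq_integral _ _ _ m setT (fun x => (f x)%:E))//.
  - by rewrite -EFin_Rintegral// If.
  - by apply: measurableT_comp => //; exact/measurable_EFinP.
  - exact/measurable_EFinP.
  - by apply: filterS f0 => x fx0 _ /=; rewrite ger0_norm.
have mfE : measurable_fun setT (EFin \o f) by exact/measurable_EFinP.
move=> /(ae_eq_integral_abs m measurableT mfE).1.
by apply: filterS => x /(_ I) [].
Qed.

Lemma RintegralN f : m.-L1 f -> \int[m]_x (- f x) = - \int[m]_x f x.
Proof.
move=> fi; rewrite -mulN1r -RintegralZl//.
by apply: eq_Rintegral => x _; rewrite mulN1r.
Qed.

Lemma dominated_Rintegral_cvg (F : nat -> T -> R) f g :
  (forall n, measurable_fun setT (F n)) -> measurable_fun setT f -> m.-L1 g ->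
  (\forall x \ae m, F ^~ x @ \oo --> f x) ->
  (\forall x \ae m, forall n, `|F n x| <= g x) ->
  m.-L1 f /\ \int[m]_x F n x @[n --> \oo] --> \int[m]_x f x.
Proof.
move=> mF mf gi Ff Fg.
have [] := @dominated_convergence _ _ _ m setT measurableT
  (fun n => EFin \o F n) (EFin \o f) (EFin \o g).
- by move=> n; exact/measurable_EFinP.
- exact/measurable_EFinP.
- by apply: filterS Ff => x Ffx _; apply/cvg_EFin => //; exact: nearW.
- exact: gi.
- by apply: filterS Fg => x Fgx n _ /=; rewrite lee_fin.
move=> fi _ FI; split => //.
by apply: fine_cvg; rewrite EFin_Rintegral.
Qed.

End real_integrals.

(** * Square-integrable functions with a real-valued norm *)

Section L2.
Context d (T : measurableType d) (R : realType) (m : {measure set T -> \bar R}).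
Implicit Types f g h : T -> R.

Definition L2 f := measurable_fun setT f /\ m.-L1 (fun x => f x ^+ 2).

Definition norm2 f : R := Num.sqrt (\int[m]_x (f x ^+ 2)).

Lemma norm2_ge0 f : 0 <= norm2 f. Proof. exact: sqrtr_ge0. Qed.

Lemma sqr_norm2 f : norm2 f ^+ 2 = \int[m]_x (f x ^+ 2).
Proof. by rewrite sqr_sqrtr// Rintegral_ge0// => x _; exact: sqr_ge0. Qed.

Lemma L2P f : f \in Lfun m 2%:E <-> L2 f.
Proof.
split.
  move=> fL; split; last exact: Lfun2_integrable_sqr.
  by move: fL => /sub_Lfun_mfun; rewrite inE.
move=> [mf fi]; apply/andP; split; rewrite inE//=.
rewrite /finite_norm unlock; apply: poweR_lty.
under eq_integral do rewrite abse_EFin poweR_EFin powR_mulrn// real_normK ?num_real//.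
exact: integrable_lty.
Qed.

Lemma L2normE f : L2 f -> ('N[m]_(2%:E)[EFin \o f])%E = (norm2 f)%:E.
Proof.
move=> [mf fi]; rewrite unlock.
under eq_integral do rewrite abse_EFin poweR_EFin powR_mulrn// real_normK ?num_real//.
rewrite -EFin_Rintegral// poweR_EFin powR12_sqrt//.
by apply: Rintegral_ge0 => x _; exact: sqr_ge0.
Qed.

Lemma L2_mul f g : L2 f -> L2 g -> m.-L1 (fun x => f x * g x).
Proof.
move=> [mf fi] [mg gi]; apply: (L1_le _ (L1D fi gi)).
  exact: measurable_funM.
by move=> x; rewrite normrM -(real_normK (num_real (f x)))
  -(real_normK (num_real (g x))); nra.
Qed.

Lemma L2D f g : L2 f -> L2 g -> L2 (fun x => f x + g x).
Proof.
move=> lf lg; split.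
  by apply: measurable_funD; [exact: lf.1|exact: lg.1].
have := L1D (L1D lf.2 lg.2) (L1Z 2 (L2_mul lf lg)).
by congr (integrable _ _ _); apply/funext => x /=; congr EFin; ring.
Qed.

Lemma L2Z r f : L2 f -> L2 (fun x => r * f x).
Proof.
move=> lf; split; first by apply: measurable_funM => //; exact: lf.1.
have := L1Z (r ^+ 2) lf.2.
by congr (integrable _ _ _); apply/funext => x /=; congr EFin; ring.
Qed.

Lemma L2B f g : L2 f -> L2 g -> L2 (fun x => f x - g x).
Proof.
move=> lf lg; have := L2D lf (L2Z (-1) lg).
by congr L2; apply/funext => x; rewrite mulN1r.
Qed.

Lemma norm2_ae_eq f g : measurable_fun setT f -> measurable_fun setT g ->
  (\forall x \ae m, f x = g x) -> norm2 f = norm2 g.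
Proof.
move=> mf mg fg; congr Num.sqrt; apply: ae_eq_Rintegral.
- exact: measurable_funX.
- exact: measurable_funX.
- by apply: filterS fg => x ->.
Qed.

Lemma Cauchy_Schwarz f g : L2 f -> L2 g ->
  `|\int[m]_x (f x * g x)| <= norm2 f * norm2 g.
Proof.
move=> lf lg.
set a := \int[m]_x (f x ^+ 2); set b := \int[m]_x (g x ^+ 2).
set c := \int[m]_x (f x * g x).
have a0 : 0 <= a by apply: Rintegral_ge0 => x _; exact: sqr_ge0.
have b0 : 0 <= b by apply: Rintegral_ge0 => x _; exact: sqr_ge0.
have quad (s t : R) : 0 <= s ^+ 2 * a + 2 * (s * t) * c + t ^+ 2 * b.
  rewrite /a /b /c -RintegralZl//; last exact: lf.2.
  rewrite -RintegralZl//; last exact: L2_mul.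
  rewrite -RintegralZl//; last exact: lg.2.
  rewrite -RintegralD//; [|exact: L1Z lf.2|by apply: L1Z; exact: L2_mul].
  rewrite -RintegralD//; last first.
  - exact: L1Z lg.2.
  - by apply: L1D; [exact: L1Z lf.2|by apply: L1Z; exact: L2_mul].
  apply: Rintegral_ge0 => x _.
  have -> : s ^+ 2 * f x ^+ 2 + 2 * (s * t) * (f x * g x) + t ^+ 2 * g x ^+ 2 =
    (s * f x + t * g x) ^+ 2 by ring.
  exact: sqr_ge0.
have cab : c ^+ 2 <= a * b.
  have [b_eq0|b_neq0] := eqVneq b 0.
    (* When b = 0 the form takes the value - c ^+ 2 here, which forces c = 0. Otherwise its value at
       (b, - c) is b times the discriminant. *)
    have := quad c (- (a + 1) / 2).
    rewrite b_eq0 mulr0; have : 0 <= c ^+ 2 by exact: sqr_ge0.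
    nra.
  have := quad b (- c).
  have b_gt0 : 0 < b by rewrite lt_neqAle eq_sym b_neq0.
  have -> : b ^+ 2 * a + 2 * (b * - c) * c + (- c) ^+ 2 * b = b * (a * b - c ^+ 2).
    by ring.
  by rewrite pmulr_rge0// subr_ge0.
by rewrite -sqrtr_sqr -sqrtrM//; exact: ler_wsqrtr.
Qed.

Lemma norm2D f g : L2 f -> L2 g -> norm2 (fun x => f x + g x) <= norm2 f + norm2 g.
Proof.
move=> lf lg.
have fg0 : 0 <= norm2 f + norm2 g by rewrite addr_ge0// norm2_ge0.
rewrite -(ler_pXn2r (ltn0Sn 1)) ?nnegrE ?norm2_ge0// sqr_norm2.
under eq_Rintegral do rewrite sqrrD.
have lfg := L2_mul lf lg.
have lfg2 : m.-L1 (fun x => f x * g x *+ 2).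
  by under eq_fun do rewrite -mulr_natl; exact: L1Z.
rewrite RintegralD//; [|exact: L1D lf.2 lfg2|exact: lg.2].
rewrite RintegralD//; last exact: lf.2.
rewrite sqrrD !sqr_norm2 lerD2r lerD2l.
under eq_Rintegral do rewrite -mulr_natl.
rewrite RintegralZl// mulr_natl lerMn2r /=.
exact: le_trans (ler_norm _) (Cauchy_Schwarz lf lg).
Qed.

End L2.

Section L2_finite.
Context d (T : measurableType d) (R : realType) (m : {finite_measure set T -> \bar R}).
Implicit Types f g : T -> R.

Lemma L1_cst (r : R) : m.-L1 (fun _ => r).
Proof. exact: finite_measure_integrable_cst. Qed.

Lemma L1_bounded f (C : R) : measurable_fun setT f -> (forall x, `|f x| <= C) -> m.-L1 f.
Proof. by move=> mf fC; apply: L1_le (L1_cst C) fC. Qed.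

Lemma L2_bounded f (C : R) : measurable_fun setT f -> (forall x, `|f x| <= C) -> L2 m f.
Proof.
move=> mf fC; split => //; apply: (@L1_bounded _ (C ^+ 2)).
  exact: measurable_funX.
move=> x; rewrite normrX ler_pXn2r ?nnegrE//.
exact: le_trans (fC x).
Qed.

Lemma L2_cst r : L2 m (fun _ => r).
Proof. by apply: (@L2_bounded _ `|r|). Qed.

Lemma L2_L1 f : L2 m f -> m.-L1 f.
Proof.
move=> lf; have := L2_mul lf (L2_cst 1).
by congr (integrable _ _ _); apply/funext => x /=; rewrite mulr1.
Qed.

End L2_finite.

Section L1_bounded.
Context d (T : measurableType d) (R : realType) (m : {measure set T -> \bar R}).
Implicit Types f g : T -> R.

Lemma L1_mul_bounded f g (C : R) : measurable_fun setT f -> (forall x, `|f x| <= C) ->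
  m.-L1 g -> m.-L1 (fun x => f x * g x).
Proof.
move=> mf fC gi; apply: L1_le (L1Z C (L1_norm gi)) _.
  by apply: measurable_funM => //; exact: L1_measurable gi.
by move=> x; rewrite normrM ler_wpM2r.
Qed.

Lemma L2_mul_bounded f g (C : R) : measurable_fun setT f -> (forall x, `|f x| <= C) ->
  L2 m g -> L2 m (fun x => f x * g x).
Proof.
move=> mf fC [mg gi]; split; first exact: measurable_funM.
have -> : (fun x => (f x * g x) ^+ 2) = (fun x => f x ^+ 2 * g x ^+ 2).
  by apply/funext => x; rewrite exprMn.
apply: (@L1_mul_bounded _ _ (C ^+ 2)) => //; first exact: measurable_funX.
by move=> x; rewrite normrX ler_pXn2r ?nnegrE//; exact: le_trans (fC x).
Qed.

End L1_bounded.

(** * Monotonicity from one-sided difference estimates *)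

Section dini.
Context (R : realType).

Lemma near_right0P (P : R -> Prop) : (\forall h \near 0^'+, P h) <->
  exists2 delta, 0 < delta & forall h, 0 < h < delta -> P h.
Proof.
split.
  move=> [delta /= delta0 H]; exists delta => // h /andP[h0 hd].
  by apply: H => //=; rewrite sub0r normrN gtr0_norm.
move=> [delta delta0 H]; exists delta => //= h hd h0; apply: H.
by move: hd; rewrite /ball_/= sub0r normrN gtr0_norm// h0.
Qed.

(** If G rises by more than e (b - a), consider the supremum c of the points s with G b - G s > e (b
    - s). Semicontinuity from the right shows that c is not such a point; the left estimate at c
    then excludes the points just before c as well, against the choice of c. *)
Lemma dini_le (a b : R) (G : R -> R) : a <= b ->
  (forall t, a < t <= b -> forall e, 0 < e ->
    \forall h \near 0^'+, G t - G (t - h) <= e * h) ->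
  (forall t, a <= t < b -> forall e, 0 < e ->
    \forall h \near 0^'+, G (t + h) <= G t + e) ->
  G b <= G a.
Proof.
move=> ab left right; apply/ler_addgt0Pr => e' e'0.
(* The added 1 keeps the denominator positive when a = b. *)
set e := e' / (b - a + 1).
have ba0 : 0 < b - a + 1 by lra.
have e0 : 0 < e by rewrite divr_gt0.
suff : G b - G a <= e * (b - a).
  have : e * (b - a) <= e'.
    by rewrite /e mulrAC ler_pdivrMr// ler_wpM2l ?(ltW e'0)//; lra.
  lra.
rewrite leNgt; apply/negP => bada.
pose B := [set s | a <= s <= b /\ e * (b - s) < G b - G s].
have Ba : B a by split => //; rewrite lexx.
have Bs : has_sup B by split; [exists a|exists b => s [/andP[]]].
set c := sup B.
have ac : a <= c by apply: ub_le_sup => //; exact: Bs.2.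
have cb : c <= b by apply: ge_sup; [exists a|move=> s [/andP[]]].
have notB s : c < s -> s <= b -> G b - G s <= e * (b - s).
  move=> cs sb; rewrite leNgt; apply/negP => Bs'.
  have : s <= c by apply: ub_le_sup; [exact: Bs.2|split => //; rewrite sb andbT; lra].
  lra.
have nBc : G b - G c <= e * (b - c).
  have [->|cneqb] := eqVneq c b; first by rewrite !subrr mulr0.
  have cltb : c < b by rewrite lt_neqAle cneqb.
  have acb : a <= c < b by rewrite ac.
  rewrite lerBlDr; apply/ler_addgt0Pr => e1 e10.
  have [delta delta0 H] := (near_right0P _).1 (right c acb e1 e10).
  set h := Num.min (delta / 2) (b - c).
  have h0 : 0 < h by rewrite lt_min; apply/andP; split; lra.
  have hd : h < delta by rewrite /h gt_min; apply/orP; left; lra.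
  have hb : h <= b - c by rewrite /h ge_min lexx orbT.
  have := H h; rewrite h0 hd => /(_ isT) H1.
  have := notB (c + h).
  have -> : c < c + h by lra.
  have -> : c + h <= b by lra.
  move=> /(_ isT isT).
  have : e * (b - (c + h)) <= e * (b - c) by rewrite ler_pM2l//; lra.
  lra.
have ca : a < c.
  rewrite lt_neqAle ac andbT; apply/eqP => E; move: nBc; rewrite -E; lra.
have acb : a < c <= b by rewrite ca.
have [delta delta0 H] := (near_right0P _).1 (left c acb e e0).
have [s [/andP[sa sb] Bs'] cds] := sup_adherent delta0 Bs.
rewrite -/c in cds.
have sc : s <= c by apply: ub_le_sup; [exact: Bs.2|split => //; rewrite sa].
have {sc} sc : s < c.
  rewrite lt_neqAle sc andbT; apply/eqP => E; move: nBc; rewrite -E; lra.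
have := H (c - s); have -> : c - (c - s) = s by ring.
have -> : 0 < c - s < delta by apply/andP; split; lra.
move=> /(_ isT); lra.
Qed.

Lemma mulr_frac_le (a e : R) : 0 <= a -> 0 <= e -> a * (e / (a + 1)) <= e.
Proof.
move=> a0 e0; rewrite mulrA ler_pdivrMr; last lra.
by rewrite mulrDr mulr1 mulrC lerDl.
Qed.

End dini.

(** * Limits of integrals along L2 convergence *)

Section L2_limits.
Context d (T : measurableType d) (R : realType) (m : {finite_measure set T -> \bar R}).
Context (I : Type) (F : set_system I) {FF : ProperFilter F}.

Lemma L1_approx_bounded (b : T -> R) : m.-L1 b -> forall e : R, 0 < e ->
  exists b' : T -> R, [/\ measurable_fun setT b',
    exists C : R, forall x, `|b' x| <= C & \int[m]_x `|b x - b' x| <= e].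
Proof.
move=> bi e e0.
have mb := L1_measurable bi.
pose A n := [set x | `|b x| <= n%:R].
have mA n : measurable (A n).
  rewrite -[A n]setTI; apply: measurable_fun_le => //.
  exact: measurableT_comp.
pose B n x : R := b x * \1_(A n) x.
have mB n : measurable_fun setT (B n).
  by apply: measurable_funM => //; exact: measurable_indic.
have le1 n x : 0 <= (\1_(A n) x : R) <= 1.
  by rewrite indicE; case: (x \in A n); rewrite ?lexx ler01.
have [|||||_] := @dominated_Rintegral_cvg _ _ _ m (fun n x => `|b x - B n x|) (cst 0)
  (fun x => `|b x|).
- move=> n; apply: measurableT_comp => //; exact: measurable_funB.
- exact: measurable_cst.
- exact: L1_norm.
- apply: aeW => x; rewrite [X in _ --> X](_ : _ = 0)//.
  apply: cvg_near_cst; near=> n.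
  have Anx : x \in A n.
    rewrite inE /A/=; near: n; exact: nbhs_infty_ger.
  by rewrite /B indicE Anx mulr1 subrr normr0.
- apply: aeW => x n; rewrite normr_id /B.
  have -> : b x - b x * \1_(A n) x = b x * (1 - \1_(A n) x) by ring.
  rewrite normrM ler_piMr// ger0_norm; have /andP[] := le1 n x; lra.
rewrite [X in _ --> X -> _](_ : _ = 0); last by rewrite /Rintegral integral0.
move=> /cvgr0Pnorm_le /(_ e e0) [N _ /(_ N)] /= => /(_ (leqnn N)) H.
exists (B N); split => //; last first.
  by apply: le_trans H; rewrite ger0_norm// Rintegral_ge0.
exists N%:R => x; rewrite /B indicE.
have [/set_mem xA|xA] := boolP (x \in A N); first by rewrite mulr1.
by rewrite mulr0 normr0.
Unshelve. all: by end_near. Qed.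

(** As b is merely integrable, L2 convergence of u cannot be paired with it directly. A bounded b'
    replaces b up to a small L1 error, which is multiplied by at most 2 C. *)
Lemma bounded_L2_cvg_integral (u : I -> T -> R) (u0 b : T -> R) (C : R) :
  (forall i, measurable_fun setT (u i)) -> (forall i x, `|u i x| <= C) ->
  measurable_fun setT u0 -> (forall x, `|u0 x| <= C) ->
  norm2 m (fun x => u i x - u0 x) @[i --> F] --> 0 -> m.-L1 b ->
  \int[m]_x (u i x * b x) @[i --> F] --> \int[m]_x (u0 x * b x).
Proof.
move=> mu uC mu0 u0C ucvg bi.
have C0 : 0 <= C := le_trans (normr_ge0 _) (u0C point).
apply/cvgrPdistC_le => e e0.
have half n : 0 <= n -> e / (2 * (n + 1)) * n <= e / 2.
  move=> n0; rewrite mulrAC ler_pdivrMr; last lra.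
  have -> : e / 2 * (2 * (n + 1)) = e * n + e by field.
  lra.
pose e1 := e / (2 * (2 * C + 1)).
have e10 : 0 < e1 by rewrite divr_gt0//; lra.
have [b' [mb' [K b'K] bb']] := L1_approx_bounded bi e10.
have lb' : L2 m b' := L2_bounded m mb' b'K.
have ib' : m.-L1 b' := L2_L1 lb'.
have K0 : 0 <= norm2 m b' by exact: norm2_ge0.
pose e2 := e / (2 * (norm2 m b' + 1)).
have e20 : 0 < e2 by rewrite divr_gt0//; lra.
move/cvgr0Pnorm_le : ucvg => /(_ _ e20); apply: filterS => i Hi.
have lui : L2 m (u i) := L2_bounded m (mu i) (uC i).
have lu0 : L2 m u0 := L2_bounded m mu0 u0C.
have mub i' : m.-L1 (fun x => u i' x * b x) by exact: (L1_mul_bounded (mu i') (uC i')).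
have mu0b : m.-L1 (fun x => u0 x * b x) by exact: (L1_mul_bounded mu0 u0C).
rewrite -RintegralB//.
have duC x : `|u i x - u0 x| <= 2 * C.
  by apply: le_trans (ler_normB _ _) _; have := uC i x; have := u0C x; lra.
have mdu : measurable_fun setT (fun x => u i x - u0 x) by exact: measurable_funB.
have i1 : m.-L1 (fun x => (u i x - u0 x) * b' x).
  exact: (L1_mul_bounded mdu duC).
have i2 : m.-L1 (fun x => (u i x - u0 x) * (b x - b' x)).
  by apply: (L1_mul_bounded mdu duC); exact: L1B.
have -> : \int[m]_x (u i x * b x - u0 x * b x) =
    \int[m]_x ((u i x - u0 x) * b' x + (u i x - u0 x) * (b x - b' x)).
  by apply: eq_Rintegral => x _; ring.
rewrite RintegralD//.
apply: le_trans (ler_normD _ _) _.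
have h1 : `|\int[m]_x ((u i x - u0 x) * b' x)| <= e / 2.
  apply: le_trans (Cauchy_Schwarz (L2_bounded m mdu duC) lb') _.
  rewrite ger0_norm ?norm2_ge0// in Hi.
  apply: le_trans (ler_wpM2r K0 Hi) _.
  exact: half.
have h2 : `|\int[m]_x ((u i x - u0 x) * (b x - b' x))| <= e / 2.
  apply: le_trans (le_normr_Rintegral measurableT i2) _.
  have i3 : m.-L1 (fun x => `|b x - b' x|) by apply: L1_norm; exact: L1B.
  apply: (@le_trans _ _ (\int[m]_x (2 * C * `|b x - b' x|))).
    apply: le_Rintegral => //; [exact: L1_norm|exact: L1Z|].
    by move=> x _; rewrite normrM ler_wpM2r.
  rewrite RintegralZl//.
  apply: (@le_trans _ _ (2 * C * e1)); first by rewrite ler_wpM2l//; lra.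
  by rewrite mulrC; apply: half; lra.
lra.
Qed.

Lemma L2_cvg_inner (u v : I -> T -> R) (u0 v0 : T -> R) :
  (\forall i \near F, L2 m (u i)) -> L2 m u0 ->
  (\forall i \near F, L2 m (v i)) -> L2 m v0 ->
  norm2 m (fun x => u i x - u0 x) @[i --> F] --> 0 ->
  norm2 m (fun x => v i x - v0 x) @[i --> F] --> 0 ->
  \int[m]_x (u i x * v i x) @[i --> F] --> \int[m]_x (u0 x * v0 x).
Proof.
move=> lu lu0 lv lv0 cu cv.
apply/subr_cvg0.
pose rhs i := norm2 m (fun x => u i x - u0 x) * norm2 m (fun x => v i x - v0 x)
  + norm2 m (fun x => u i x - u0 x) * norm2 m v0
  + norm2 m u0 * norm2 m (fun x => v i x - v0 x).
have rhs0 : rhs i @[i --> F] --> 0.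
  rewrite [X in _ --> X](_ : _ = 0 * 0 + 0 * norm2 m v0 + norm2 m u0 * 0); last ring.
  by apply: cvgD; [apply: cvgD|]; apply: cvgM => //; exact: cvg_cst.
apply/norm_cvg0P; apply: (squeeze_cvgr _ (cvg_cst 0) rhs0).
apply: filterS2 lu lv => i lui lvi; rewrite normr_ge0/=.
have du := L2B lui lu0; have dv := L2B lvi lv0.
rewrite -RintegralB//; [|exact: L2_mul|exact: L2_mul].
have -> : \int[m]_x (u i x * v i x - u0 x * v0 x) =
   \int[m]_x ((u i x - u0 x) * (v i x - v0 x) + (u i x - u0 x) * v0 x
    + u0 x * (v i x - v0 x)).
  by apply: eq_Rintegral => x _; ring.
have i1 := L2_mul du dv; have i2 := L2_mul du lv0; have i3 := L2_mul lu0 dv.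
rewrite RintegralD//; last exact: L1D.
rewrite RintegralD//.
apply: le_trans (ler_normD _ _) _; apply: lerD; last exact: Cauchy_Schwarz.
by apply: le_trans (ler_normD _ _) _; apply: lerD; exact: Cauchy_Schwarz.
Qed.

End L2_limits.

(** * Fubini for mixtures and integrable functions *)

Section mixture_L1.
Context d d' (S : measurableType d) (T : measurableType d') (R : realType).
Variables (m : {measure set S -> \bar R})
  (k : S -> {measure set T -> \bar R}) (nu : {measure set T -> \bar R}).
Hypothesis mk : forall A, measurable A -> measurable_fun setT (k ^~ A).
Hypothesis nuE : forall A, measurable A -> nu A = (\int[m]_y k y A)%E.
Implicit Types f g : T -> R.

Lemma ge0_integral_mixture (q : T -> \bar R) : (forall x, (0 <= q x)%E) ->
  measurable_fun setT q ->
  (\int[nu]_x q x = \int[m]_y \int[k y]_x q x)%E.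
Proof.
move=> q0 mq; rewrite (@integral_mixture _ _ _ _ _ m (cst 1) k)//.
  by apply: eq_integral => y _; rewrite mul1e.
by move=> A mA; rewrite nuE//; apply: eq_integral => y _; rewrite mul1e.
Qed.

Lemma measurable_kernel_Rintegral f : measurable_fun setT f ->
  measurable_fun setT (fun y => \int[k y]_x f x).
Proof.
move=> mf; apply: measurableT_comp => //.
have -> : (fun y => \int[k y]_x (f x)%:E)%E =
    (fun y => \int[k y]_x (EFin \o f)^\+ x - \int[k y]_x (EFin \o f)^\- x)%E.
  by apply/funext => y; rewrite integralE.
have mfE : measurable_fun setT (EFin \o f) by exact/measurable_EFinP.
apply: emeasurable_funB; apply: measurable_fun_integral_kernel => //.
  exact: measurable_funepos.
exact: measurable_funeneg.
Qed.

Lemma mixture_ae (Q : T -> Prop) : (\forall x \ae nu, Q x) ->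
  \forall y \ae m, \forall x \ae k y, Q x.
Proof.
move=> [N [mN N0 QN]].
have : (\int[m]_y `|k y N| = 0)%E.
  by under eq_integral do rewrite gee0_abs//; rewrite -nuE.
move=> /(ae_eq_integral_abs m measurableT (mk mN)).1.
by apply: filterS => y /(_ I) kyN; exists N; split.
Qed.

Lemma mixture_ae_L1 f : nu.-L1 f -> \forall y \ae m, (k y).-L1 f.
Proof.
move=> /integrableP[mf fi].
have mfa : measurable_fun setT (fun x => `|(EFin \o f) x|)%E.
  exact: measurableT_comp.
have ki : integrable m setT (fun y => \int[k y]_x `|(EFin \o f) x|)%E.
  apply/integrableP; split; first exact: measurable_fun_integral_kernel.
  under eq_integral do rewrite gee0_abs ?integral_ge0//.
  by rewrite -ge0_integral_mixture.
have := integrable_ae measurableT ki.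
apply: filterS => y /(_ I) kyf; apply/integrableP; split => //.
by rewrite -ge0_fin_numE// integral_ge0.
Qed.

Let mixture_ge0 f : nu.-L1 f -> (forall x, 0 <= f x) ->
  m.-L1 (fun y => \int[k y]_x f x) /\
  \int[nu]_x f x = \int[m]_y \int[k y]_x f x.
Proof.
move=> fi f0; have := mixture_ae_L1 fi; move/integrableP: (fi) => [mf fi'] kyf.
have mk' : measurable_fun setT (fun y => \int[k y]_x f x).
  by apply: measurable_kernel_Rintegral; exact/measurable_EFinP.
have E : (\int[m]_y (\int[k y]_x f x)%:E = \int[nu]_x (f x)%:E)%E.
  rewrite ge0_integral_mixture//.
  apply: ge0_ae_eq_integral.
  - exact: measurableT.
  - exact/measurable_EFinP.
  - exact: measurable_fun_integral_kernel.
  - by move=> y _; rewrite lee_fin Rintegral_ge0.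
  - by move=> y _; apply: integral_ge0 => x _; rewrite lee_fin.
  - by apply: filterS kyf => y kyf _; rewrite EFin_Rintegral.
split; last by rewrite /Rintegral -E.
apply/integrableP; split; first exact/measurable_EFinP.
under eq_integral do rewrite /= ger0_norm ?Rintegral_ge0//.
rewrite E; apply: le_lt_trans fi'.
apply: ge0_le_integral => //.
- by move=> x _; rewrite lee_fin.
- exact: measurableT_comp.
- by move=> x _; rewrite /= lee_fin ler_norm.
Qed.

(** The inner integrals are meaningful for almost every y only, so linearity in f holds almost
    everywhere; this is why the positive and negative parts are treated first and recombined
    afterwards. *)
Lemma mixture_L1 f : nu.-L1 f ->
  m.-L1 (fun y => \int[k y]_x f x) /\
  \int[nu]_x f x = \int[m]_y \int[k y]_x f x.
Proof.
move=> fi.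
have mf := L1_measurable fi.
pose fp x := (`|f x| + f x) / 2; pose fn x := (`|f x| - f x) / 2.
have fpi : nu.-L1 fp.
  have := L1Z 2^-1 (L1D (L1_norm fi) fi).
  by congr (integrable _ _ _); apply/funext => x /=; rewrite mulrC.
have fni : nu.-L1 fn.
  have := L1Z 2^-1 (L1B (L1_norm fi) fi).
  by congr (integrable _ _ _); apply/funext => x /=; rewrite mulrC.
have fp0 x : 0 <= fp x.
  by have := ler_norm (- f x); rewrite normrN /fp; lra.
have fn0 x : 0 <= fn x by have := ler_norm (f x); rewrite /fn; lra.
have [kp Ep] := mixture_ge0 fpi fp0; have [kn En] := mixture_ge0 fni fn0.
have fE x : f x = fp x - fn x by rewrite /fp /fn; field.
have kE : \forall y \ae m, \int[k y]_x fp x - \int[k y]_x fn x = \int[k y]_x f x.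
  apply: filterS2 (mixture_ae_L1 fpi) (mixture_ae_L1 fni) => y kyp kyn.
  by rewrite -RintegralB//; apply: eq_Rintegral => x _; rewrite -fE.
have mkf := measurable_kernel_Rintegral mf.
split; first exact: L1_ae_eq mkf (L1B kp kn) kE.
rewrite -(ae_eq_Rintegral _ mkf kE); last exact: L1_measurable (L1B kp kn).
by rewrite RintegralB// -Ep -En -RintegralB//; apply: eq_Rintegral => x _; exact: fE.
Qed.

Lemma mixture_norm f : nu.-L1 f ->
  \int[m]_y `|\int[k y]_x f x| <= \int[nu]_x `|f x|.
Proof.
move=> fi.
have [kf _] := mixture_L1 fi; have [kaf ->] := mixture_L1 (L1_norm fi).
apply: ae_le_Rintegral => //; first exact: L1_norm.
by apply: filterS (mixture_ae_L1 fi) => y kyf; exact: le_normr_Rintegral.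
Qed.

End mixture_L1.

(** * Probability measures, in a form that also covers the kernels [kappa t y] *)

Section probability_integrals.
Context d (T : measurableType d) (R : realType) (m : {measure set T -> \bar R}).
Hypothesis m1 : m setT = 1%E.
Implicit Types f : T -> R.

Lemma prob_L1_cst (r : R) : m.-L1 (fun _ => r).
Proof.
apply/integrableP; split; first exact/measurable_EFinP.
have := @integral_cst _ _ _ m setT measurableT (`|r|%:E)%E.
by rewrite m1 mule1 => e; apply: le_lt_trans (ltry `|r|); rewrite -e.
Qed.

Lemma prob_Rintegral_cst (r : R) : \int[m]_x r = r.
Proof. by rewrite Rintegral_cst// m1 mulr1. Qed.

Lemma prob_Rintegral_bounds f (a b : R) : measurable_fun setT f ->
  (forall x, a <= f x <= b) -> a <= \int[m]_x f x <= b.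
Proof.
move=> mf fab.
have fi : m.-L1 f.
  apply: L1_le mf (prob_L1_cst (`|a| + `|b|)) _ => x.
  have /andP[ax xb] := fab x; rewrite ler_norml.
  have := ler_norm a; have := ler_norm b; have := ler_norm (- a).
  have := ler_norm (- b); rewrite !normrN => ? ? ? ?; apply/andP; split; lra.
apply/andP; split; [rewrite -(prob_Rintegral_cst a)|rewrite -(prob_Rintegral_cst b)].
  by apply: le_Rintegral => //; [exact: prob_L1_cst|move=> x _; case/andP: (fab x)].
by apply: le_Rintegral => //; [exact: prob_L1_cst|move=> x _; case/andP: (fab x)].
Qed.

Lemma variance_identity f (c : R) : m.-L1 f -> m.-L1 (fun x => f x ^+ 2) ->
  \int[m]_x ((f x - c) ^+ 2) =
  \int[m]_x (f x ^+ 2) - 2 * c * \int[m]_x f x + c ^+ 2.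
Proof.
move=> fi f2i.
have i1 : m.-L1 (fun x => f x ^+ 2 - 2 * c * f x) by apply: L1B => //; exact: L1Z.
rewrite -[X in _ + X](prob_Rintegral_cst (c ^+ 2)) -RintegralZl// -RintegralB//;
  last exact: L1Z.
rewrite -RintegralD//; last exact: prob_L1_cst.
by apply: eq_Rintegral => x _; ring.
Qed.

Lemma Jensen_sqr f : m.-L1 f -> m.-L1 (fun x => f x ^+ 2) ->
  (\int[m]_x f x) ^+ 2 <= \int[m]_x (f x ^+ 2).
Proof.
move=> fi f2i.
have : 0 <= \int[m]_x ((f x - \int[m]_x f x) ^+ 2).
  by apply: Rintegral_ge0 => x _; exact: sqr_ge0.
by rewrite variance_identity//; nra.
Qed.

End probability_integrals.

(** * The symmetric Markov semigroup, its generator and its carre du champ *)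

Section symmetric_semigroup.
Context d (R : realType) (E : measurableType d) (mu : probability E R).
Variable kappa : R -> R.-pker E ~> E.
Hypothesis kappaS : symmetric_markov_semigroup mu kappa.
Implicit Types f g q psi : E -> R.

Local Notation P := (semigroup kappa).
Local Notation Lgen := (generator mu kappa).
Local Notation Gamma := (carre_du_champ mu kappa).

Let mkappa t : forall A, measurable A -> measurable_fun setT (kappa t ^~ A).
Proof. exact: measurable_kernel. Qed.

Let kappa1 t y : kappa t y setT = 1%E. Proof. exact: prob_kernel. Qed.

Lemma measurable_semigroup t f : measurable_fun setT f -> measurable_fun setT (P t f).
Proof. by move=> mf; exact: (measurable_kernel_Rintegral (@mkappa t) mf). Qed.

Lemma semigroup_indic t A y : measurable A -> (P t \1_A y)%:E = kappa t y A.
Proof.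
move=> mA; rewrite /semigroup /Rintegral integral_indic// setIT fineK//.
rewrite ge0_fin_numE//; apply: le_lt_trans (ltry 1).
by rewrite -(kappa1 t y); apply: le_measure; rewrite ?inE.
Qed.

Lemma semigroup_cst t (r : R) y : P t (fun _ => r) y = r.
Proof. exact: (prob_Rintegral_cst (kappa1 t y)). Qed.

Lemma semigroup_bounds t f (a b : R) y : measurable_fun setT f ->
  (forall x, a <= f x <= b) -> a <= P t f y <= b.
Proof. by move=> mf fab; exact: (prob_Rintegral_bounds (kappa1 t y)). Qed.

Lemma semigroup_bounded t f (C : R) y : measurable_fun setT f ->
  (forall x, `|f x| <= C) -> `|P t f y| <= C.
Proof.
move=> mf fC; rewrite ler_norml; apply: semigroup_bounds => // x.
by rewrite -ler_norml.
Qed.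

Lemma semigroup_ge0 t f y : (forall x, 0 <= f x) -> 0 <= P t f y.
Proof. by move=> f0; apply: Rintegral_ge0. Qed.

Lemma semigroup_L2 t f : 0 <= t -> L2 mu f -> L2 mu (P t f).
Proof. by case: kappaS => _ + _ _ t0 /L2P lf => /(_ t f t0 lf) /L2P. Qed.

Lemma semigroup_symmetric t f g : 0 <= t -> L2 mu f -> L2 mu g ->
  \int[mu]_y (P t f y * g y) = \int[mu]_y (f y * P t g y).
Proof. by case: kappaS => _ _ + _ t0 /L2P lf /L2P lg; exact. Qed.

Lemma L1_indic A : measurable A -> mu.-L1 (\1_A : E -> R).
Proof.
move=> mA; apply: (@L1_bounded _ _ _ _ _ 1) => // x.
by rewrite indicE; case: (x \in A); rewrite ?normr0 ?normr1.
Qed.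

Lemma L2_indic A : measurable A -> L2 mu (\1_A : E -> R).
Proof.
move=> mA; apply: (@L2_bounded _ _ _ _ _ 1) => // x.
by rewrite indicE; case: (x \in A); rewrite ?normr0 ?normr1.
Qed.

(** Symmetry tested against the constant 1, which the semigroup fixes. *)
Lemma invariant_measure t : 0 <= t -> forall A, measurable A ->
  mu A = (\int[mu]_y kappa t y A)%E.
Proof.
move=> t0 A mA.
have H : \int[mu]_y (\1_A y : R) = \int[mu]_y P t \1_A y.
  transitivity (\int[mu]_y (P t (fun _ => 1) y * \1_A y)).
    by apply: eq_Rintegral => y _; rewrite semigroup_cst mul1r.
  rewrite (semigroup_symmetric t0 (L2_cst mu 1) (L2_indic mA)).
  by apply: eq_Rintegral => y _; rewrite mul1r.
transitivity ((\int[mu]_y (\1_A y : R))%:E).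
  by rewrite EFin_Rintegral ?integral_indic ?setIT//; exact: L1_indic.
rewrite H.
rewrite EFin_Rintegral; last first.
  by apply: L2_L1; apply: semigroup_L2 => //; exact: L2_indic.
by apply: eq_integral => y _; rewrite semigroup_indic.
Qed.

Lemma semigroup_L1 t f : 0 <= t -> mu.-L1 f -> mu.-L1 (P t f).
Proof. by move=> t0 fi; have [] := mixture_L1 (@mkappa t) (invariant_measure t0) fi. Qed.

Lemma Rintegral_semigroup t f : 0 <= t -> mu.-L1 f ->
  \int[mu]_y P t f y = \int[mu]_y f y.
Proof. by move=> t0 fi; have [] := mixture_L1 (@mkappa t) (invariant_measure t0) fi. Qed.

Lemma kernel_ae_L1 t f : 0 <= t -> mu.-L1 f -> \forall y \ae mu, (kappa t y).-L1 f.
Proof. by move=> t0 fi; exact: (mixture_ae_L1 (@mkappa t) (invariant_measure t0) fi). Qed.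

Lemma semigroup_norm_L1 t f : 0 <= t -> mu.-L1 f ->
  \int[mu]_y `|P t f y| <= \int[mu]_y `|f y|.
Proof. by move=> t0 fi; exact: (mixture_norm (@mkappa t) (invariant_measure t0) fi). Qed.

Lemma kernel_ae t (Q : E -> Prop) : 0 <= t -> (\forall y \ae mu, Q y) ->
  \forall y \ae mu, \forall x \ae kappa t y, Q x.
Proof. by move=> t0; exact: (mixture_ae (@mkappa t) (invariant_measure t0)). Qed.

Lemma semigroupB t f g : 0 <= t -> mu.-L1 f -> mu.-L1 g ->
  \forall y \ae mu, P t (fun x => f x - g x) y = P t f y - P t g y.
Proof.
move=> t0 fi gi; apply: filterS2 (kernel_ae_L1 t0 fi) (kernel_ae_L1 t0 gi) => y kf kg.
exact: RintegralB.
Qed.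

Lemma semigroup_sqr t f : 0 <= t -> L2 mu f ->
  \forall y \ae mu, P t f y ^+ 2 <= P t (fun x => f x ^+ 2) y.
Proof.
move=> t0 lf; apply: filterS2 (kernel_ae_L1 t0 (L2_L1 lf)) (kernel_ae_L1 t0 lf.2) => y.
exact: Jensen_sqr.
Qed.

Lemma semigroup_contraction t f : 0 <= t -> L2 mu f -> norm2 mu (P t f) <= norm2 mu f.
Proof.
move=> t0 lf; apply: ler_wsqrtr; rewrite -(Rintegral_semigroup t0 lf.2).
apply: ae_le_Rintegral.
- exact: (semigroup_L2 t0 lf).2.
- exact: semigroup_L1 lf.2.
- exact: semigroup_sqr.
Qed.

(** The kernels compose at every point, but Fubini requires f to be integrable under
    [kappa (s + t) y], which invariance grants for almost every y. *)
Lemma semigroup_add s t f : 0 <= s -> 0 <= t -> mu.-L1 f ->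
  \forall y \ae mu, P (s + t) f y = P s (P t f) y.
Proof.
move=> s0 t0 fi; apply: filterS (kernel_ae_L1 (addr_ge0 s0 t0) fi) => y kf.
case: kappaS => -[_ CK] _ _ _.
by have [_] := mixture_L1 (@mkappa t) (CK s t s0 t0 y) kf.
Qed.

(** Symmetry beyond L2, as needed for q = Gamma g: q is truncated, and the remainder stays small
    under P_t, which contracts L1. *)
Lemma semigroup_bounded_symmetric t psi q (C : R) : 0 <= t ->
  measurable_fun setT psi -> (forall x, `|psi x| <= C) -> mu.-L1 q ->
  \int[mu]_y (P t psi y * q y) = \int[mu]_y (psi y * P t q y).
Proof.
move=> t0 mpsi psiC qi.
have C0 : 0 <= C := le_trans (normr_ge0 _) (psiC point).
have mPpsi := measurable_semigroup t mpsi.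
have PpsiC y : `|P t psi y| <= C by exact: semigroup_bounded.
have bnd (p r : E -> R) (D : R) : measurable_fun setT p -> (forall x, `|p x| <= C) ->
    mu.-L1 r -> \int[mu]_y `|r y| <= D -> `|\int[mu]_y (p y * r y)| <= C * D.
  move=> mp pC ri rD.
  have pri := L1_mul_bounded mp pC ri.
  apply: le_trans (le_normr_Rintegral measurableT pri) _.
  apply: le_trans (ler_wpM2l C0 rD); rewrite -RintegralZl//; last exact: L1_norm.
  apply: le_Rintegral => //; [exact: L1_norm|by apply: L1Z; exact: L1_norm|].
  by move=> y _; rewrite normrM ler_wpM2r.
apply/eqP; rewrite -subr_eq0 -normr_le0; apply/ler_addgt0Pr => e e0; rewrite add0r.
(* The truncation costs C * e1 on each side; the added 1 covers C = 0. *)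
pose e1 := e / (2 * C + 1).
have e10 : 0 < e1 by rewrite divr_gt0// ltr_wpDl// mulr_ge0.
have [q' [mq' [K q'K] qq']] := L1_approx_bounded qi e10.
have lq' : L2 mu q' := L2_bounded mu mq' q'K.
have q'i := L2_L1 lq'.
have dqi := L1B qi q'i.
have Pdqi := semigroup_L1 t0 dqi.
have H1 := bnd _ _ _ mPpsi PpsiC dqi qq'.
have H2 := bnd _ _ _ mpsi psiC Pdqi (le_trans (semigroup_norm_L1 t0 dqi) qq').
have E1 : \int[mu]_y (P t psi y * q y) = \int[mu]_y (P t psi y * q' y)
    + \int[mu]_y (P t psi y * (q y - q' y)).
  rewrite -RintegralD//; [|exact: L1_mul_bounded mPpsi PpsiC q'i
    |exact: L1_mul_bounded mPpsi PpsiC dqi].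
  by apply: eq_Rintegral => y _; ring.
have E2 : \int[mu]_y (psi y * P t q y) = \int[mu]_y (psi y * P t q' y)
    + \int[mu]_y (psi y * P t (fun x => q x - q' x) y).
  have Pq'i := semigroup_L1 t0 q'i; have Pqi := semigroup_L1 t0 qi.
  rewrite -RintegralD//; [|exact: L1_mul_bounded mpsi psiC Pq'i
    |exact: L1_mul_bounded mpsi psiC Pdqi].
  apply: ae_eq_Rintegral.
  - exact: L1_measurable (L1_mul_bounded mpsi psiC Pqi).
  - apply: L1_measurable (L1D (L1_mul_bounded mpsi psiC Pq'i)
      (L1_mul_bounded mpsi psiC Pdqi)).
  - by apply: filterS (semigroupB t0 qi q'i) => y ->; ring.
rewrite E1 E2 (semigroup_symmetric t0 (L2_bounded mu mpsi psiC) lq').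
set a := \int[mu]_y (psi y * P t q' y).
rewrite (_ : a + _ - _ = \int[mu]_y (P t psi y * (q y - q' y))
  - \int[mu]_y (psi y * P t (fun x => q x - q' x) y)); last ring.
apply: le_trans (ler_normB _ _) _.
apply: le_trans (lerD H1 H2) _.
rewrite (_ : C * e1 + C * e1 = 2 * C * e1); last ring.
by apply: mulr_frac_le; [rewrite mulr_ge0|exact: ltW].
Qed.

Lemma cvg_L2norm (F : R -> E -> R) : (\forall h \near 0^'+, L2 mu (F h)) ->
  L2norm mu (F h) @[h --> 0^'+] --> 0%E -> norm2 mu (F h) @[h --> 0^'+] --> 0.
Proof.
move=> lF /fine_cvg; apply: cvg_trans; apply: near_eq_cvg.
by apply: filterS lF => h lFh /=; rewrite /L2norm L2normE.
Qed.

Lemma semigroup_cvg0 f : L2 mu f ->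
  norm2 mu (fun y => P h f y - f y) @[h --> 0^'+] --> 0.
Proof.
move=> lf; case: kappaS => _ _ _ /(_ f) H.
apply: cvg_L2norm; last by apply: H; exact/L2P.
by near=> h; apply: L2B => //; exact: semigroup_L2.
Unshelve. all: by end_near. Qed.

(** Factoring out the contraction P_s makes the modulus of continuity at 0 serve at every time.
    Being uniform in s, it yields continuity from the left as well as from the right. *)
Lemma semigroup_increment s h f : 0 <= s -> 0 <= h -> L2 mu f ->
  norm2 mu (fun y => P (s + h) f y - P s f y) <= norm2 mu (fun y => P h f y - f y).
Proof.
move=> s0 h0 lf.
have lh := semigroup_L2 h0 lf; have ls := semigroup_L2 s0 lf.
have lsh := semigroup_L2 (addr_ge0 s0 h0) lf.
have ld := L2B lh lf.
apply: le_trans (semigroup_contraction s0 ld).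
rewrite le_eqVlt; apply/orP; left; apply/eqP; apply: norm2_ae_eq.
- exact: (L2B lsh ls).1.
- exact: measurable_semigroup ld.1.
- apply: filterS2 (semigroup_add s0 h0 (L2_L1 lf))
    (semigroupB s0 (L2_L1 lh) (L2_L1 lf)) => y -> ->.
  by [].
Qed.

Lemma semigroup_right_cvg t f : 0 <= t -> L2 mu f ->
  norm2 mu (fun y => P (t + h) f y - P t f y) @[h --> 0^'+] --> 0.
Proof.
move=> t0 lf; apply: (squeeze_cvgr _ (cvg_cst 0) (semigroup_cvg0 lf)).
by near=> h; rewrite norm2_ge0 semigroup_increment.
Unshelve. all: by end_near. Qed.

Lemma norm2_distrC f g : norm2 mu (fun y => f y - g y) = norm2 mu (fun y => g y - f y).
Proof. by congr Num.sqrt; apply: eq_Rintegral => y _; ring. Qed.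

Lemma semigroup_left_cvg t f : 0 < t -> L2 mu f ->
  norm2 mu (fun y => P (t - h) f y - P t f y) @[h --> 0^'+] --> 0.
Proof.
move=> t0 lf; apply: (squeeze_cvgr _ (cvg_cst 0) (semigroup_cvg0 lf)).
near=> h; rewrite norm2_ge0/= norm2_distrC.
have ht : 0 <= t - h.
  by rewrite subr_ge0; near: h; exact: nbhs_right_le.
have h0 : 0 <= h by near: h; exact: nbhs_right_ge.
by have := semigroup_increment ht h0 lf; rewrite subrK.
Unshelve. all: by end_near. Qed.

Lemma in_dom_L2 f : in_dom mu kappa f -> L2 mu f.
Proof. by case=> /L2P. Qed.

Let generatorP f : in_dom mu kappa f -> is_generator_value mu kappa f (Lgen f).
Proof. by case=> _ [h fh]; rewrite /generator; exact: xgetI fh. Qed.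

Lemma generator_L2 f : in_dom mu kappa f -> L2 mu (Lgen f).
Proof. by move=> /generatorP[/L2P]. Qed.

Definition diff_quotient h f y := h^-1 * (P h f y - f y).

Lemma diff_quotient_L2 h f : 0 <= h -> L2 mu f -> L2 mu (diff_quotient h f).
Proof. by move=> h0 lf; apply: L2Z; apply: L2B => //; exact: semigroup_L2. Qed.

Lemma generator_cvg f : in_dom mu kappa f ->
  norm2 mu (fun y => diff_quotient h f y - Lgen f y) @[h --> 0^'+] --> 0.
Proof.
move=> df; have lf := in_dom_L2 df; have lLf := generator_L2 df.
apply: cvg_L2norm.
  by near=> h; apply: L2B => //; exact: diff_quotient_L2.
have [_] := generatorP df.
set F := (X in X @ _ --> _ -> _); set G := (X in _ -> X @ _ --> _).
suff -> : G = F by [].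
apply/funext => h; congr L2norm; apply/funext => y.
by rewrite /diff_quotient mulrC.
Unshelve. all: by end_near. Qed.

Lemma norm2_cst_cvg (f : E -> R) : norm2 mu (fun y => f y - f y) @[h --> (0 : R)^'+] --> 0.
Proof.
rewrite [X in _ --> X](_ : _ = norm2 mu (fun y => f y - f y)); first exact: cvg_cst.
rewrite /norm2; under eq_Rintegral do rewrite subrr expr0n.
by rewrite prob_Rintegral_cst ?sqrtr0//; exact: probability_setT.
Qed.

Lemma generator_integral_cvg f g : in_dom mu kappa f -> L2 mu g ->
  \int[mu]_y (diff_quotient h f y * g y) @[h --> 0^'+] --> \int[mu]_y (Lgen f y * g y).
Proof.
move=> df lg; have lf := in_dom_L2 df.
apply: L2_cvg_inner => //.
- by near=> h; exact: diff_quotient_L2.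
- exact: generator_L2.
- by near=> h.
- exact: generator_cvg.
- exact: norm2_cst_cvg.
Unshelve. all: by end_near. Qed.

Lemma diff_quotient_symmetric h f g : 0 <= h -> L2 mu f -> L2 mu g ->
  \int[mu]_y (diff_quotient h f y * g y) = \int[mu]_y (diff_quotient h g y * f y).
Proof.
move=> h0 lf lg.
have lPf := semigroup_L2 h0 lf; have lPg := semigroup_L2 h0 lg.
have E1 u v : L2 mu u -> L2 mu v -> L2 mu (P h u) -> \int[mu]_y (diff_quotient h u y * v y)
    = h^-1 * (\int[mu]_y (P h u y * v y) - \int[mu]_y (u y * v y)).
  move=> lu lv lPu; rewrite -RintegralB//; [|exact: L2_mul|exact: L2_mul].
  rewrite -RintegralZl//; last by apply: L1B; exact: L2_mul.
  by apply: eq_Rintegral => y _; rewrite /diff_quotient; ring.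
rewrite !E1// semigroup_symmetric//; congr (_ * (_ - _)).
  by apply: eq_Rintegral => y _; rewrite mulrC.
by apply: eq_Rintegral => y _; rewrite mulrC.
Qed.

Lemma generator_symmetric f g : in_dom mu kappa f -> in_dom mu kappa g ->
  \int[mu]_y (Lgen f y * g y) = \int[mu]_y (f y * Lgen g y).
Proof.
move=> df dg; have lf := in_dom_L2 df; have lg := in_dom_L2 dg.
have -> : \int[mu]_y (f y * Lgen g y) = \int[mu]_y (Lgen g y * f y).
  by apply: eq_Rintegral => y _; rewrite mulrC.
have H : \int[mu]_y (diff_quotient h f y * g y) @[h --> 0^'+] -->
    \int[mu]_y (Lgen g y * f y).
  apply: cvg_trans (generator_integral_cvg dg lf); apply: near_eq_cvg.
  by near=> h; exact: diff_quotient_symmetric.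
rewrite -(cvg_lim (@Rhausdorff R) H).
by rewrite -(cvg_lim (@Rhausdorff R) (generator_integral_cvg df lg)).
Unshelve. all: by end_near. Qed.

Lemma Rintegral_generator f : in_dom mu kappa f -> \int[mu]_y Lgen f y = 0.
Proof.
move=> df; have lf := in_dom_L2 df.
have <- : \int[mu]_y (Lgen f y * 1) = \int[mu]_y Lgen f y.
  by apply: eq_Rintegral => y _; rewrite mulr1.
rewrite -(cvg_lim (@Rhausdorff R) (generator_integral_cvg df (L2_cst mu 1))).
apply: cvg_lim => //; apply: cvg_near_cst; near=> h.
have h0 : 0 <= h by near: h; exact: nbhs_right_ge.
rewrite diff_quotient_symmetric//; last exact: L2_cst.
rewrite -[RHS](prob_Rintegral_cst (probability_setT mu)).
by apply: eq_Rintegral => y _; rewrite /diff_quotient semigroup_cst subrr mulr0 mul0r.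
Unshelve. all: by end_near. Qed.

Lemma carre_du_champ_L1 f g : in_dom_carre_du_champ mu kappa f g -> mu.-L1 (Gamma f g).
Proof.
move=> [df dg dfg]; apply: L1Z.
have lf := in_dom_L2 df; have lg := in_dom_L2 dg.
have lLf := generator_L2 df; have lLg := generator_L2 dg.
apply: L1B; last exact: L2_mul.
by apply: L1B; [apply: L2_L1; exact: generator_L2|exact: L2_mul].
Qed.

(** Integration by parts: L(f g) integrates to 0 by invariance, and the two other terms coincide by
    symmetry. *)
Lemma Rintegral_carre_du_champ f g : in_dom_carre_du_champ mu kappa f g ->
  \int[mu]_y Gamma f g y = - \int[mu]_y (f y * Lgen g y).
Proof.
move=> [df dg dfg].
have lf := in_dom_L2 df; have lg := in_dom_L2 dg.
have lLf := generator_L2 df; have lLg := generator_L2 dg.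
have i1 := L2_L1 (generator_L2 dfg); have i2 := L2_mul lf lLg; have i3 := L2_mul lg lLf.
rewrite RintegralZl//; last by apply: L1B => //; exact: L1B.
rewrite RintegralB//; last exact: L1B.
rewrite RintegralB// Rintegral_generator//.
have -> : \int[mu]_y (g y * Lgen f y) = \int[mu]_y (f y * Lgen g y).
  by rewrite -generator_symmetric//; apply: eq_Rintegral => y _; rewrite mulrC.
lra.
Qed.

End symmetric_semigroup.

(** * Almost everywhere comparison and vanishing error terms *)

Section comparison.
Context d (T : measurableType d) (R : realType) (m : {finite_measure set T -> \bar R}).
Context (I : Type) (F : set_system I) {FF : ProperFilter F}.

(** The event on which g < f is the test set: there f - g is positive and yet has a nonpositive
    integral. *)
Lemma L1_ae_le (f g : T -> R) : m.-L1 f -> m.-L1 g ->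
  (forall B, measurable B -> \int[m]_x (\1_B x * f x) <= \int[m]_x (\1_B x * g x)) ->
  \forall x \ae m, f x <= g x.
Proof.
move=> fi gi fg.
have mf := L1_measurable fi; have mg := L1_measurable gi.
pose B := [set x | g x < f x].
have mB : measurable B.
  have -> : B = ~` (setT `&` [set x | f x <= g x]).
    by rewrite setTI; apply/seteqP; split => x; rewrite /B/= ltNge => /negP.
  by apply: measurableC; exact: measurable_fun_le.
have B1 x : `|\1_B x : R| <= 1.
  by rewrite indicE; case: (x \in B); rewrite ?normr0 ?normr1.
have m1B : measurable_fun setT (\1_B : T -> R) by exact: measurable_indic.
have Bfi := L1_mul_bounded m1B B1 fi; have Bgi := L1_mul_bounded m1B B1 gi.
pose D x := \1_B x * f x - \1_B x * g x.
have Di : m.-L1 D by exact: L1B.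
have D0 x : 0 <= D x.
  rewrite /D indicE; have [/set_mem xB|_] := boolP (x \in B); last by rewrite !mul0r subrr.
  by rewrite !mul1r subr_ge0 ltW.
have ID : \int[m]_x D x = 0.
  apply/eqP; rewrite eq_le Rintegral_ge0// andbT.
  by rewrite RintegralB// subr_le0; exact: fg.
have := Rintegral_eq0_ae Di (aeW _ D0) ID.
apply: filterS => x; rewrite /D indicE => Dx; rewrite leNgt; apply/negP => gf.
by move: Dx; rewrite mem_set// !mul1r => /eqP; rewrite subr_eq0 => /eqP E; move: gf; rewrite E ltxx.
Qed.

(** Meant for error terms: u is bounded and p is bounded in L2, neither has to converge, and
    Cauchy-Schwarz lets z carry the limit. *)
Lemma bounded_inner_cvg0 (u p z : I -> T -> R) (C K : R) :
  (forall i, measurable_fun setT (u i)) -> (forall i x, `|u i x| <= C) ->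
  (\forall i \near F, L2 m (p i) /\ norm2 m (p i) <= K) ->
  (\forall i \near F, L2 m (z i)) -> norm2 m (z i) @[i --> F] --> 0 ->
  \int[m]_x (u i x * (p i x * z i x)) @[i --> F] --> 0.
Proof.
move=> mu uC pK lz cz; apply/norm_cvg0P.
have C0 i : 0 <= C := le_trans (normr_ge0 _) (uC i point).
have rhs : C * (K * norm2 m (z i)) @[i --> F] --> 0.
  rewrite [X in _ --> X](_ : _ = C * (K * 0)); last by rewrite !mulr0.
  by apply: cvgMr; apply: cvgMr.
apply: (squeeze_cvgr _ (cvg_cst 0) rhs).
apply: filterS2 pK lz => i [lp pK] lz; rewrite normr_ge0/=.
have i1 := L1_mul_bounded (mu i) (uC i) (L2_mul lp lz).
have la : L2 m (fun x => `|p i x|).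
  split; first by apply: measurableT_comp => //; exact: lp.1.
  have -> : (fun x => `|p i x| ^+ 2) = (fun x => p i x ^+ 2); last exact: lp.2.
  by apply/funext => x; rewrite real_normK ?num_real.
have lb : L2 m (fun x => `|z i x|).
  split; first by apply: measurableT_comp => //; exact: lz.1.
  have -> : (fun x => `|z i x| ^+ 2) = (fun x => z i x ^+ 2); last exact: lz.2.
  by apply/funext => x; rewrite real_normK ?num_real.
have na f : norm2 m (fun x => `|f x|) = norm2 m f.
  by congr Num.sqrt; apply: eq_Rintegral => x _; rewrite real_normK ?num_real.
apply: le_trans (le_normr_Rintegral measurableT i1) _.
apply: (@le_trans _ _ (C * \int[m]_x (`|p i x| * `|z i x|))).
  rewrite -RintegralZl//; last exact: L2_mul.
  apply: le_Rintegral => //; [exact: L1_norm|by apply: L1Z; exact: L2_mul|].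
  by move=> x _; rewrite !normrM ler_wpM2r// mulr_ge0.
apply: ler_wpM2l; first exact: C0.
apply: le_trans (ler_norm _) _; apply: le_trans (Cauchy_Schwarz la lb) _.
by rewrite !na ler_wpM2r// norm2_ge0.
Qed.

Lemma cvg_near_leD (r : I -> R) (l e : R) : r i @[i --> F] --> l -> 0 < e ->
  \forall i \near F, r i <= l + e.
Proof.
move=> /cvgrPdistC_le rl e0; apply: filterS (rl _ e0) => i.
by rewrite ler_norml => /andP[_]; rewrite lerBlDl.
Qed.

End comparison.

(** * The local Poincare inequality *)

Section local_poincare.
Context d (R : realType) (E : measurableType d) (mu : probability E R).
Variable kappa : R -> R.-pker E ~> E.
Hypothesis kappaS : symmetric_markov_semigroup mu kappa.

Local Notation P := (semigroup kappa).
Local Notation Lgen := (generator mu kappa).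
Local Notation Gamma := (carre_du_champ mu kappa).

Lemma semigroup0 (f : E -> R) : measurable_fun setT f -> P 0 f = f.
Proof.
move=> mf; apply/funext => y; rewrite /semigroup /Rintegral.
rewrite (@eq_measure_integral _ _ _ setT (\d_y : {measure set E -> \bar R})).
  by rewrite integral_dirac ?diracT ?mul1e//; exact/measurable_EFinP.
by move=> A mA _; case: kappaS => -[+ _] _ _ _; exact.
Qed.

(** With v = P_(t-h) psi and w = P_(a-t) g, the left side is the increment of the interpolation from
    t - h to t. The integrand on the right exceeds v (P_h (w^2) - (P_h w)^2) by v (P_h w - w)^2.
    Dropping this square leaves difference quotients of the fixed functions w^2 and w, which
    converge to L(w^2) - 2 w L w = 2 Gamma w. *)
Lemma carre_increment h (v w : E -> R) : 0 < h -> measurable_fun setT v ->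
  (forall y, 0 <= v y) -> (forall y, `|v y| <= 1) -> L2 mu w -> L2 mu (w \* w) ->
  \int[mu]_y (P h v y * w y ^+ 2) - \int[mu]_y (v y * P h w y ^+ 2) <=
  h * \int[mu]_y (v y * (diff_quotient kappa h (w \* w) y
                         - 2 * (w y * diff_quotient kappa h w y))).
Proof.
move=> h0 mv v0 v1 lw lw2.
have lPw := semigroup_L2 kappaS (ltW h0) lw.
have lPw2 := semigroup_L2 kappaS (ltW h0) lw2.
have i1 := L2_L1 lw2.
have E1 : \int[mu]_y (P h v y * w y ^+ 2) = \int[mu]_y (v y * P h (w \* w) y).
  rewrite -(semigroup_bounded_symmetric kappaS (ltW h0) mv v1 i1).
  by apply: eq_Rintegral => y _; rewrite expr2.
have i3 := L2_mul lw (diff_quotient_L2 kappaS (ltW h0) lw).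
have i4 := L2_L1 (diff_quotient_L2 kappaS (ltW h0) lw2).
have j1 := L1_mul_bounded mv v1 (L2_L1 lPw2).
have j2 := L1_mul_bounded mv v1 lPw.2.
have j3 := L1_mul_bounded mv v1 (L1B i4 (L1Z 2 i3)).
rewrite E1 -(RintegralB measurableT j1 j2) -(RintegralZl _ measurableT j3).
apply: (le_Rintegral measurableT (L1B j1 j2) (L1Z h j3)) => y _.
rewrite /diff_quotient.
have aux (p q s t r : R) : h * (t * (h^-1 * (p - s * s) - 2 * (s * (h^-1 * (q - s))))) =
   (h * h^-1) * (t * (p - s ^+ 2 - 2 * (s * (q - s)))) by ring.
rewrite aux// mulfV ?gt_eqF// mul1r -mulrBr; apply: ler_wpM2l; first exact: v0.
set p := P h _ y; set q := P h w y.
rewrite -subr_ge0 (_ : _ - _ = (q - w y) ^+ 2); last by ring.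
exact: sqr_ge0.
Qed.

(** The weight moves with h too. Replacing the quotients by their limits leaves 2 Gamma w, merely
    integrable, against a bounded weight that converges in L2, and two errors that vanish in L2. *)
Lemma carre_increment_cvg t (psi w : E -> R) : 0 < t -> measurable_fun setT psi ->
  (forall y, `|psi y| <= 1) -> in_dom_carre_du_champ mu kappa w w ->
  \int[mu]_y (P (t - h) psi y * (diff_quotient kappa h (w \* w) y
      - 2 * (w y * diff_quotient kappa h w y))) @[h --> 0^'+] -->
  2 * \int[mu]_y (P t psi y * Gamma w w y).
Proof.
have PF : ProperFilter (0 : R)^'+ := at_right_proper_filter 0.
move=> t0 mpsi psi1 dwc; have [dw _ dw2] := dwc.
have lw := in_dom_L2 dw; have lw2 := in_dom_L2 dw2.
have lLw := generator_L2 dw; have lLw2 := generator_L2 dw2.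
have mu_ s : measurable_fun setT (P s psi) by exact: measurable_semigroup.
have u1 s y : `|P s psi y| <= 1 by exact: semigroup_bounded.
have uth := semigroup_left_cvg kappaS t0 (L2_bounded mu mpsi psi1).
have Hdq f : in_dom mu kappa f ->
    \forall h \near 0^'+, L2 mu (fun y => diff_quotient kappa h f y - Lgen f y).
  move=> df; have lf := in_dom_L2 df; have lLf := generator_L2 df.
  by near=> h; apply: L2B => //; exact: (diff_quotient_L2 kappaS).
have Gi := carre_du_champ_L1 dwc.
have c1 := @bounded_L2_cvg_integral _ _ _ mu _ _ PF (fun h => P (t - h) psi) (P t psi)
  _ 1 (fun h => mu_ (t - h)) (fun h => u1 (t - h)) (mu_ t) (u1 t) uth (L1Z 2 Gi).
have c2 := @bounded_inner_cvg0 _ _ _ mu _ _ PF (fun h => P (t - h) psi) (fun _ _ => 1)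
  _ 1 _ (fun h => mu_ (t - h)) (fun h => u1 (t - h))
  (@filterE _ _ PF _ (fun _ => conj (L2_cst mu 1) (lexx _))) (Hdq _ dw2) (generator_cvg kappaS dw2).
have c3 := @bounded_inner_cvg0 _ _ _ mu _ _ PF (fun h => P (t - h) psi) (fun _ => w)
  _ 1 _ (fun h => mu_ (t - h)) (fun h => u1 (t - h))
  (@filterE _ _ PF _ (fun _ => conj lw (lexx _))) (Hdq _ dw) (generator_cvg kappaS dw).
have := cvgB (cvgD c1 c2) (cvgM (cvg_cst (2 : R)) c3).
rewrite mulr0 subr0 addr0.
have -> : \int[mu]_y (P t psi y * (2 * Gamma w w y)) =
    2 * \int[mu]_y (P t psi y * Gamma w w y).
  rewrite -RintegralZl//; last exact: L1_mul_bounded (mu_ t) (u1 t) Gi.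
  by apply: eq_Rintegral => y _; ring.
move=> /(_ _ _ _ _) HH; apply: (cvg_trans _ HH); apply: near_eq_cvg; near=> h.
have h0 : 0 <= h by [].
have lq := diff_quotient_L2 kappaS h0 lw; have lq2 := diff_quotient_L2 kappaS h0 lw2.
have j1 := L1_mul_bounded (mu_ (t - h)) (u1 (t - h)) (L1Z 2 Gi).
have j2 := L1_mul_bounded (mu_ (t - h)) (u1 (t - h))
  (L2_mul (L2_cst mu 1) (L2B lq2 lLw2)).
have j3 := L1_mul_bounded (mu_ (t - h)) (u1 (t - h)) (L2_mul lw (L2B lq lLw)).
rewrite /= !fctE /= -(RintegralZl _ measurableT j3) -(RintegralD measurableT j1 j2).
rewrite -(RintegralB measurableT (L1D j1 j2) (L1Z 2 j3)).
apply: eq_Rintegral => y _; rewrite /carre_du_champ.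
move: (generator _ _ (w \* w) y) (generator _ _ w y) => c1' c2'; field.
Unshelve. all: by end_near. Qed.

(** By symmetry, the difference of the values of [phi] at a and at 0 is the left side, while the
    curvature condition bounds the growth of [phi] by 2 J per unit of time. *)
Lemma local_poincare_indic g B a : in_dom_carre_du_champ mu kappa g g ->
  nonneg_curvature mu kappa g -> measurable B -> 0 <= a ->
  \int[mu]_y (\1_B y * (P a (fun x => g x ^+ 2) y - P a g y ^+ 2)) <=
  \int[mu]_y (\1_B y * (2 * a * P a (Gamma g g) y)).
Proof.
have PF : ProperFilter (0 : R)^'+ := at_right_proper_filter 0.
move=> domg curvg mB a0.
have lg : L2 mu g by case: domg => /in_dom_L2.
set psi : E -> R := \1_B.
have mpsi : measurable_fun setT psi by exact: measurable_indic.
have psi0 y : 0 <= psi y by rewrite /psi.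
have psi1 y : `|psi y| <= 1.
  by rewrite /psi indicE; case: (y \in B); rewrite ?normr0 ?normr1.
have lpsi : L2 mu psi by exact: L2_bounded mpsi psi1.
have mu_ s : measurable_fun setT (P s psi) by exact: measurable_semigroup.
have u1 s y : `|P s psi y| <= 1 by exact: semigroup_bounded.
have u_ge0 s y : 0 <= P s psi y by exact: semigroup_ge0.
have lw s : s <= a -> L2 mu (P (a - s) g).
  by move=> sa; apply: (semigroup_L2 kappaS) => //; rewrite subr_ge0.
have Gi : mu.-L1 (Gamma g g) by exact: carre_du_champ_L1.
(* phi has left derivative at most 2 J; its right derivative is never needed,
   right continuity suffices. *)
pose phi s := \int[mu]_y (P s psi y * P (a - s) g y ^+ 2).
pose J := \int[mu]_y (psi y * P a (Gamma g g) y).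
(* Curvature bounds Gamma (P_(a-s) g) by P_(a-s) (Gamma g); symmetry then moves P_s off psi, and P_s
   P_(a-s) = P_a makes the bound independent of s. *)
have carre_le s : 0 <= s <= a ->
    \int[mu]_y (P s psi y * Gamma (P (a - s) g) (P (a - s) g) y) <= J.
  move=> /andP[s0 sa]; have as0 : 0 <= a - s by rewrite subr_ge0.
  have [dw cw] := curvg _ as0.
  have i1 := L1_mul_bounded (@mu_ s) (u1 s) (carre_du_champ_L1 dw).
  have i2 := semigroup_L1 kappaS as0 Gi.
  apply: (@le_trans _ _ (\int[mu]_y (P s psi y * P (a - s) (Gamma g g) y))).
    apply: (ae_le_Rintegral i1 (L1_mul_bounded (mu_ s) (u1 s) i2)).
    by apply: filterS cw => y; apply: ler_wpM2l.
  rewrite (semigroup_bounded_symmetric kappaS s0 mpsi psi1 i2) le_eqVlt.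
  apply/orP; left; apply/eqP; apply: ae_eq_Rintegral.
  - apply: measurable_funM => //; apply: measurable_semigroup.
    exact: L1_measurable i2.
  - apply: measurable_funM => //; apply: measurable_semigroup.
    exact: L1_measurable Gi.
  apply: filterS (semigroup_add kappaS s0 as0 Gi) => y <-.
  by rewrite addrC subrK.
have real_step (h t e r f1 f2 K : R) : 0 < h -> f1 - f2 <= h * r -> r <= 2 * K + e ->
    (f1 - 2 * K * t) - (f2 - 2 * K * (t - h)) <= e * h.
  move=> h0 H1 rK.
  rewrite (_ : _ - _ = (f1 - f2) - 2 * K * h); last by ring.
  rewrite lerBlDr (le_trans H1)//.
  have -> : e * h + 2 * K * h = h * (2 * K + e) by ring.
  by rewrite ler_pM2l.
have phi_left t : 0 < t <= a -> forall e, 0 < e ->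
    \forall h \near 0^'+, (phi t - 2 * J * t) - (phi (t - h) - 2 * J * (t - h)) <= e * h.
  move=> /andP[t0 ta] e e0.
  have at0 : 0 <= a - t by rewrite subr_ge0.
  have [dwc _] := curvg _ at0; have [dw _ dw2] := dwc.
  have C := carre_increment_cvg t0 mpsi psi1 dwc.
  apply: filterS2 (filterI (nbhs_right_gt 0) (nbhs_right_lt t0))
    (cvg_near_leD C e0) => h [/= h0 ht] H.
  have th0 : 0 <= t - h by rewrite subr_ge0 ltW.
  have E1 : phi t = \int[mu]_y (P h (P (t - h) psi) y * P (a - t) g y ^+ 2).
    apply: ae_eq_Rintegral.
    - by apply: measurable_funM => //; apply: measurable_funX; exact: (lw _ ta).1.
    - apply: measurable_funM; first by apply: measurable_semigroup.
      by apply: measurable_funX; exact: (lw _ ta).1.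
    have := semigroup_add kappaS (ltW h0) th0 (L2_L1 lpsi).
    by apply: filterS => y; rewrite subrKC => ->.
  have E2 : phi (t - h) = \int[mu]_y (P (t - h) psi y * P h (P (a - t) g) y ^+ 2).
    apply: ae_eq_Rintegral.
    - apply: measurable_funM => //; apply: measurable_funX.
      by apply: measurable_semigroup; exact: lg.1.
    - apply: measurable_funM => //; apply: measurable_funX.
      by apply: measurable_semigroup; exact: (lw _ ta).1.
    have := semigroup_add kappaS (ltW h0) at0 (L2_L1 lg).
    apply: filterS => y; rewrite (_ : a - (t - h) = h + (a - t)); last by ring.
    by move=> ->.
  have := carre_increment h0 (mu_ (t - h)) (u_ge0 (t - h)) (u1 (t - h)) (lw _ ta)
    (in_dom_L2 dw2).
  rewrite -E1 -E2.
  have cl : \int[mu]_y (P t psi y * Gamma (P (a - t) g) (P (a - t) g) y) <= J.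
    by apply: carre_le; rewrite ta ltW.
  have : \int[mu]_y (P (t - h) psi y *
      (diff_quotient kappa h (P (a - t) g \* P (a - t) g) y
        - 2 * (P (a - t) g y * diff_quotient kappa h (P (a - t) g) y))) <= 2 * J + e.
    by apply: le_trans H _; rewrite lerD2r ler_pM2l.
  move=> rJ H1; exact: (real_step h t e _ _ _ J h0 H1 rJ).
have phi_right t : 0 <= t < a -> forall e, 0 < e ->
    \forall h \near 0^'+, phi (t + h) - 2 * J * (t + h) <= phi t - 2 * J * t + e.
  move=> /andP[t0 ta] e e0.
  have at0 : 0 < a - t by rewrite subr_gt0.
  have cu := semigroup_right_cvg kappaS t0 lpsi.
  have cw := semigroup_left_cvg kappaS at0 lg.
  have lwt := lw _ (ltW ta).
  have c1 := @bounded_L2_cvg_integral _ _ _ mu _ _ PF (fun h => P (t + h) psi) (P t psi)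
    _ 1 (fun h => mu_ (t + h)) (fun h => u1 (t + h)) (mu_ t) (u1 t) cu lwt.2.
  have Hl : \forall h \near 0^'+, L2 mu (P (a - t - h) g).
    near=> h; apply: (semigroup_L2 kappaS) => //; rewrite subr_ge0.
    by near: h; exact: nbhs_right_le.
  (* The difference of the squares of P_(a-t-h) g and P_(a-t) g factors into a sum bounded in L2, by
     contraction, and a difference that tends to 0. *)
  have c2 := @bounded_inner_cvg0 _ _ _ mu _ _ PF (fun h => P (t + h) psi)
    (fun h y => P (a - t - h) g y + P (a - t) g y)
    (fun h y => P (a - t - h) g y - P (a - t) g y)
    1 (2 * norm2 mu g) (fun h => mu_ (t + h)) (fun h => u1 (t + h)).
  have {}c2 := c2 _ _ cw.
  have cphi : phi (t + h) @[h --> 0^'+] --> phi t.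
    have := cvgD c1 (c2 _ _); rewrite addr0.
    move=> /(_ _ _) H.
    apply: cvg_trans (H _ _).
    - apply: near_eq_cvg; near=> h.
      have lwh : L2 mu (P (a - t - h) g) by near: h.
      have j1 := L1_mul_bounded (mu_ (t + h)) (u1 (t + h)) lwt.2.
      have j2 := L1_mul_bounded (mu_ (t + h)) (u1 (t + h)) (L2_mul (L2D lwh lwt) (L2B lwh lwt)).
      rewrite /= !fctE /= -(RintegralD measurableT j1 j2) /phi opprD addrA.
      by apply: eq_Rintegral => y _; ring.
    - near=> h; have lwh : L2 mu (P (a - t - h) g) by near: h.
      split; first exact: L2D.
      apply: le_trans (norm2D lwh lwt) _; rewrite mulr_natl mulr2n; apply: lerD.
        apply: (semigroup_contraction kappaS) => //; rewrite subr_ge0.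
        by near: h; exact: nbhs_right_le.
      by apply: (semigroup_contraction kappaS) => //; exact: ltW.
    - near=> h; have lwh : L2 mu (P (a - t - h) g) by near: h.
      exact: L2B.
  have cG : phi (t + h) - 2 * J * (t + h) @[h --> 0^'+] --> phi t - 2 * J * (t + 0).
    apply: cvgB => //; apply: cvgMr; apply: cvgD; first exact: cvg_cst.
    exact: cvg_at_right_filter.
  by rewrite addr0 in cG; exact: cvg_near_leD cG e0.
have := dini_le a0 phi_left phi_right.
rewrite mulr0 subr0 lerBlDr => H.
have i1 := semigroup_L1 kappaS a0 lg.2.
have lPg := semigroup_L2 kappaS a0 lg.
have i3 := semigroup_L1 kappaS a0 Gi.
have Ea : phi a = \int[mu]_y (psi y * P a (fun x => g x ^+ 2) y).
  rewrite -(semigroup_bounded_symmetric kappaS a0 mpsi psi1 lg.2).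
  by rewrite /phi subrr semigroup0//; exact: lg.1.
have E0 : phi 0 = \int[mu]_y (psi y * P a g y ^+ 2).
  by rewrite /phi subr0 semigroup0.
have j1 := L1_mul_bounded mpsi psi1 i1.
have j2 := L1_mul_bounded mpsi psi1 lPg.2.
have -> : \int[mu]_y (psi y * (P a (fun x => g x ^+ 2) y - P a g y ^+ 2)) = phi a - phi 0.
  rewrite Ea E0 -RintegralB//.
  by apply: eq_Rintegral => y _; rewrite mulrBr.
have -> : \int[mu]_y (psi y * (2 * a * P a (Gamma g g) y)) = 2 * J * a.
  rewrite mulrAC -RintegralZl//; last exact: (L1_mul_bounded mpsi psi1 i3).
  by apply: eq_Rintegral => y _; ring.
by rewrite lerBlDr addrC.
Unshelve. all: by end_near. Qed.

Lemma local_poincare g a : in_dom_carre_du_champ mu kappa g g ->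
  nonneg_curvature mu kappa g -> 0 <= a ->
  \forall y \ae mu, P a (fun x => g x ^+ 2) y - P a g y ^+ 2
                    <= 2 * a * P a (Gamma g g) y.
Proof.
move=> domg curvg a0.
have lg : L2 mu g by case: domg => /in_dom_L2.
apply: L1_ae_le.
- by apply: L1B; [exact: (semigroup_L1 kappaS a0 lg.2)|exact: (semigroup_L2 kappaS a0 lg).2].
- by apply: L1Z; apply: (semigroup_L1 kappaS a0); exact: carre_du_champ_L1.
- by move=> B mB; exact: local_poincare_indic.
Qed.

End local_poincare.

(** * Laws of random variables and orthogonality to functions of a variable *)

Section laws.
Import HBNNSimple.
Context d d' (R : realType) (E : measurableType d) (Omega : measurableType d').
Variables (Pr : probability Omega R) (Z : {mfun Omega >-> E}).
Implicit Types f : E -> R.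

Lemma law_ae (Q : E -> Prop) : (\forall y \ae distribution Pr Z, Q y) ->
  \forall w \ae Pr, Q (Z w).
Proof.
move=> [N [mN N0 QN]]; exists (Z @^-1` N); split.
- by rewrite -[X in measurable X]setTI; exact: measurable_funP.
- exact: N0.
- by move=> w /= QZw; apply: QN.
Qed.

Lemma law_L1 f : (distribution Pr Z).-L1 f ->
  Pr.-L1 (fun w => f (Z w)) /\ \int[distribution Pr Z]_y f y = \int[Pr]_w f (Z w).
Proof.
move=> /integrableP[mf fi].
have mfZ : measurable_fun setT (EFin \o (fun w => f (Z w))).
  exact: (measurableT_comp mf).
have fZi : Pr.-L1 (fun w => f (Z w)).
  apply/integrableP; split => //; apply: le_lt_trans fi.
  by rewrite ge0_integral_distribution//; exact: measurableT_comp.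
by split => //; rewrite /Rintegral integral_distribution.
Qed.

(** The hypothesis says E[Y | Z] = 0 without conditional expectations. It passes to unbounded p
    through simple approximations q_n of the positive and negative parts, since |q_n(Z) Y| stays
    below |p(Z) Y|. *)
Lemma Rintegral_comp_eq0 (Y : Omega -> R) (p : E -> R) : Pr.-L1 Y ->
  (forall B, measurable B -> \int[Pr]_w (\1_B (Z w) * Y w) = 0) ->
  measurable_fun setT p -> Pr.-L1 (fun w => p (Z w) * Y w) ->
  \int[Pr]_w (p (Z w) * Y w) = 0.
Proof.
move=> Yi Y0.
have nonneg (q : E -> R) : measurable_fun setT q -> (forall y, 0 <= q y) ->
    Pr.-L1 (fun w => q (Z w) * Y w) -> \int[Pr]_w (q (Z w) * Y w) = 0.
  move=> mq q0 qYi.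
  have mqE : measurable_fun setT (EFin \o q) by exact/measurable_EFinP.
  have q0E y : setT y -> (0 <= (EFin \o q) y)%E by rewrite lee_fin.
  pose F := nnsfun_approx measurableT mqE.
  have mF n : measurable_fun setT (fun w => F n (Z w) * Y w).
    apply: measurable_funM; last exact: L1_measurable Yi.
    by apply: measurableT_comp.
  have [||||_] := @dominated_Rintegral_cvg _ _ _ Pr (fun n w => F n (Z w) * Y w)
    (fun w => q (Z w) * Y w) (fun w => `|q (Z w) * Y w|) mF.
  - exact: L1_measurable qYi.
  - exact: L1_norm.
  - apply: aeW => w; apply: cvgM; last exact: cvg_cst.
    by have /fine_cvg := @cvg_nnsfun_approx _ _ _ _ measurableT _ mqE q0E (Z w) I.
  - apply: aeW => w n; rewrite !normrM ler_wpM2r// !ger0_norm//.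
    by rewrite -lee_fin /F nnsfun_approxE; exact: (le_approx n q0E).
  have -> : (fun n => \int[Pr]_w (F n (Z w) * Y w)) = (fun _ => 0).
    apply/funext => n.
    have -> : \int[Pr]_w (F n (Z w) * Y w) =
      \int[Pr]_w (\sum_(r <- finmap.enum_fset (fset_set (range (F n))))
        (r * (\1_(F n @^-1` [set r]) (Z w) * Y w))).
      apply: eq_Rintegral => w _; rewrite [F n (Z w)]fimfunE fsbig_finite//= mulr_suml.
      by apply: eq_bigr => r _; rewrite mulrA.
    have mB r : measurable (F n @^-1` [set r]).
      by rewrite -[X in measurable X]setTI; exact: measurable_funP.
    have ii r : Pr.-L1 (fun w => r * (\1_(F n @^-1` [set r]) (Z w) * Y w)).
      apply: L1Z; apply: (@L1_mul_bounded _ _ _ _ _ _ 1) => //.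
        by apply: measurableT_comp => //; exact: measurable_indic.
      by move=> w; rewrite indicE; case: (_ \in _); rewrite ?normr0 ?normr1.
    have isum (s : seq R) : Pr.-L1 (fun w => \sum_(r <- s)
          (r * (\1_(F n @^-1` [set r]) (Z w) * Y w))) /\
        \int[Pr]_w (\sum_(r <- s) (r * (\1_(F n @^-1` [set r]) (Z w) * Y w))) = 0.
      elim: s => [|r s [IHi IH]].
        have -> : (fun w => \sum_(r <- [::]) (r * (\1_(F n @^-1` [set r]) (Z w) * Y w))) = cst 0.
          by apply/funext => w; rewrite big_nil.
        by split; [exact: L1_cst|rewrite /Rintegral integral0].
      have -> : (fun w => \sum_(r0 <- r :: s) (r0 * (\1_(F n @^-1` [set r0]) (Z w) * Y w))) =
          (fun w => r * (\1_(F n @^-1` [set r]) (Z w) * Y w) +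
            \sum_(r <- s) (r * (\1_(F n @^-1` [set r]) (Z w) * Y w))).
        by apply/funext => w; rewrite big_cons.
      split; first exact: L1D.
      rewrite RintegralD// IH addr0 RintegralZl ?Y0 ?mulr0//.
      apply: (@L1_mul_bounded _ _ _ _ _ _ 1) => //.
        by apply: measurableT_comp => //; exact: measurable_indic.
      by move=> w; rewrite indicE; case: (_ \in _); rewrite ?normr0 ?normr1.
    by have [] := isum (finmap.enum_fset (fset_set (range (F n)))).
  by move=> /(cvg_lim (@Rhausdorff R)) <-; apply: cvg_lim => //; exact: cvg_cst.
move=> mp pYi.
pose pp y := Num.max (p y) 0; pose pn y := Num.max (- p y) 0.
have mpp : measurable_fun setT pp by exact: measurable_maxr.
have mpn : measurable_fun setT pn by apply: measurable_maxr => //; exact: measurableT_comp.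
have pE y : p y = pp y - pn y.
  by rewrite /pp /pn; case: (leP (p y) 0) => h; case: (leP (- p y) 0) => h'; lra.
have ppp y : `|pp y| <= `|p y|.
  by rewrite /pp; case: (leP (p y) 0) => h; rewrite ?normr0.
have pnp y : `|pn y| <= `|p y|.
  by rewrite /pn; case: (leP (- p y) 0) => h; rewrite ?normr0 ?normrN.
have ii (q : E -> R) : measurable_fun setT q -> (forall y, `|q y| <= `|p y|) ->
    Pr.-L1 (fun w => q (Z w) * Y w).
  move=> mq qp; apply: L1_le (L1_norm pYi) _.
    apply: measurable_funM; last exact: L1_measurable Yi.
    exact: measurableT_comp.
  by move=> w; rewrite !normrM ler_wpM2r.
have -> : \int[Pr]_w (p (Z w) * Y w) = \int[Pr]_w (pp (Z w) * Y w - pn (Z w) * Y w).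
  by apply: eq_Rintegral => w _; rewrite pE mulrBl.
rewrite RintegralB; [|exact: measurableT|exact: ii|exact: ii].
rewrite (nonneg pp) ?(nonneg pn) ?subrr//; try exact: ii.
- by move=> y; rewrite /pn le_max lexx orbT.
- by move=> y; rewrite /pp le_max lexx orbT.
Qed.

End laws.

(** * The Markov property for integrable observables *)

Section markov.
Context d d' (R : realType) (E : measurableType d) (Omega : measurableType d').
Variables (Pr : probability Omega R) (kappa : R -> R.-pker E ~> E).
Variables (X : R -> {mfun Omega >-> E}) (x : E).
Hypothesis X0 : \forall w \ae Pr, X 0 w = x.
Hypothesis markov : forall s t : R, 0 <= s -> 0 <= t ->
  forall (G : set Omega) (A : set E), right_past X s G -> measurable A ->
  Pr (G `&` X (s + t) @^-1` A) = (\int[Pr]_(w in G) kappa t (X s w) A)%E.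

Local Notation P := (semigroup kappa).
Local Notation law t := (distribution Pr (X t)).

Lemma measurable_preimage (Z : {mfun Omega >-> E}) B : measurable B ->
  measurable (Z @^-1` B).
Proof. by move=> mB; rewrite -[X in measurable X]setTI; exact: measurable_funP. Qed.

Lemma past_measurable s : past X s `<=` measurable.
Proof.
apply: smallest_sub; first exact: sigma_algebra_measurable.
by move=> _ [u [B [_ mB ->]]]; exact: measurable_preimage.
Qed.

Lemma right_past_measurable s G : right_past X s G -> measurable G.
Proof. by move=> /(_ (s + 1)) H; apply: (@past_measurable (s + 1)); apply: H; rewrite /= ltrDl. Qed.

Lemma past_preimage s u B : 0 <= u <= s -> measurable B -> past X s (X u @^-1` B).
Proof. by move=> us mB; apply: sub_sigma_algebra; exists u, B. Qed.

Lemma right_past_preimage s B : 0 <= s -> measurable B -> right_past X s (X s @^-1` B).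
Proof. by move=> s0 mB u /= su; apply: past_preimage => //; rewrite s0 ltW. Qed.

Lemma right_pastS s t : s <= t -> right_past X s `<=` right_past X t.
Proof. by move=> st G Gs u /= tu; apply: Gs; exact: le_lt_trans tu. Qed.

Lemma right_pastT s : right_past X s setT.
Proof.
move=> u _; rewrite -(setD0 setT); apply: sigma_algebraCD; exact: sigma_algebra0.
Qed.

Lemma law_transport s t : 0 <= s -> 0 <= t -> forall A, measurable A ->
  law (s + t) A = (\int[law s]_y kappa t y A)%E.
Proof.
move=> s0 t0 A mA.
have -> : law (s + t) A = Pr (setT `&` X (s + t) @^-1` A) by rewrite setTI.
rewrite (markov s0 t0 (@right_pastT s) mA) ge0_integral_distribution//.
exact: measurable_kernel.
Qed.

Lemma law_kernel t : 0 <= t -> forall A, measurable A -> law t A = kappa t x A.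
Proof.
move=> t0 A mA; rewrite -{1}(add0r t).
have -> : law (0 + t) A = Pr (setT `&` X (0 + t) @^-1` A) by rewrite setTI.
rewrite (markov (lexx 0) t0 (@right_pastT 0) mA).
rewrite (@ae_eq_integral _ _ _ Pr setT (fun=> kappa t x A)).
- by rewrite integral_cst// [X in (_ * X)%E](probability_setT Pr) mule1.
- exact: measurableT.
- exact: (measurableT_comp (measurable_kernel (kappa t) A mA)).
- exact: measurable_cst.
- by apply: filterS X0 => w + _ => ->.
Qed.

Let law_mixture s t q (s0 : 0 <= s) (t0 : 0 <= t) (qi : (law (s + t)).-L1 q) :=
  mixture_L1 (@measurable_kernel _ _ _ _ _ (kappa t)) (law_transport s0 t0) qi.

Lemma markov_L1 s t q G : 0 <= s -> 0 <= t -> (law (s + t)).-L1 q ->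
  right_past X s G ->
  \int[Pr]_w (\1_G w * q (X (s + t) w)) = \int[Pr]_w (\1_G w * P t q (X s w)).
Proof.
move=> s0 t0 qi Gs.
have mG := right_past_measurable Gs.
have m1G : measurable_fun setT (\1_G : Omega -> R) by exact: measurable_indic.
have G0 w : 0 <= \1_G w :> R by [].
have G1 w : `|\1_G w : R| <= 1.
  by rewrite indicE; case: (w \in G); rewrite ?normr0 ?normr1.
have mk A : measurable A -> measurable_fun setT (fun w => kappa t (X s w) A).
  by move=> mA; exact: (measurableT_comp (measurable_kernel (kappa t) A mA)).
have mdir A : measurable A -> measurable_fun setT (fun w => (\d_(X (s + t) w) : {measure set E -> \bar R}) A).
  move=> mA; apply/measurable_EFinP; apply: (measurableT_comp (measurable_indic mA)).
  by [].
have mX : measurable_fun setT (X (s + t)) by [].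
(* The law of X_(s+t) restricted to G is a mixture in two ways, both with weight 1_G: of the kernels
   at X_s, by the Markov property, and of the Dirac masses at X_(s+t). Integrating q both ways gives
   the claim. *)
pose pushX : {measure set E -> \bar R} :=
  pushforward (mrestr Pr mG) (X (s + t)).
pose nu := pushX mX.
have nuA A : nu A = Pr (X (s + t) @^-1` A `&` G) by [].
have nuE1 A : measurable A -> nu A = (\int[Pr]_w ((\1_G w)%:E * kappa t (X s w) A))%E.
  move=> mA; rewrite nuA setIC (markov s0 t0 Gs mA).
  by rewrite integral_mkcond; apply: eq_integral => w _; rewrite patchE indicE;
    case: (w \in G); rewrite ?mul1e ?mul0e.
have nuE2 A : measurable A -> nu A = (\int[Pr]_w ((\1_G w)%:E * \d_(X (s + t) w) A))%E.
  move=> mA; rewrite nuA.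
  rewrite -[LHS]mul1e -(@integral_cst _ _ _ Pr (X (s + t) @^-1` A `&` G)); last first.
    by apply: measurableI => //; exact: measurable_preimage.
  rewrite integral_mkcond; apply: eq_integral => w _.
  rewrite patchE indicE diracE in_setI.
  have -> : (w \in X (s + t) @^-1` A) = (X (s + t) w \in A) by apply/idP/idP; rewrite !inE.
  by case: (w \in G); case: (X (s + t) w \in A); rewrite ?mul1e ?mul0e.
have nonneg (p : E -> R) : (law (s + t)).-L1 p -> (forall y, 0 <= p y) ->
    Pr.-L1 (fun w => P t p (X s w)) /\ Pr.-L1 (fun w => p (X (s + t) w)) /\
    \int[Pr]_w (\1_G w * p (X (s + t) w)) = \int[Pr]_w (\1_G w * P t p (X s w)).
  move=> ip p0; have mp := L1_measurable ip.
  have mpE : measurable_fun setT (EFin \o p) by exact/measurable_EFinP.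
  have p0E y : (0 <= (EFin \o p) y)%E by rewrite lee_fin.
  have [kpi _] := law_mixture s0 t0 ip.
  have [j1 _] := law_L1 kpi; have [j2 _] := law_L1 ip.
  split => //; split => //.
  have := integral_mixture G0 m1G mk nuE1 p0E mpE.
  rewrite (integral_mixture G0 m1G mdir nuE2 p0E mpE) => H.
  rewrite /Rintegral.
  have -> : (\int[Pr]_w (\1_G w * p (X (s + t) w))%:E =
     \int[Pr]_w ((\1_G w)%:E * \int[\d_(X (s + t) w)]_y (EFin \o p) y))%E.
    by apply: eq_integral => w _; rewrite integral_dirac// diracT mul1e EFinM.
  rewrite H; congr fine; apply: ae_eq_integral => //.
  - apply: emeasurable_funM; first exact/measurable_EFinP.
    exact: measurable_fun_integral_kernel.
  - apply/measurable_EFinP; apply: measurable_funM => //.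
    exact: L1_measurable j1.
  have := law_ae (mixture_ae_L1 (@measurable_kernel _ _ _ _ _ (kappa t)) (law_transport s0 t0) ip).
  by apply: filterS => w kp _; rewrite EFinM /semigroup EFin_Rintegral.
have mq := L1_measurable qi.
pose fp y := (`|q y| + q y) / 2; pose fn y := (`|q y| - q y) / 2.
have fpi : (law (s + t)).-L1 fp.
  have := L1Z 2^-1 (L1D (L1_norm qi) qi).
  by congr (integrable _ _ _); apply/funext => y /=; rewrite mulrC.
have fni : (law (s + t)).-L1 fn.
  have := L1Z 2^-1 (L1B (L1_norm qi) qi).
  by congr (integrable _ _ _); apply/funext => y /=; rewrite mulrC.
have fp0 y : 0 <= fp y by have := ler_norm (- q y); rewrite normrN /fp; lra.
have fn0 y : 0 <= fn y by have := ler_norm (q y); rewrite /fn; lra.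
have qE y : q y = fp y - fn y by rewrite /fp /fn; field.
have [ip1 [ip2 Ep]] := nonneg fp fpi fp0; have [in1 [in2 En]] := nonneg fn fni fn0.
have [Pqi _] := law_mixture s0 t0 qi; have [iq _] := law_L1 Pqi.
transitivity (\int[Pr]_w (\1_G w * fp (X (s + t) w) - \1_G w * fn (X (s + t) w))).
  by apply: eq_Rintegral => w _; rewrite qE mulrBr.
rewrite (RintegralB measurableT (L1_mul_bounded m1G G1 ip2) (L1_mul_bounded m1G G1 in2)).
rewrite Ep En.
rewrite -(RintegralB measurableT (L1_mul_bounded m1G G1 ip1) (L1_mul_bounded m1G G1 in1)).
apply: ae_eq_Rintegral.
- exact: L1_measurable (L1B (L1_mul_bounded m1G G1 ip1) (L1_mul_bounded m1G G1 in1)).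
- exact: L1_measurable (L1_mul_bounded m1G G1 iq).
have kp := law_ae (mixture_ae_L1 (@measurable_kernel _ _ _ _ _ (kappa t)) (law_transport s0 t0) fpi).
have kn := law_ae (mixture_ae_L1 (@measurable_kernel _ _ _ _ _ (kappa t)) (law_transport s0 t0) fni).
apply: filterS2 kp kn => w kpw knw; rewrite -mulrBr; congr (_ * _).
by rewrite /semigroup -RintegralB//; apply: eq_Rintegral => y _; rewrite qE.
Qed.

End markov.

(** * Almost sure convergence of rapidly converging L2 sequences *)

Section fast_L2_convergence.
Context d (R : realType) (Omega : measurableType d) (Pr : {finite_measure set Omega -> \bar R}).

(** The rate 8^-n leaves room for the weight 4^n: the weighted squares have expectations at most
    2^-n, and K is their sum, finite almost surely. *)
Lemma fast_L2_summable (D : nat -> Omega -> R) :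
  (forall n, L2 Pr (D n)) ->
  (forall n, \int[Pr]_w (D n w ^+ 2) <= (8 ^+ n)^-1) ->
  exists K : Omega -> R, [/\ Pr.-L1 K, forall w, 0 <= K w &
    \forall w \ae Pr, forall n, (2 ^+ n * D n w) ^+ 2 <= K w].
Proof.
move=> lD Dn.
pose u n w := (2 ^+ n * D n w) ^+ 2.
have u0 n w : (0 <= (u n w)%:E)%E by rewrite lee_fin sqr_ge0.
have lu n : L2 Pr (fun w => 2 ^+ n * D n w) by exact: L2Z.
have mu n : measurable_fun setT (EFin \o u n).
  by apply/measurable_EFinP; exact: L1_measurable (lu n).2.
have Iu n : (\int[Pr]_w (u n w)%:E <= ((1 / (2 ^ n)%:R) : R)%:E)%E.
  rewrite -(EFin_Rintegral (lu n).2) lee_fin.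
  have -> : \int[Pr]_w ((2 ^+ n * D n w) ^+ 2) = 4 ^+ n * \int[Pr]_w (D n w ^+ 2).
    rewrite -(RintegralZl _ measurableT (lD n).2); apply: eq_Rintegral => w _.
    by rewrite exprMn -exprM mulnC exprM expr2; congr (_ ^+ _ * _); ring.
  apply: le_trans (ler_wpM2l (exprn_ge0 n _) (Dn n)) _; first by [].
  rewrite natrX div1r (_ : 8 = 4 * 2 :> R); last by ring.
  by rewrite exprMn invfM mulrA mulfV ?mul1r// expf_neq0.
pose S w := (\sum_(n <oo) (u n w)%:E)%E.
have mS : measurable_fun setT S.
  by apply: ge0_emeasurable_sum => [n w _ _|n _]; [exact: u0|exact: mu].
have S0 w : (0 <= S w)%E by apply: nneseries_ge0 => n _ _; exact: u0.
have IS : (\int[Pr]_w S w < +oo)%E.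
  rewrite integral_nneseries//.
  apply: (@le_lt_trans _ _ (\sum_(n <oo) ((1 / (2 ^ n)%:R) : R)%:E)%E).
    by apply: lee_nneseries => n *; [exact: integral_ge0|exact: Iu].
  have /(cvg_lim (@ereal_hausdorff R)) H := @cvg_geometric_eseries_half R 2 0.
  have -> : (\sum_(n <oo) ((1 / (2 ^ n)%:R) : R)%:E)%E = (2 / 2 ^+ 0 : R)%:E.
    rewrite -H; congr (limn _); apply/funext => k; apply: eq_bigr => i _.
    by congr EFin; rewrite addn1 expnS natrM invfM mulrA divff// mul1r div1r.
  exact: ltry.
have Si : Pr.-integrable setT S.
  apply/integrableP; split => //; under eq_integral do rewrite gee0_abs//.
  exact: IS.
have Sfin := integrable_ae measurableT Si.
exists (fun w => fine (S w)); split.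
- apply/integrableP; split; first by apply/measurable_EFinP; exact: measurableT_comp.
  apply: le_lt_trans IS; apply: ge0_le_integral => //.
  + apply: measurableT_comp => //; apply/measurable_EFinP; exact: measurableT_comp.
  + move=> w _ /=; rewrite ger0_norm ?fine_ge0//.
    by case: (S w) (S0 w) => //= r _; rewrite leey.
- by move=> w; rewrite fine_ge0.
- apply: filterS Sfin => w /(_ I) Sw n; rewrite -lee_fin fineK//.
  rewrite /S (@nneseriesD1 _ (fun k => (u k w)%:E) n xpredT)//.
    by rewrite leeDl//; apply: nneseries_ge0 => k _ _; exact: u0.
Qed.

(** The increments are at most 2^-n sqrt K, so they are summable and |M_n - M_0| <= 2 sqrt K. The
    resulting integrable bound on all the squares plays the part of Doob's maximal inequality. *)
Lemma fast_L2_cvg (M : nat -> Omega -> R) : (forall n, L2 Pr (M n)) ->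
  (forall n, \int[Pr]_w ((M n.+1 w - M n w) ^+ 2) <= (8 ^+ n)^-1) ->
  exists (Y g : Omega -> R), [/\ measurable_fun setT Y, Pr.-L1 g,
    \forall w \ae Pr, M ^~ w @ \oo --> Y w &
    \forall w \ae Pr, forall n, M n w ^+ 2 <= g w].
Proof.
move=> lM Mn.
pose D n w := M n.+1 w - M n w.
have [K [Ki K0 KD]] := fast_L2_summable (fun n => L2B (lM n.+1) (lM n)) Mn.
have DK w : (forall n, (2 ^+ n * D n w) ^+ 2 <= K w) ->
    forall n, `|D n w| <= Num.sqrt (K w) * 2^-1 ^+ n.
  move=> H n; have p2 : 0 < (2 ^+ n : R) by rewrite exprn_gt0.
  rewrite exprVn ler_pdivlMr// mulrC -(gtr0_norm p2) -normrM -sqrtr_sqr.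
  exact: ler_wsqrtr (H n).
have half1 : `|2^-1 : R| < 1 by rewrite ger0_norm// invf_lt1// ltr1n.
have cvgM w : (forall n, (2 ^+ n * D n w) ^+ 2 <= K w) -> cvgn (M ^~ w).
  move=> /DK H.
  have : cvgn (series (D ^~ w)).
    apply: normed_cvg; apply: (@series_le_cvg _ _ (geometric (Num.sqrt (K w)) 2^-1)).
    - by move=> n; exact: normr_ge0.
    - by move=> n; rewrite /= mulr_ge0// ?sqrtr_ge0// exprn_ge0.
    - exact: H.
    - exact: is_cvg_geometric_series.
  have -> : M ^~ w = (fun n => M 0%N w + series (D ^~ w) n).
    by apply/funext => n; exact: (eq_sum_telescope (M ^~ w)).
  by move=> c; apply: is_cvgD => //; exact: is_cvg_cst.
have bndM w n : (forall n, (2 ^+ n * D n w) ^+ 2 <= K w) ->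
    M n w ^+ 2 <= 2 * M 0%N w ^+ 2 + 8 * K w.
  move=> /DK H.
  have B k : `|M k w - M 0%N w| <= Num.sqrt (K w) * (2 - 2 * 2^-1 ^+ k).
    elim: k => [|k IH]; first by rewrite subrr normr0 expr0 mulr1 subrr mulr0.
    have -> : M k.+1 w - M 0%N w = D k w + (M k w - M 0%N w) by rewrite /D; ring.
    apply: le_trans (ler_normD _ _) _; apply: le_trans (lerD (H k) IH) _.
    rewrite -mulrDr exprS le_eqVlt; apply/orP; left; apply/eqP; congr (_ * _).
    by field.
  have B2 : `|M n w - M 0%N w| <= 2 * Num.sqrt (K w).
    apply: le_trans (B n) _; rewrite mulrC ler_wpM2r ?sqrtr_ge0//.
    by rewrite lerBlDr lerDl mulr_ge0// exprn_ge0.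
  have B3 : (M n w - M 0%N w) ^+ 2 <= 4 * K w.
    rewrite -(real_normK (num_real (M n w - M 0%N w))).
    apply: (@le_trans _ _ ((2 * Num.sqrt (K w)) ^+ 2)).
      by rewrite ler_pXn2r// ?nnegrE// mulr_ge0// sqrtr_ge0.
    by rewrite exprMn sqr_sqrtr// -natrX.
  have : 0 <= (M n w - 2 * M 0%N w) ^+ 2 by exact: sqr_ge0.
  move: B3; rewrite !sqrrD !sqrrN; nra.
have [N [mN N0 NK]] := KD.
have goodN w : ~ N w -> forall n, (2 ^+ n * D n w) ^+ 2 <= K w.
  by move=> nNw; apply: contrapT => H; apply: nNw; exact: NK.
(* M is set to 0 on the exceptional null set, so that the limit exists everywhere and is
   measurable. *)
pose h n w : R := M n w * \1_(~` N) w.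
have mh n : measurable_fun setT (h n).
  apply: measurable_funM; first exact: (lM n).1.
  by apply: measurable_indic; exact: measurableC.
have hN w : ~ N w -> h ^~ w = M ^~ w.
  by move=> nNw; apply/funext => n; rewrite /h indicE mem_set// mulr1.
have ch w : cvgn (h ^~ w).
  have [Nw|nNw] := pselect (N w); last by rewrite (hN _ nNw); apply: cvgM; exact: goodN.
  have -> : h ^~ w = (fun _ => 0); last exact: is_cvg_cst.
  by apply/funext => n; rewrite /h indicE memNset ?mulr0//; exact: contra_not.
exists (fun w => limn (h ^~ w)), (fun w => 2 * M 0%N w ^+ 2 + 8 * K w); split.
- exact: (measurable_fun_cvg mh (fun w _ => ch w)).
- by apply: L1D; apply: L1Z => //; exact: (lM 0%N).2.
- exists N; split => // w /= H; apply: contrapT => nNw; apply: H.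
  by rewrite -(hN _ nNw); exact: ch.
- by exists N; split => // w /= H; apply: contrapT => nNw; apply: H => n; apply: bndM; exact: goodN.
Qed.

End fast_L2_convergence.

(** * Blumenthal's zero-one law and the limit at time 0 *)

Section zero_one_law.
Context d d' (R : realType) (E : measurableType d) (Omega : measurableType d').
Variables (Pr : probability Omega R) (kappa : R -> R.-pker E ~> E).
Variables (X : R -> {mfun Omega >-> E}) (x : E).
Hypothesis X0 : \forall w \ae Pr, X 0 w = x.
Hypothesis markov : forall s t : R, 0 <= s -> 0 <= t ->
  forall (G : set Omega) (A : set E), right_past X s G -> measurable A ->
  Pr (G `&` X (s + t) @^-1` A) = (\int[Pr]_(w in G) kappa t (X s w) A)%E.

Local Notation P := (semigroup kappa).
Local Notation law t := (distribution Pr (X t)).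

Variables (T : R) (q : E -> R).
Hypothesis T0 : 0 < T.
Hypothesis lq : L2 (law T) q.

(** The martingale E[q(X_T) | F_s] of the right-continuous filtration. Its mean [m] is also its
    almost sure value at time 0, where X_0 = x. *)
Let M s w := P (T - s) q (X s w).
Let m := \int[law T]_y q y.

Let mkappa t : forall A, measurable A -> measurable_fun setT (kappa t ^~ A).
Proof. exact: measurable_kernel. Qed.

Let kappa1 t y : kappa t y setT = 1%E. Proof. exact: prob_kernel. Qed.

Let transport s : 0 <= s <= T -> forall A, measurable A ->
  law T A = (\int[law s]_y kappa (T - s)%R y A)%E.
Proof.
move=> /andP[s0 sT] A mA; have Ts0 : 0 <= T - s by rewrite subr_ge0.
by rewrite -(law_transport markov s0 Ts0 mA) subrKC.
Qed.

Lemma semigroup_law_L2 s : 0 <= s <= T -> L2 (law s) (P (T - s) q).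
Proof.
move=> sT; have [kq _] := mixture_L1 (@mkappa (T - s)) (transport sT) (L2_L1 lq).
have [kq2 _] := mixture_L1 (@mkappa (T - s)) (transport sT) lq.2.
have a1 := mixture_ae_L1 (@mkappa (T - s)) (transport sT) (L2_L1 lq).
have a2 := mixture_ae_L1 (@mkappa (T - s)) (transport sT) lq.2.
have mP : measurable_fun setT (P (T - s) q).
  exact: (measurable_kernel_Rintegral (@mkappa (T - s)) lq.1).
split => //; apply: (L1_ae_dom _ kq2); first exact: measurable_funX.
apply: filterS2 a1 a2 => y k1 k2.
by rewrite ger0_norm ?sqr_ge0//; exact: (Jensen_sqr (kappa1 (T - s) y) k1 k2).
Qed.

Let M_L2 s : 0 <= s <= T -> L2 Pr (M s).
Proof.
move=> sT; have lP := semigroup_law_L2 sT.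
by split; [exact: L1_measurable (law_L1 (L2_L1 lP)).1|exact: (law_L1 lP.2).1].
Qed.

Let lawM s : 0 <= s <= T -> \int[law s]_y (P (T - s) q y ^+ 2) = \int[Pr]_w (M s w ^+ 2).
Proof. by move=> sT; have [_] := law_L1 (semigroup_law_L2 sT).2. Qed.

Let M_past s G : 0 <= s <= T -> right_past X s G ->
  \int[Pr]_w (\1_G w * q (X T w)) = \int[Pr]_w (\1_G w * M s w).
Proof.
move=> /andP[s0 sT] Gs; have Ts0 : 0 <= T - s by rewrite subr_ge0.
have := @markov_L1 _ _ _ _ _ _ _ _ markov s (T - s) q G s0 Ts0; rewrite subrKC.
by move=> /(_ (L2_L1 lq) Gs).
Qed.

Let indic_bounded (G : set Omega) w : `|\1_G w : R| <= 1.
Proof. by rewrite indicE; case: (w \in G); rewrite ?normr0 ?normr1. Qed.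

Let L1_indicM G (f : Omega -> R) : measurable G -> Pr.-L1 f -> Pr.-L1 (fun w => \1_G w * f w).
Proof. by move=> mG fi; apply: L1_mul_bounded (indic_bounded G) fi. Qed.

(** Orthogonality of martingale increments: M t - M s integrates to 0 on every event of X_s, hence
    is orthogonal to M s, a function of X_s. *)
Let M_increment s t : 0 <= s -> s <= t -> t <= T ->
  \int[Pr]_w ((M t w - M s w) ^+ 2) = \int[Pr]_w (M t w ^+ 2) - \int[Pr]_w (M s w ^+ 2).
Proof.
move=> s0 st tT.
have sT : 0 <= s <= T by rewrite s0 (le_trans st).
have tT' : 0 <= t <= T by rewrite tT (le_trans s0).
have lMs := M_L2 sT; have lMt := M_L2 tT'; have lD := L2B lMt lMs.
have lP := semigroup_law_L2 sT.
have orth : \int[Pr]_w (M s w * (M t w - M s w)) = 0.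
  apply: (@Rintegral_comp_eq0 _ _ _ _ _ Pr (X s) (fun w => M t w - M s w)
    (P (T - s) q) (L2_L1 lD)); [|exact: lP.1|exact: L2_mul lMs lD].
  move=> B mB.
  have Gs := @right_past_preimage _ _ _ _ _ X s B s0 mB.
  have Gt := @right_pastS _ _ _ _ _ X s t st _ Gs.
  have mG := measurable_preimage (X s) mB.
  have -> : \int[Pr]_w (\1_B (X s w) * (M t w - M s w)) =
      \int[Pr]_w (\1_(X s @^-1` B) w * M t w - \1_(X s @^-1` B) w * M s w).
    apply: eq_Rintegral => w _; rewrite -mulrBr !indicE.
    by have -> : (w \in X s @^-1` B) = (X s w \in B) by apply/idP/idP; rewrite !inE.
  rewrite (RintegralB measurableT (L1_indicM mG (L2_L1 lMt)) (L1_indicM mG (L2_L1 lMs))).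
  by rewrite -(M_past tT' Gt) -(M_past sT Gs) subrr.
have -> : \int[Pr]_w ((M t w - M s w) ^+ 2) =
   \int[Pr]_w (M t w ^+ 2 - M s w ^+ 2 - 2 * (M s w * (M t w - M s w))).
  by apply: eq_Rintegral => w _; ring.
rewrite (RintegralB measurableT (L1B lMt.2 lMs.2) (L1Z 2 (L2_mul lMs lD))).
rewrite (RintegralB measurableT lMt.2 lMs.2).
by rewrite (RintegralZl _ measurableT (L2_mul lMs lD)) orth mulr0 subr0.
Qed.

Let M_right_past0 G : right_past X 0 G ->
  \int[Pr]_w (\1_G w * q (X T w)) = \int[Pr]_w (\1_G w * m).
Proof.
move=> G0; have mG := right_past_measurable G0.
have T00 : (0 : R) <= 0 <= T by rewrite lexx ltW.
rewrite (M_past T00 G0); apply: ae_eq_Rintegral.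
- exact: L1_measurable (L1_indicM mG (L2_L1 (M_L2 T00))).
- exact: L1_measurable (L1_indicM mG (L1_cst Pr m)).
apply: filterS X0 => w X0w; congr (_ * _); rewrite /M X0w subr0 /semigroup /m /Rintegral.
congr fine; apply: eq_measure_integral => A mA _.
by rewrite -(law_kernel X0 markov (ltW T0) mA).
Qed.

Let v s := \int[Pr]_w (M s w ^+ 2).

Let v_mono s t : 0 <= s -> s <= t -> t <= T -> v s <= v t.
Proof.
move=> s0 st tT; rewrite -subr_ge0 -(M_increment s0 st tT).
by apply: Rintegral_ge0 => w _; exact: sqr_ge0.
Qed.

(* The second moment of the martingale M decreases as s decreases to 0, so times can
   be chosen along which M converges almost surely. *)
Lemma approximating_times : exists s : nat -> R,
  [/\ forall n, 0 < s n <= T, forall n, s n < n.+1%:R^-1 &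
  forall n, \int[Pr]_w ((M (s n.+1) w - M (s n) w) ^+ 2) <= (8 ^+ n)^-1].
Proof.
have sub_le (a b c e : R) : c <= a -> b <= c + e -> b - a <= e.
  by move=> ca bc; rewrite lerBlDr (le_trans bc)// addrC lerD2l.
pose V := [set v s | s in [set s | 0 < s <= T]].
have V0 : V (v T) by exists T => //=; rewrite T0 lexx.
have hV : has_inf V.
  split; first by exists (v T).
  exists 0 => _ [s _ <-]; apply: Rintegral_ge0 => w _; exact: sqr_ge0.
pose v0 := inf V.
have lb s : 0 < s <= T -> v0 <= v s.
  by move=> sT; apply: ge_inf; [exact: hV.2|exists s].
have ex n : exists s, [/\ 0 < s <= T, s < n.+1%:R^-1 & v s <= v0 + (8 ^+ n)^-1].
  have e0 : 0 < (8 ^+ n : R)^-1 by rewrite invr_gt0 exprn_gt0.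
  have [_ [s /= /andP[s0 sT] <-] vs] := inf_adherent e0 hV.
  have n0 : 0 < (n.+1%:R : R)^-1 by rewrite invr_gt0.
  exists (Num.min s (n.+1%:R^-1 / 2)).
  have r0 : 0 < Num.min s (n.+1%:R^-1 / 2) by rewrite lt_min s0 divr_gt0.
  have rs : Num.min s (n.+1%:R^-1 / 2) <= s by rewrite ge_min lexx.
  split; first by rewrite r0 (le_trans rs).
    by rewrite gt_min; apply/orP; right; rewrite ltr_pdivrMr// ltr_pMr// ltr1n.
  by apply: le_trans (ltW vs); apply: v_mono => //; exact: ltW.
have [s sP] := choice ex.
exists s; split => n; [by have [] := sP n|by have [] := sP n|].
have [/andP[a0 aT] _ av] := sP n; have [/andP[b0 bT] _ bv] := sP n.+1.
have lba : v0 <= v (s n) by apply: lb; rewrite a0.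
have lbb : v0 <= v (s n.+1) by apply: lb; rewrite b0.
have e8 : (8 ^+ n.+1 : R)^-1 <= (8 ^+ n)^-1.
  rewrite lef_pV2 ?posrE ?exprn_gt0// exprS.
  by rewrite ler_peMl ?exprn_ge0// ler1n.
(* The chosen times need not decrease. Both second moments lie between [v0] and [v0] + 8^-n, which
   bounds the increment in either order. *)
have [ab|/ltW ba] := leP (s n) (s n.+1).
  rewrite (M_increment (ltW a0) ab bT); apply: sub_le lba _.
  by apply: le_trans bv _; rewrite lerD2l.
have -> : \int[Pr]_w ((M (s n.+1) w - M (s n) w) ^+ 2) =
    \int[Pr]_w ((M (s n) w - M (s n.+1) w) ^+ 2).
  by apply: eq_Rintegral => w _; ring.
by rewrite (M_increment (ltW b0) ba aT); exact: sub_le lbb av.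
Qed.

(** A lower limit of events is unchanged when its first terms are dropped, and for each u > 0 the
    remaining terms involve times at most u only. *)
Lemma right_past_liminf (s : nat -> R) (B : nat -> set E) :
  (forall n, 0 <= s n) -> (forall n, s n < n.+1%:R^-1) -> (forall n, measurable (B n)) ->
  right_past X 0 (\bigcup_N \bigcap_n (X (s (N + n)%N) @^-1` B (N + n)%N)).
Proof.
move=> s0 sn mB u /= u0.
have [N0 N0u] : exists N0, forall n, (N0 <= n)%N -> s n <= u.
  have [N0 HN] : exists N0, (N0.+1%:R : R)^-1 < u.
    have := near_infty_natSinv_lt (PosNum u0).
    by move=> [N0 _ H]; exists N0; apply: H => /=.
  exists N0 => n N0n; apply: ltW; apply: lt_trans (sn n) _; apply: le_lt_trans HN.
  by rewrite lef_pV2 ?posrE ?ltr0n// ler_nat.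
have -> : \bigcup_N \bigcap_n (X (s (N + n)%N) @^-1` B (N + n)%N) =
    \bigcup_N \bigcap_n (X (s (N0 + N + n)%N) @^-1` B (N0 + N + n)%N).
  apply/seteqP; split => w [N _ H].
    by exists N => // n _; have := H (N0 + n)%N I; rewrite addnA (addnC N N0).
  by exists (N0 + N)%N.
apply: sigma_algebra_bigcup => N.
rewrite -[X in <<s _ >> X]setCK setC_bigcap -setTD.
apply: sigma_algebraCD; apply: sigma_algebra_bigcup => n; rewrite -setTD.
apply: sigma_algebraCD; apply: past_preimage => //.
by rewrite s0 N0u// -addnA leq_addr.
Qed.

(** Along the approximating times M converges almost surely to some Y with dominated squares. Every
    event of the right-continuous past at 0 gives Y and the constant m the same integral, which
    forces Y = m, so the second moments tend to m^2. *)
Lemma semigroup_law_cvg (e : R) : 0 < e -> exists s, [/\ 0 < s, s < e, s <= T &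
  \int[law s]_y (P (T - s) q y ^+ 2) <= (\int[law T]_y q y) ^+ 2 + e].
Proof.
move=> e0; have [s [sT sn Ms]] := approximating_times.
have s0T n : 0 <= s n <= T by have /andP[/ltW -> ->] := sT n.
have [Y [g [mY gi cY Mg]]] := fast_L2_cvg (fun n => M_L2 (s0T n)) Ms.
have gi1 : Pr.-L1 (fun w => 1 + g w) by apply: L1D => //; exact: L1_cst.
have sqle (a b : R) : a ^+ 2 <= b -> `|a| <= 1 + b.
  move=> ab; rewrite -(real_normK (num_real a)) in ab.
  by have : 0 <= (`|a| - 1) ^+ 2; [exact: sqr_ge0|rewrite sqrrB; nra].
have mM n : measurable_fun setT (M (s n)) := (M_L2 (s0T n)).1.
have [||Yi _] := @dominated_Rintegral_cvg _ _ _ Pr (fun n => M (s n)) Y _ mM mY gi1.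
- exact: cY.
- by apply: filterS Mg => w H n; apply: sqle; exact: H.
have YG G : right_past X 0 G -> \int[Pr]_w (\1_G w * (Y w - m)) = 0.
  move=> G0; have mG := right_past_measurable G0.
  have m1G : measurable_fun setT (\1_G : Omega -> R) by exact: measurable_indic.
  have [|||||_] := @dominated_Rintegral_cvg _ _ _ Pr (fun n w => \1_G w * M (s n) w)
    (fun w => \1_G w * Y w) (fun w => 1 + g w).
  - by move=> n; exact: measurable_funM.
  - exact: measurable_funM.
  - exact: gi1.
  - by apply: filterS cY => w; apply: cvgM; exact: cvg_cst.
  - apply: filterS Mg => w H n; apply: le_trans (sqle _ _ (H n)).
    by rewrite normrM ler_piMl.
  have -> : (fun n => \int[Pr]_w (\1_G w * M (s n) w)) = (fun _ => \int[Pr]_w (\1_G w * m)).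
    apply/funext => n; rewrite -M_right_past0// (M_past (s0T n))//.
    by apply: (@right_pastS _ _ _ _ _ X 0 (s n)) => //; case/andP: (s0T n).
  move=> /(cvg_lim (@Rhausdorff R)); rewrite lim_cst//.
  move=> H.
  have -> : \int[Pr]_w (\1_G w * (Y w - m)) = \int[Pr]_w (\1_G w * Y w - \1_G w * m).
    by apply: eq_Rintegral => w _; rewrite mulrBr.
  rewrite (RintegralB measurableT (L1_indicM mG Yi) (L1_indicM mG (L1_cst Pr m))).
  by rewrite -H subrr.
(* Y - m integrates to 0 over every event of the right-continuous past at 0.  The
   event A is one of them; it contains [Y > m], and Y >= m almost surely on A. *)
pose B n := [set y | m <= P (T - s n) q y].
have mB n : measurable (B n).
  rewrite -[B n]setTI; apply: measurable_fun_le => //.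
  exact: (semigroup_law_L2 (s0T n)).1.
have A0 := right_past_liminf (fun n => (andP (s0T n)).1) sn mB.
set A := \bigcup_N _ in A0.
have mA := right_past_measurable A0.
have Ym0 : Pr.-L1 (fun w => Y w - m) by apply: L1B => //; exact: L1_cst.
have AY : \forall w \ae Pr, \1_A w * (Y w - m) = 0.
  apply: Rintegral_eq0_ae; [exact: L1_indicM| |exact: YG].
  apply: filterS cY => w Yw; rewrite indicE.
  have [/set_mem Aw|_] := boolP (w \in A); last by rewrite mul0r.
  rewrite mul1r subr_ge0; have [N _ H] := Aw.
  rewrite -(cvg_lim (@Rhausdorff R) Yw); apply: limr_ge; first by apply: cvgP Yw.
  exists N => // n /= Nn; have := H (n - N)%N I; rewrite subnKC//.
have Ym : \forall w \ae Pr, Y w <= m.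
  apply: filterS2 cY AY => w Yw AYw; rewrite leNgt; apply/negP => mY'.
  have Aw : A w.
    have [N _ H] := cvgr_ge _ Yw _ mY'.
    by exists N => // n _; apply: H => /=; exact: leq_addr.
  by move: AYw; rewrite indicE mem_set// mul1r => /eqP; rewrite subr_eq0 => /eqP YE; move: mY'; rewrite YE ltxx.
have Yeq : \forall w \ae Pr, m - Y w = 0.
  apply: Rintegral_eq0_ae; first by apply: L1B => //; exact: L1_cst.
    by apply: filterS Ym => w; rewrite subr_ge0.
  have := YG setT (@right_pastT _ _ _ _ _ X 0).
  have -> : \int[Pr]_w (\1_[set: Omega] w * (Y w - m)) = \int[Pr]_w (Y w - m).
    by apply: eq_Rintegral => w _; rewrite indicT mul1r.
  move=> H; have -> : \int[Pr]_w (m - Y w) = \int[Pr]_w (- (Y w - m)).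
    by apply: eq_Rintegral => w _; rewrite opprB.
  by rewrite RintegralN// H oppr0.
have [|||||_] := @dominated_Rintegral_cvg _ _ _ Pr (fun n w => M (s n) w ^+ 2)
    (fun w => m ^+ 2) g.
- by move=> n; exact: measurable_funX.
- exact: measurable_cst.
- exact: gi.
- apply: filterS2 cY Yeq => w Yw /eqP; rewrite subr_eq0 => /eqP ->.
  by under eq_fun do rewrite expr2; rewrite expr2; apply: cvgM.
- by apply: filterS Mg => w H n; rewrite ger0_norm ?sqr_ge0.
rewrite prob_Rintegral_cst; last exact: probability_setT.
move=> cM2; have [N1 _ H1] := cvg_near_leD cM2 e0.
have [N2 _ H2] := near_infty_natSinv_lt (PosNum e0).
pose n := maxn N1 N2; exists (s n); have /andP[sn0 snT] := sT n.
split => //.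
- by apply: lt_trans (sn n) _; apply: H2 => /=; exact: leq_maxr.
- rewrite (lawM (s0T n)); apply: H1 => /=; exact: leq_maxl.
Qed.

End zero_one_law.

(** * Change of measure by a density *)

Section density.
Context d (R : realType) (E : measurableType d) (mu nu : probability E R) (f : E -> R).
Hypothesis fi : mu.-L1 f.
Hypothesis f0 : \forall y \ae mu, 0 < f y.
Hypothesis fnu : is_density mu nu f.

Let mf : measurable_fun setT f := L1_measurable fi.

(** The absolute value of f appears because [integral_mixture] wants a weight that is nonnegative
    everywhere, whereas f is positive almost everywhere. *)
Let ge0_density (q : E -> \bar R) : (forall y, (0 <= q y)%E) -> measurable_fun setT q ->
  (\int[nu]_y q y = \int[mu]_y (`|f y|%:E * q y))%E.
Proof.
move=> q0 mq.
have mdir A : measurable A ->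
    measurable_fun setT (fun y => (\d_y : {measure set E -> \bar R}) A).
  by move=> mA; apply/measurable_EFinP; exact: measurable_indic.
have maf : measurable_fun setT (fun y => `|f y|) by exact: measurableT_comp.
rewrite (@integral_mixture _ _ _ _ _ mu (fun y => `|f y|) (fun y => \d_y))//.
  by apply: eq_integral => y _; rewrite integral_dirac// diracT mul1e.
move=> A mA; apply: (etrans (fnu mA)); rewrite [LHS]integral_mkcond.
apply: ae_eq_integral => //.
- apply/(measurable_restrictT _ mA).1.
  by apply: measurable_funTS; exact/measurable_EFinP.
- by apply: emeasurable_funM; [exact/measurable_EFinP|exact: mdir].
- apply: filterS f0 => y fy0 _; rewrite patchE /= diracE.
  by case: (y \in A); rewrite ?mule1 ?mule0// gtr0_norm.
Qed.

Lemma density_ae (Q : E -> Prop) : (\forall y \ae mu, Q y) -> \forall y \ae nu, Q y.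
Proof.
move=> [N [mN N0 QN]]; exists N; split => //; apply: (etrans (fnu mN)).
apply: null_set_integral => //.
by apply: measurable_funTS; exact/measurable_EFinP.
Qed.

Lemma density_L1P q : measurable_fun setT q ->
  nu.-L1 q <-> mu.-L1 (fun y => q y * f y).
Proof.
move=> mq.
have mqE : measurable_fun setT (EFin \o q) by exact/measurable_EFinP.
have mqf : measurable_fun setT (EFin \o (fun y => q y * f y)).
  by apply/measurable_EFinP; exact: measurable_funM.
have H : (\int[nu]_y `|(EFin \o q) y| = \int[mu]_y `|(EFin \o (fun y => q y * f y)%R) y|)%E.
  rewrite ge0_density//; last exact: measurableT_comp.
  by apply: eq_integral => y _; rewrite /= -EFinM -normrM mulrC.
by split => /integrableP[_ i]; apply/integrableP; split => //; rewrite ?H// -H.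
Qed.

Lemma density_Rintegral q : nu.-L1 q ->
  \int[nu]_y q y = \int[mu]_y (q y * f y).
Proof.
move=> qi; have mq := L1_measurable qi.
have nonneg (p : E -> R) : nu.-L1 p -> (forall y, 0 <= p y) ->
    \int[nu]_y p y = \int[mu]_y (p y * f y).
  move=> pi p0; have mp := L1_measurable pi.
  have -> : \int[mu]_y (p y * f y) = \int[mu]_y (`|f y| * p y).
    apply: ae_eq_Rintegral.
    - exact: measurable_funM.
    - by apply: measurable_funM => //; exact: measurableT_comp.
    - by apply: filterS f0 => y fy0; rewrite gtr0_norm// mulrC.
  have p0E y : (0 <= (EFin \o p) y)%E by rewrite lee_fin.
  have mpE : measurable_fun setT (EFin \o p) by exact/measurable_EFinP.
  by rewrite /Rintegral (ge0_density p0E mpE); congr fine.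
pose fp y := (`|q y| + q y) / 2; pose fn y := (`|q y| - q y) / 2.
have fpi : nu.-L1 fp.
  have := L1Z 2^-1 (L1D (L1_norm qi) qi).
  by congr (integrable _ _ _); apply/funext => y /=; rewrite mulrC.
have fni : nu.-L1 fn.
  have := L1Z 2^-1 (L1B (L1_norm qi) qi).
  by congr (integrable _ _ _); apply/funext => y /=; rewrite mulrC.
have fp0 y : 0 <= fp y by have := ler_norm (- q y); rewrite normrN /fp; lra.
have fn0 y : 0 <= fn y by have := ler_norm (q y); rewrite /fn; lra.
have qE y : q y = fp y - fn y by rewrite /fp /fn; field.
transitivity (\int[nu]_y (fp y - fn y)).
  by apply: eq_Rintegral => y _; exact: qE.
have i1 := (density_L1P (L1_measurable fpi)).1 fpi.
have i2 := (density_L1P (L1_measurable fni)).1 fni.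
rewrite (RintegralB measurableT fpi fni) (nonneg _ fpi fp0) (nonneg _ fni fn0).
rewrite -(RintegralB measurableT i1 i2); apply: eq_Rintegral => y _.
by rewrite qE mulrBl.
Qed.

End density.

(** The convex function u ln u lies above its tangent at b; this follows from 1 + u <= e^u at u = ln
    b - ln a. It serves both for Jensen's inequality and for the dissipation of entropy. *)
Lemma ln_tangent (R : realType) (a b : R) : 0 < a -> 0 < b ->
  a * ln b + a - b <= a * ln a.
Proof.
move=> a0 b0.
have H := expR_ge1Dx (ln b - ln a).
have E1 : a * expR (ln b - ln a) = b.
  by rewrite expRD expRN !lnK// mulrCA divff ?gt_eqF// mulr1.
have : a * (1 + (ln b - ln a)) <= b by rewrite -[leRHS]E1 ler_pM2l.
rewrite mulrDr mulr1 mulrBr.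
move: (a * ln b) (a * ln a) => u v; lra.
Qed.

(** * Entropy along the semigroup *)

Section entropy.
Context d (R : realType) (E : measurableType d) (mu : probability E R).
Variable kappa : R -> R.-pker E ~> E.
Hypothesis kappaS : symmetric_markov_semigroup mu kappa.

Local Notation P := (semigroup kappa).

Definition entropy (f : E -> R) : R := \int[mu]_y (f y * ln (f y)).

Lemma measurable_ln_comp (f : E -> R) : measurable_fun setT f ->
  measurable_fun setT (fun y => ln (f y)).
Proof. by move=> mf; exact: (measurableT_comp (@measurable_ln R) mf). Qed.

(* Jensen's inequality for the convex function a ln a, applied to the kernel. *)
Lemma entropy_semigroup h (f f' : E -> R) : 0 <= h -> L2 mu f -> (\forall y \ae mu, 0 < f y) ->
  mu.-L1 (fun y => f y * ln (f y)) ->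
  measurable_fun setT f' -> (\forall y \ae mu, 0 < f' y) ->
  (\forall y \ae mu, f' y = P h f y) ->
  mu.-L1 (fun y => f' y * ln (f' y)) -> entropy f' <= entropy f.
Proof.
move=> h0 lf f0 ei mf' f'0 f'E ei'.
rewrite /entropy -(Rintegral_semigroup kappaS h0 ei).
apply: ae_le_Rintegral => //; first exact: semigroup_L1 ei.
have A1 : \forall y \ae mu, 0 < f' y /\ f' y = P h f y.
  by apply: filterS2 f'0 f'E => y.
have A : \forall y \ae mu, (0 < f' y /\ f' y = P h f y) /\
    (\forall z \ae kappa h y, 0 < f z).
  by apply: filterS2 A1 (kernel_ae kappaS h0 f0) => y.
have B : \forall y \ae mu, (kappa h y).-L1 f /\ (kappa h y).-L1 (fun z => f z * ln (f z)).
  by apply: filterS2 (kernel_ae_L1 kappaS h0 (L2_L1 lf)) (kernel_ae_L1 kappaS h0 ei) => y.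
apply: filterS2 A B => y [[f'y0 f'Ey] kf0] [kf ke].
set b := f' y in f'y0 f'Ey *.
have k1 : kappa h y setT = 1%E by exact: prob_kernel.
have i0 : (kappa h y).-L1 (fun z => f z * ln b).
  by under eq_fun do rewrite mulrC; exact: L1Z.
have i1 : (kappa h y).-L1 (fun z => f z * ln b + f z) by exact: L1D.
have i2 : (kappa h y).-L1 (fun _ => b) by exact: prob_L1_cst.
have : \int[kappa h y]_z (f z * ln b + f z - b) <= P h (fun z => f z * ln (f z)) y.
  apply: ae_le_Rintegral => //; first exact: L1B.
  by apply: filterS kf0 => z fz0; exact: ln_tangent.
rewrite (RintegralB measurableT i1 i2) (RintegralD measurableT i0 kf).
rewrite (RintegralZr _ measurableT kf) (prob_Rintegral_cst k1).
by rewrite -[\int[kappa h y]_z f z]/(P h f y) -f'Ey addrK.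
Qed.

End entropy.

(** * Varentropy and entropy dissipation of the diffusion *)

Section diffusion.
Context d d' (R : realType) (E : measurableType d) (Omega : measurableType d').
Variables (mu : probability E R) (Pr : probability Omega R).
Variables (kappa : R -> R.-pker E ~> E) (X : R -> {mfun Omega >-> E}) (x : E).
Hypothesis kappaS : symmetric_markov_semigroup mu kappa.
Hypothesis X_markov : markov_process Pr kappa X x.

Local Notation P := (semigroup kappa).
Local Notation Lgen := (generator mu kappa).
Local Notation Gamma := (carre_du_champ mu kappa).
Local Notation law t := (distribution Pr (X t)).

Definition smooth_density (t : R) (f : E -> R) : Prop :=
  let g := @ln R \o f in
  [/\ is_density mu (law t) f,
      \forall y \ae mu, 0 < f y,
      [/\ in_dom mu kappa f, in_dom mu kappa g,
          in_dom mu kappa (f \* f), in_dom mu kappa (g \* g)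
        & in_dom mu kappa (f \* g)],
      chain_rule mu kappa (@ln R) f g
    & nonneg_curvature mu kappa g].

Hypothesis law_density : forall s, 0 < s ->
  exists fs, [/\ mu.-L1 fs, \forall y \ae mu, 0 < fs y & is_density mu (law s) fs].

Section one_time.
Variables (t : R) (f : E -> R).
Hypothesis t0 : 0 < t.
Hypothesis fP : smooth_density t f.
Let g := @ln R \o f.

Let lf : L2 mu f. Proof. by case: fP => _ _ [/in_dom_L2]. Qed.
Let lg : L2 mu g. Proof. by case: fP => _ _ [_ /in_dom_L2]. Qed.
Let lfg : L2 mu (f \* g). Proof. by case: fP => _ _ [_ _ _ _ /in_dom_L2]. Qed.
Let f0 : \forall y \ae mu, 0 < f y. Proof. by case: fP. Qed.
Let fi : mu.-L1 f := L2_L1 lf.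
Let fden : is_density mu (law t) f. Proof. by case: fP. Qed.

Let domg : in_dom_carre_du_champ mu kappa g g.
Proof. by case: fP => _ _ [_ ? _ ? _]. Qed.

Let domfg : in_dom_carre_du_champ mu kappa f g.
Proof. by case: fP => _ _ [? ? _ _ ?]. Qed.

Lemma smooth_density_L1 : mu.-L1 (fun y => f y * ln (f y)).
Proof. exact: L2_L1 lfg. Qed.

(** The domain condition on f g enters here: g^2 f = g (f g) is a product of two L2 functions. In
    the same way f Gamma g is a combination of f L(g^2) and (f g) L g. *)
Lemma smooth_density_L2_law : L2 (law t) g.
Proof.
split; first exact: lg.1.
apply/(density_L1P fi f0 fden); first exact: measurable_funX lg.1.
have := L2_mul lg lfg; congr (integrable _ _ _); apply/funext => y /=.
by congr EFin; ring.
Qed.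

Lemma entropy_law : entropy mu f = \int[law t]_y g y.
Proof.
rewrite (density_Rintegral fi f0 fden (L2_L1 smooth_density_L2_law)).
by apply: eq_Rintegral => y _; rewrite mulrC.
Qed.

Let Gamma_law : (law t).-L1 (Gamma g g).
Proof.
have Gi := carre_du_champ_L1 domg.
apply/(density_L1P fi f0 fden); first exact: L1_measurable Gi.
have [dg _ dgg] := domg.
have i1 := L2_mul lf (generator_L2 dgg).
have i2 := L2_mul lfg (generator_L2 dg).
have := L1Z 2^-1 (L1B i1 (L1Z 2 i2)).
congr (integrable _ _ _); apply/funext => y /=; congr EFin.
by rewrite /carre_du_champ; ring.
Qed.

(** The Fisher information of the law of X_t, in the form that arises when the entropy is varied in
    time. *)
Definition entropy_flux : R := - \int[mu]_y (f y * Lgen g y).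

(** The chain rule turns f Gamma(log f, log f) into Gamma(f, log f), which is then integrated by
    parts. *)
Let flux_law : \int[law t]_y Gamma g g y = entropy_flux.
Proof.
rewrite (density_Rintegral fi f0 fden Gamma_law) /entropy_flux.
rewrite -(Rintegral_carre_du_champ kappaS domfg).
have Gi := carre_du_champ_L1 domg; have Gfi := carre_du_champ_L1 domfg.
apply: ae_eq_Rintegral.
- by apply: measurable_funM; [exact: L1_measurable Gi|exact: lf.1].
- exact: L1_measurable Gfi.
have ch : chain_rule mu kappa (@ln R) f g by case: fP.
apply: filterS2 f0 ch => y fy0; rewrite -/g => ->.
have dln : derive1 (@ln R) (f y) = (f y)^-1.
  by rewrite derive1E; have H := is_derive1_ln fy0; rewrite derive_val.
by rewrite dln mulrAC mulVf ?mul1r// gt_eqF.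
Qed.

Definition varentropy : R := \int[law t]_y (g y ^+ 2) - (\int[law t]_y g y) ^+ 2.

Lemma varentropy_le : varentropy <= 2 * t * entropy_flux.
Proof.
have lgl := smooth_density_L2_law.
have [X0 markov] := X_markov.
have curvg : nonneg_curvature mu kappa g by case: fP.
have mk s A : measurable A -> measurable_fun setT (kappa s ^~ A) by exact: measurable_kernel.
rewrite /varentropy lerBlDr; apply/ler_addgt0Pr => e e0.
(* Since s < [e1], this absorbs both the error on the second moment of P_(t-s) g and the term 2 s
   [entropy_flux], whatever the sign of the flux. *)
pose e1 := e / (1 + 2 * `|entropy_flux|).
have e10 : 0 < e1 by rewrite divr_gt0// ltr_wpDr// mulr_ge0.
have [s [s0 se st H]] := semigroup_law_cvg X0 markov t0 lgl e10.
have ts0 : 0 <= t - s by rewrite subr_ge0.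
have tr A : measurable A -> law t A = (\int[law s]_y kappa (t - s) y A)%E.
  by move=> mA; rewrite -(law_transport markov (ltW s0) ts0 mA) subrKC.
have mix := mixture_L1 (mk (t - s)) tr.
have [i1 E1] := mix _ lgl.2; have [i3 E3] := mix _ Gamma_law.
have sT : 0 <= s <= t by rewrite ltW.
have lP := semigroup_law_L2 markov lgl sT.
have i2 := lP.2.
(* Absolute continuity of the law of X_s, for s > 0, is what carries the local Poincare inequality
   from mu to the process. *)
have law_s_ac (Q : E -> Prop) : (\forall y \ae mu, Q y) -> \forall y \ae law s, Q y.
  by move=> Qmu; have [fs [fs_i fs0 fsden]] := law_density s0; exact: (density_ae fs_i fsden Qmu).
have LP : \forall y \ae law s, P (t - s) (fun x => g x ^+ 2) y - P (t - s) g y ^+ 2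
    <= 2 * (t - s) * P (t - s) (Gamma g g) y.
  exact: law_s_ac (local_poincare kappaS domg curvg ts0).
have := ae_le_Rintegral (L1B i1 i2) (L1Z (2 * (t - s)) i3) LP.
rewrite (RintegralB measurableT i1 i2) (RintegralZl _ measurableT i3) -E1 -E3 flux_law.
move=> H2.
have H3 : e1 * (1 + 2 * `|entropy_flux|) = e.
  by rewrite /e1 mulfVK// gt_eqF// ltr_wpDr// mulr_ge0.
have H4 : - (2 * s * entropy_flux) <= e1 * (2 * `|entropy_flux|).
  have : - entropy_flux <= `|entropy_flux| by rewrite -normrN ler_norm.
  have := normr_ge0 entropy_flux.
  move: (entropy_flux) `|entropy_flux| => F A A0 FA.
  have : s * - F <= e1 * A.
    apply: (@le_trans _ _ (s * A)); first by rewrite ler_pM2l.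
    by rewrite ler_wpM2r// ltW.
  rewrite mulrN => H5; rewrite (_ : 2 * s * F = 2 * (s * F)); last by ring.
  rewrite (_ : e1 * (2 * A) = 2 * (e1 * A)); last by ring.
  move: (s * F) (e1 * A) H5 => u v; lra.
rewrite mulrDr mulr1 in H3; rewrite (mulrBr 2) mulrBl in H2.
move: H H2 H3 H4.
move: (\int[law s]_y _) (\int[law t]_y _ ^+ 2) (_ ^+ 2) => a b c.
move: (e1 * _) (2 * s * _) (2 * t * _) => u v w; lra.
Qed.

End one_time.

Variable f : R -> E -> R.
Hypothesis fP : forall t, 0 < t -> smooth_density t (f t).

Let lf t : 0 < t -> L2 mu (f t). Proof. by case/fP => _ _ [/in_dom_L2]. Qed.
Let dg t : 0 < t -> in_dom mu kappa (@ln R \o f t). Proof. by case/fP => _ _ []. Qed.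
Let f0 t : 0 < t -> \forall y \ae mu, 0 < f t y. Proof. by case/fP. Qed.
Let fden t : 0 < t -> is_density mu (law t) (f t). Proof. by case/fP. Qed.
Let markov := X_markov.2.

(** By reversibility the semigroup acts on the densities themselves: the law of X_(t+h) gives A the
    integral of f_t P_h 1_A, and symmetry moves P_h onto f_t. *)
Lemma density_semigroup t h : 0 < t -> 0 <= h ->
  \forall y \ae mu, f (t + h) y = P h (f t) y.
Proof.
move=> t0 h0; have th0 : 0 < t + h by rewrite ltr_wpDr.
have fi := L2_L1 (lf th0); have Pi := semigroup_L1 kappaS h0 (L2_L1 (lf t0)).
have : ae_eq mu setT (EFin \o f (t + h)) (EFin \o P h (f t)).
  apply: integral_ae_eq => //.
    by apply/measurable_EFinP; exact: L1_measurable Pi.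
  move=> A _ mA; apply: (etrans (esym (fden th0 mA))).
  apply: (etrans (law_transport markov (ltW t0) h0 mA)).
  have i1 : (law t).-L1 (P h \1_A).
    apply: (@L1_bounded _ _ _ _ _ 1); first by apply: measurable_semigroup.
    move=> y; apply: semigroup_bounded => // z.
    by rewrite indicE; case: (z \in A); rewrite ?normr0 ?normr1.
  transitivity ((\int[law t]_y P h \1_A y)%:E).
    by rewrite EFin_Rintegral//; apply: eq_integral => y _; rewrite semigroup_indic.
  rewrite (density_Rintegral (L2_L1 (lf t0)) (f0 t0) (fden t0) i1).
  rewrite (semigroup_symmetric kappaS h0 (L2_indic mu mA) (lf t0)).
  have i2 : mu.-L1 (fun y => \1_A y * P h (f t) y).
    apply: (@L1_mul_bounded _ _ _ _ _ _ 1) => // y.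
    by rewrite indicE; case: (y \in A); rewrite ?normr0 ?normr1.
  rewrite EFin_Rintegral// [RHS]integral_mkcond; apply: eq_integral => y _.
  by rewrite patchE indicE; case: (y \in A); rewrite ?mul1r ?mul0r.
by apply: filterS => y /(_ I) [].
Qed.

Lemma entropy_nonincreasing t h : 0 < t -> 0 <= h ->
  entropy mu (f (t + h)) <= entropy mu (f t).
Proof.
move=> t0 h0; have th0 : 0 < t + h by rewrite ltr_wpDr.
apply: (entropy_semigroup kappaS h0 (lf t0) (f0 t0)).
- exact: smooth_density_L1 (fP t0).
- exact: (lf th0).1.
- exact: f0.
- exact: density_semigroup.
- exact: smooth_density_L1 (fP th0).
Qed.

Lemma Rintegral_density t : 0 < t -> \int[mu]_y f t y = 1.
Proof.
move=> t0; have := density_Rintegral (L2_L1 (lf t0)) (f0 t0) (fden t0) (L1_cst (law t) 1).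
rewrite prob_Rintegral_cst; last exact: probability_setT.
by move=> ->; apply: eq_Rintegral => y _; rewrite mul1r.
Qed.

(** Only the logarithm g of the later density f_t is used: D(t - h) is at least the integral of
    f_(t-h) g by the tangent inequality, and D(t) is that of f_(t-h) P_h g by symmetry. Their
    difference involves the difference quotient of g, whose limit is L g. *)
Lemma entropy_left_dini t e : 0 < t -> 0 < e -> \forall h \near 0^'+,
  entropy mu (f t) + h * (entropy_flux (f t) - e) <= entropy mu (f (t - h)).
Proof.
move=> t0 e0.
have PF : ProperFilter (0 : R)^'+ := at_right_proper_filter 0.
have t20 : 0 < t / 2 by rewrite divr_gt0.
pose g := @ln R \o f t.
have lgt : L2 mu g := in_dom_L2 (dg t0).
(* Restarting from time t / 2 reduces continuity of the densities at t to left continuity of the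
   semigroup. *)
have cu : norm2 mu (fun y => f (t - h) y - f t y) @[h --> 0^'+] --> 0.
  apply: (cvg_trans _ (semigroup_left_cvg kappaS t20 (lf t20))).
  apply: near_eq_cvg; near=> h.
  have ht : h < t / 2 by near: h; exact: nbhs_right_lt.
  have t2h : 0 <= t / 2 - h by rewrite subr_ge0 ltW.
  have e1 := density_semigroup t20 t2h; have e2 := density_semigroup t20 (ltW t20).
  rewrite -splitr in e2; rewrite addrA -splitr in e1.
  have th : 0 < t - h by rewrite subr_gt0 (lt_trans ht)// ltr_pdivrMr// ltr_pMr// ltr1n.
  apply: norm2_ae_eq.
  - exact: (L2B (semigroup_L2 kappaS t2h (lf t20)) (semigroup_L2 kappaS (ltW t20) (lf t20))).1.
  - exact: (L2B (lf th) (lf t0)).1.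
  - by apply: filterS2 e1 e2 => y -> ->.
have nlt : \forall h \near (0 : R)^'+, h < t by exact: nbhs_right_lt.
have c1 : \int[mu]_y (f (t - h) y * diff_quotient kappa h g y) @[h --> 0^'+] -->
    \int[mu]_y (f t y * Lgen g y).
  apply: L2_cvg_inner.
  - by apply: filterS nlt => h ht; apply: lf; rewrite subr_gt0.
  - exact: lf.
  - by near=> h; exact: (diff_quotient_L2 kappaS).
  - exact: generator_L2 (dg t0).
  - exact: cu.
  - exact: generator_cvg (dg t0).
have hr0 : \forall h \near (0 : R)^'+, 0 < h by exact: nbhs_right_gt.
apply: filterS3 nlt hr0 (cvg_near_leD c1 e0) => h ht h0 H.
have th : 0 < t - h by rewrite subr_gt0.
have lPg := semigroup_L2 kappaS (ltW h0) lgt.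
have i1 := L2_mul (lf th) lgt; have i2 := L2_mul (lf t0) lgt.
have i3 := L2_mul (lf th) lPg.
have ei := smooth_density_L1 (fP th).
have H1 : \int[mu]_y (f (t - h) y * g y + f (t - h) y - f t y) <= entropy mu (f (t - h)).
  apply: ae_le_Rintegral => //.
    by apply: L1B; [apply: L1D => //; exact: L2_L1 (lf th)|exact: L2_L1 (lf t0)].
  by apply: filterS2 (f0 th) (f0 t0) => y; exact: ln_tangent.
have i4 := L2_L1 (lf th); have i5 := L2_L1 (lf t0).
rewrite (RintegralB measurableT (L1D i1 i4) i5) (RintegralD measurableT i1 i4) in H1.
rewrite !Rintegral_density// addrK in H1.
have E2 : entropy mu (f t) = \int[mu]_y (f (t - h) y * P h g y).
  rewrite -(semigroup_symmetric kappaS (ltW h0) (lf th) lgt) /entropy.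
  apply: ae_eq_Rintegral.
  - exact: L1_measurable i2.
  - by apply: measurable_funM; [exact: (semigroup_L2 kappaS (ltW h0) (lf th)).1|exact: lgt.1].
  - by have := density_semigroup th (ltW h0); rewrite subrK; apply: filterS => y <-.
have E3 : h * \int[mu]_y (f (t - h) y * diff_quotient kappa h g y) =
    \int[mu]_y (f (t - h) y * P h g y) - \int[mu]_y (f (t - h) y * g y).
  rewrite -(RintegralB measurableT i3 i1) -RintegralZl//; last first.
    by apply: L2_mul; [exact: lf|exact: (diff_quotient_L2 kappaS (ltW h0) lgt)].
  apply: eq_Rintegral => y _; rewrite /diff_quotient.
  by rewrite mulrCA mulVKf ?gt_eqF// mulrBr.
have H5 : h * \int[mu]_y (f (t - h) y * diff_quotient kappa h g y) <=
   h * (\int[mu]_y (f t y * Lgen g y) + e) by rewrite ler_pM2l.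
apply: le_trans H1; rewrite -lerBrDl.
rewrite E3 -E2 in H5.
by rewrite /entropy_flux -/g -opprD mulrN lerNl opprB.
Unshelve. all: by end_near. Qed.

End diffusion.

(** From e >= 2 and e^(y-1) >= y. This factor 2 is the source of the halves below: the measure
    eps/2, the bound -1/2 for a ln a, and the term 1/(2 z). *)
Lemma expR_ge_double (R : realType) (y : R) : 2 * y <= expR y.
Proof.
have [y0|/ltW y0] := leP y 0.
  by apply: le_trans (expR_ge0 y); rewrite pmulr_rle0.
rewrite -(subrK 1 y) expRD mulrC ler_pM//; first by rewrite subrK.
  by have := expR_ge1Dx (y - 1); rewrite addrC.
by have := expR_ge1Dx (1 : R); rewrite -natr1.
Qed.

Lemma mul_ln_ge (R : realType) (a : R) : 0 < a -> - 2^-1 <= a * ln a.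
Proof.
move=> a0; have := expR_ge_double (- ln a); rewrite expRN lnK//.
rewrite -(ler_pM2l a0) mulfV ?gt_eqF//.
by rewrite mulrN mulrN mulrCA; lra.
Qed.

(** * Total variation distance, entropy and observables *)

Section total_variation.
Context d (R : realType) (E : measurableType d) (mu nu : probability E R) (f : E -> R).
Hypothesis lf : L2 mu f.
Hypothesis f0 : \forall y \ae mu, 0 < f y.
Hypothesis fnu : is_density mu nu f.

Let fi : mu.-L1 f := L2_L1 lf.
Let f1i : mu.-L1 (fun y => f y - 1). Proof. by apply: L1B => //; exact: L1_cst. Qed.

Lemma indic_le1 (T : Type) (A : set T) y : `|\1_A y : R| <= 1.
Proof. by rewrite indicE; case: (y \in A); rewrite ?normr0 ?normr1. Qed.

Lemma prob_indic (m : probability E R) A : measurable A -> m A = (\int[m]_y (\1_A y : R))%:E.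
Proof.
move=> mA; rewrite EFin_Rintegral; last exact: L1_indic.
by rewrite integral_indic// setIT.
Qed.

Lemma tvP c : (tv_to_equilibrium mu nu <= c%:E)%E <->
  forall A, measurable A -> `|\int[mu]_y (\1_A y * (f y - 1))| <= c.
Proof.
have H A : measurable A -> `|nu A - mu A|%E = `|\int[mu]_y (\1_A y * (f y - 1))|%:E.
  move=> mA; rewrite !prob_indic// -EFinB abse_EFin; congr (`|_|%:E).
  have i1 : nu.-L1 (\1_A : E -> R) by exact: L1_indic.
  have i2 := L1_mul_bounded (measurable_indic mA) (@indic_le1 _ A) fi.
  rewrite (density_Rintegral fi f0 fnu i1) -(RintegralB measurableT i2 (L1_indic mu mA)).
  by apply: eq_Rintegral => y _; rewrite mulrBr mulr1.
split.
  move=> tvc A mA; rewrite -lee_fin -H//; apply: le_trans tvc.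
  by apply: ereal_sup_ubound; exists A.
by move=> tvc; apply: ge_ereal_sup => _ [A mA <-]; rewrite H// lee_fin tvc.
Qed.

Lemma Rintegral_density1 : \int[mu]_y f y = 1.
Proof.
have := density_Rintegral fi f0 fnu (L1_cst nu 1).
rewrite prob_Rintegral_cst; last exact: probability_setT.
by move=> ->; apply: eq_Rintegral => y _; rewrite mul1r.
Qed.

(* If the entropy exceeds 1/eps, the event [log f > 1/eps] has mu-measure at most
   eps/2, whereas its complement has nu-measure at most eps/2 by Chebyshev's
   inequality unless the varentropy is large. *)
Lemma reverse_pinsker eps : 0 < eps < 2^-1 ->
  (tv_to_equilibrium mu nu <= (1 - eps)%:E)%E ->
  L2 nu (fun y => ln (f y)) ->
  0 < eps * \int[nu]_y ln (f y) - 1 ->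
  (eps * \int[nu]_y ln (f y) - 1) ^+ 2 <=
    \int[nu]_y (ln (f y) ^+ 2) - (\int[nu]_y ln (f y)) ^+ 2.
Proof.
move=> /andP[eps0 eps2] /tvP tvc lg.
set m := \int[nu]_y ln (f y); set V := _ - m ^+ 2 => m0.
rewrite leNgt; apply/negP => Vlt.
(* The gap between the mean of log f and the threshold 1/eps; the assumption to refute reads V <
   (eps c)^2. *)
pose c := m - eps^-1.
have epsV : eps * eps^-1 = 1 by rewrite mulfV ?gt_eqF.
have cE : eps * m - 1 = eps * c by rewrite /c mulrBr epsV.
have c0 : 0 < c by rewrite -(pmulr_rgt0 _ eps0) -cE.
pose A := [set y | eps^-1 < ln (f y)].
have mA : measurable A.
  have -> : A = ~` (setT `&` [set y | ln (f y) <= eps^-1]).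
    by rewrite setTI; apply/seteqP; split => y; rewrite /A/= ltNge => /negP.
  by apply: measurableC; apply: measurable_fun_le => //; exact: lg.1.
have mAc := measurableC mA.
have i1A (p : probability E R) : p.-L1 (\1_A : E -> R) by exact: L1_indic.
have iAc (p : probability E R) : p.-L1 (\1_(~` A) : E -> R) by exact: L1_indic.
(* Markov's inequality: f has integral 1 and exceeds e^(1/eps) >= 2/eps on A. *)
have muA : \int[mu]_y (\1_A y : R) <= eps / 2.
  have H : expR eps^-1 * \int[mu]_y (\1_A y : R) <= 1.
    rewrite -Rintegral_density1 -(RintegralZl _ measurableT (i1A mu)).
    apply: (ae_le_Rintegral (L1Z _ (i1A mu)) fi).
    apply: filterS f0 => y fy0; rewrite indicE.
    have [/set_mem Ay|_] := boolP (y \in A); last by rewrite mulr0 ltW.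
    by rewrite mulr1 -[leRHS]lnK// ler_expR ltW.
  have e2 := expR_ge_double eps^-1.
  have a0 : 0 <= \int[mu]_y (\1_A y : R) by apply: Rintegral_ge0.
  have : 2 * eps^-1 * \int[mu]_y (\1_A y : R) <= 1.
    by apply: le_trans H; rewrite ler_wpM2r.
  rewrite -(ler_pM2l eps0) mulr1 -mulrA mulrCA (mulrA eps) epsV mul1r => H'.
  by rewrite ler_pdivlMr// mulrC.
have nuAc : c ^+ 2 * \int[nu]_y (\1_(~` A) y : R) <= V.
  have nu1 : nu setT = 1%E by exact: probability_setT.
  have vi := variance_identity nu1 m (L2_L1 lg) lg.2.
  have -> : V = \int[nu]_y ((ln (f y) - m) ^+ 2) by rewrite vi -/m /V; ring.
  rewrite -(RintegralZl _ measurableT (iAc nu)).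
  apply: (ae_le_Rintegral (L1Z _ (iAc nu)) (L2B lg (L2_cst nu m)).2).
  apply: aeW => y; rewrite indicE.
  have [/set_mem Ay|_] := boolP (y \in ~` A); last by rewrite mulr0 sqr_ge0.
  have {}Ay : ln (f y) <= eps^-1 by rewrite leNgt; apply/negP.
  have cm : c <= m - ln (f y) by rewrite /c lerB.
  rewrite mulr1 -[leRHS]sqrrN opprB ler_pXn2r ?nnegrE ?(ltW c0)//.
  exact: le_trans (ltW c0) cm.
(* Chebyshev gives a value below eps^2, and eps^2 <= eps/2 because eps < 1/2. *)
have nuAc2 : \int[nu]_y (\1_(~` A) y : R) < eps / 2.
  have : c ^+ 2 * \int[nu]_y (\1_(~` A) y : R) < c ^+ 2 * eps ^+ 2.
    by apply: le_lt_trans nuAc _; apply: lt_le_trans Vlt _; rewrite cE exprMn mulrC.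
  rewrite ltr_pM2l ?exprn_gt0// => H; apply: lt_le_trans H _.
  by rewrite expr2 ler_pM2l// ltW.
have nuA : \int[nu]_y (\1_A y : R) = 1 - \int[nu]_y (\1_(~` A) y : R).
  have nu1 : nu setT = 1%E by exact: probability_setT.
  rewrite -[X in X - _](prob_Rintegral_cst nu1 1) -(RintegralB measurableT (L1_cst nu 1) (iAc nu)).
  apply: eq_Rintegral => y _; rewrite !indicE in_setC.
  by case: (y \in A); rewrite ?subr0 ?subrr.
have := tvc A mA.
have i2 := L1_mul_bounded (measurable_indic mA) (@indic_le1 _ A) fi.
have -> : \int[mu]_y (\1_A y * (f y - 1)) = \int[nu]_y (\1_A y : R) - \int[mu]_y (\1_A y : R).
  rewrite (density_Rintegral fi f0 fnu (i1A nu)) -(RintegralB measurableT i2 (i1A mu)).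
  by apply: eq_Rintegral => y _; rewrite mulrBr mulr1.
move=> /(le_trans (ler_norm _)).
rewrite nuA; move: nuAc2 muA.
move: (\int[nu]_y _) (\int[mu]_y _) => a b; lra.
Qed.

(* An observable with values in [0, 1] distinguishes nu from mu no better than the
   event f > 1 does. *)
Lemma tv_observable c (psi : E -> R) : (tv_to_equilibrium mu nu <= c%:E)%E ->
  measurable_fun setT psi -> (forall y, 0 <= psi y <= 1) ->
  `|\int[mu]_y (psi y * (f y - 1))| <= c.
Proof.
move=> /tvP tvc mpsi psi01.
pose B := [set y | 1 < f y].
have mB : measurable B.
  have -> : B = ~` (setT `&` [set y | f y <= 1]).
    by rewrite setTI; apply/seteqP; split => y; rewrite /B/= ltNge => /negP.
  by apply: measurableC; apply: measurable_fun_le => //; exact: lf.1.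
have iB := L1_mul_bounded (measurable_indic mB) (@indic_le1 _ B) f1i.
have up (p : E -> R) : measurable_fun setT p -> (forall y, 0 <= p y <= 1) ->
    \int[mu]_y (p y * (f y - 1)) <= c.
  move=> mp p01; apply: le_trans (le_trans (ler_norm _) (tvc B mB)).
  have p1 y : `|p y| <= 1 by have /andP[p0 pl1] := p01 y; rewrite ger0_norm.
  apply: (le_Rintegral measurableT (L1_mul_bounded mp p1 f1i) iB) => y _.
  have /andP[p0 pl1] := p01 y; rewrite indicE.
  have [/set_mem By|By] := boolP (y \in B).
    by rewrite ler_wpM2r// subr_ge0 ltW.
  rewrite mul0r mulr_ge0_le0// subr_le0 leNgt; apply/negP => fy.
  by move: By; rewrite notin_setE; apply.
have psi1 y : `|psi y| <= 1 by have /andP[p0 pl1] := psi01 y; rewrite ger0_norm.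
rewrite ler_norml up// andbT.
(* As f - 1 has mean 0, the lower bound for psi is the upper bound for 1 - psi. *)
have mpsi' : measurable_fun setT (fun y => 1 - psi y) by exact: measurable_funB.
have psi01' y : 0 <= 1 - psi y <= 1.
  by have /andP[p0 pl1] := psi01 y; apply/andP; split; lra.
have := up _ mpsi' psi01'.
have -> : \int[mu]_y ((1 - psi y) * (f y - 1)) = \int[mu]_y ((f y - 1) - psi y * (f y - 1)).
  by apply: eq_Rintegral => y _; ring.
rewrite (RintegralB measurableT f1i (L1_mul_bounded mpsi psi1 f1i)).
rewrite (RintegralB measurableT fi (L1_cst mu 1)) Rintegral_density1.
rewrite prob_Rintegral_cst; last exact: probability_setT.
by rewrite subrr sub0r lerNl.
Qed.

End total_variation.

(** * Total variation along the semigroup and the spectral gap *)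

Section total_variation_semigroup.
Context d (R : realType) (E : measurableType d) (mu nu nu' : probability E R).
Variable kappa : R -> R.-pker E ~> E.
Hypothesis kappaS : symmetric_markov_semigroup mu kappa.
Variables (f f' : E -> R) (h : R).
Hypotheses (lf : L2 mu f) (lf' : L2 mu f').
Hypotheses (f0 : \forall y \ae mu, 0 < f y) (f'0 : \forall y \ae mu, 0 < f' y).
Hypotheses (fnu : is_density mu nu f) (f'nu : is_density mu nu' f').
Hypothesis h0 : 0 <= h.
Hypothesis f'E : \forall y \ae mu, f' y = semigroup kappa h f y.

Local Notation P := (semigroup kappa).

(** Testing the later density on A amounts to testing the earlier one on P_h 1_A, an observable with
    values in [0, 1]. *)
Let duality A : measurable A ->
  \int[mu]_y (\1_A y * (f' y - 1)) = \int[mu]_y (P h \1_A y * (f y - 1)).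
Proof.
move=> mA; have lA := L2_indic mu mA; have lPA := semigroup_L2 kappaS h0 lA.
have E1 : \int[mu]_y (\1_A y * (f' y - 1)) =
    \int[mu]_y (\1_A y * f' y) - \int[mu]_y (\1_A y : R).
  rewrite -(RintegralB measurableT (L2_mul lA lf') (L2_L1 lA)).
  by apply: eq_Rintegral => y _; rewrite mulrBr mulr1.
have E2 : \int[mu]_y (P h \1_A y * (f y - 1)) =
    \int[mu]_y (P h \1_A y * f y) - \int[mu]_y P h \1_A y.
  rewrite -(RintegralB measurableT (L2_mul lPA lf) (L2_L1 lPA)).
  by apply: eq_Rintegral => y _; rewrite mulrBr mulr1.
rewrite E1 E2 (Rintegral_semigroup kappaS h0 (L2_L1 lA)); congr (_ - _).
rewrite (semigroup_symmetric kappaS h0 lA lf); apply: ae_eq_Rintegral.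
- exact: L1_measurable (L2_mul lA lf').
- exact: L1_measurable (L2_mul lA (semigroup_L2 kappaS h0 lf)).
- by apply: filterS f'E => y ->.
Qed.

Lemma tv_nonincreasing c : (tv_to_equilibrium mu nu <= c%:E)%E ->
  (tv_to_equilibrium mu nu' <= c%:E)%E.
Proof.
move=> tvc; apply/(tvP lf' f'0 f'nu) => A mA; rewrite duality//.
have m1 : measurable_fun setT (\1_A : E -> R) by exact: measurable_indic.
apply: (tv_observable lf f0 fnu tvc).
  exact: measurable_semigroup.
move=> y; apply: semigroup_bounds => // z.
by rewrite indicE; case: (z \in A); rewrite ?lexx ?ler01.
Qed.

(* Where log f <= z = lam * h, the density has L2 norm at most e^(z/2), and the spectral
   gap applies; elsewhere f is controlled by the entropy. *)
Lemma tv_spectral_gap lam eps D : 0 < eps -> 0 < lam -> l2_decay mu kappa lam ->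
  mu.-L1 (fun y => f y * ln (f y)) -> entropy mu f <= D -> 0 <= D ->
  h = (1 + D) / eps / lam -> (tv_to_equilibrium mu nu' <= eps%:E)%E.
Proof.
move=> eps0 lam0 [_ decay] ei eD D0 hE.
(* The part where log f <= z will contribute 1/(2 z) and the rest (D + 1/2)/z; z is chosen so that
   the sum (1 + D)/z equals eps. *)
pose z := (1 + D) / eps.
have z0 : 0 < z by rewrite divr_gt0// ltr_wpDr.
have lamh : lam * h = z by rewrite hE -/z mulrC mulfVK ?gt_eqF.
apply/(tvP lf' f'0 f'nu) => A mA; rewrite duality//.
have m1 : measurable_fun setT (\1_A : E -> R) by exact: measurable_indic.
have lA := L2_indic mu mA.
have mu1 : mu setT = 1%E by exact: probability_setT.
pose a := \int[mu]_y (\1_A y : R).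
have /andP[a0 a1] : 0 <= a <= 1.
  apply: (prob_Rintegral_bounds mu1 m1) => y.
  by rewrite indicE; case: (y \in A); rewrite ?lexx ?ler01.
pose q y : R := \1_A y - a.
have lq : L2 mu q by exact: L2B lA (L2_cst mu a).
have q1 y : `|q y| <= 1.
  by rewrite /q indicE ler_norml; case: (y \in A) => /=; apply/andP; split; lra.
have q0 : \int[mu]_y q y = 0.
  by rewrite (RintegralB measurableT (L2_L1 lA) (L1_cst mu a)) (prob_Rintegral_cst mu1) subrr.
(* The variance of an indicator, a (1 - a), is at most 1/4. *)
have qn : norm2 mu q <= 2^-1.
  rewrite -(ler_pXn2r (ltn0Sn 1)) ?nnegrE ?norm2_ge0// sqr_norm2.
  rewrite (variance_identity mu1 a (L2_L1 lA) lA.2).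
  have -> : \int[mu]_y ((\1_A y : R) ^+ 2) = a.
    by apply: eq_Rintegral => y _; rewrite indicE; case: (y \in A); rewrite ?expr1n ?expr0n.
  rewrite -/a; have : 0 <= (a - 2^-1) ^+ 2 by exact: sqr_ge0.
  rewrite sqrrB; nra.
have lPq := semigroup_L2 kappaS h0 lq.
have Pqn : norm2 mu (P h q) <= expR (- z) * 2^-1.
  have := decay h q h0 ((L2P mu q).2 lq) q0.
  rewrite /L2norm !L2normE// lamh -EFinM lee_fin => H; apply: le_trans H _.
  by rewrite ler_wpM2l// expR_ge0.
have Pq1 y : `|P h q y| <= 1 by apply: semigroup_bounded => //; exact: lq.1.
have E1 : \int[mu]_y (P h \1_A y * (f y - 1)) = \int[mu]_y (f y * P h q y).
  have lPA := semigroup_L2 kappaS h0 lA.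
  have E2 : \forall y \ae mu, P h q y = P h \1_A y - a.
    apply: filterS (semigroupB kappaS h0 (L2_L1 lA) (L1_cst mu a)) => y.
    by rewrite semigroup_cst.
  have -> : \int[mu]_y (f y * P h q y) = \int[mu]_y (f y * (P h \1_A y - a)).
    apply: ae_eq_Rintegral.
    - exact: L1_measurable (L2_mul lf lPq).
    - exact: L1_measurable (L2_mul lf (L2B lPA (L2_cst mu a))).
    - by apply: filterS E2 => y ->.
  have -> : \int[mu]_y (f y * (P h \1_A y - a)) = \int[mu]_y (P h \1_A y * f y - a * f y).
    by apply: eq_Rintegral => y _; ring.
  rewrite (RintegralB measurableT (L2_mul lPA lf) (L1Z a (L2_L1 lf))).
  rewrite (RintegralZl _ measurableT (L2_L1 lf)) (Rintegral_density1 lf f0 fnu) mulr1.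
  rewrite -[a in RHS](Rintegral_semigroup kappaS h0 (L2_L1 lA)).
  rewrite -(RintegralB measurableT (L2_mul lPA lf) (L2_L1 lPA)).
  by apply: eq_Rintegral => y _; rewrite mulrBr mulr1.
rewrite E1.
have lnm := measurable_ln_comp lf.1.
pose C := [set y | ln (f y) <= z].
have mC : measurable C by rewrite -[C]setTI; exact: measurable_fun_le.
have mCc := measurableC mC.
have mi B : measurable B -> measurable_fun setT (\1_B : E -> R) by exact: measurable_indic.
have lk : L2 mu (fun y => \1_C y * f y).
  exact: L2_mul_bounded (mi _ mC) (@indic_le1 _ _ C) lf.
have ll : mu.-L1 (fun y => \1_(~` C) y * f y).
  exact: L1_mul_bounded (mi _ mCc) (@indic_le1 _ _ (~` C)) (L2_L1 lf).
have lla : mu.-L1 (fun y => P h q y * (\1_(~` C) y * f y)).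
  exact: L1_mul_bounded lPq.1 Pq1 ll.
have lka := L2_mul lk lPq.
have -> : \int[mu]_y (f y * P h q y) = \int[mu]_y (\1_C y * f y * P h q y)
    + \int[mu]_y (P h q y * (\1_(~` C) y * f y)).
  rewrite -(RintegralD measurableT lka lla); apply: eq_Rintegral => y _.
  by rewrite !indicE in_setC; case: (y \in C) => /=; ring.
(* Cauchy-Schwarz bounds this by e^(z/2) e^(-z) / 2, and e^(z/2) >= z. *)
have b1 : `|\int[mu]_y (\1_C y * f y * P h q y)| <= (2 * z)^-1.
  apply: le_trans (Cauchy_Schwarz lk lPq) _.
  have kn : norm2 mu (fun y => \1_C y * f y) <= expR (z / 2).
    rewrite -(ler_pXn2r (ltn0Sn 1)) ?nnegrE ?norm2_ge0 ?expR_ge0// sqr_norm2.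
    rewrite -expRM_natl mulrC divfK ?pnatr_eq0//.
    rewrite -[leRHS]mulr1 -(Rintegral_density1 lf f0 fnu) -(RintegralZl _ measurableT (L2_L1 lf)).
    apply: ae_le_Rintegral; [exact: lk.2|exact: L1Z (L2_L1 lf)|].
    apply: filterS f0 => y fy0; rewrite indicE.
    have [/set_mem Cy|_] := boolP (y \in C); last first.
      by rewrite mul0r expr0n mulr_ge0 ?expR_ge0// ltW.
    by rewrite mul1r expr2 ler_pM2r// -[leLHS]lnK// ler_expR.
  apply: (@le_trans _ _ (expR (z / 2) * (expR (- z) * 2^-1))).
    by apply: ler_pM => //; exact: norm2_ge0.
  rewrite mulrA -expRD (_ : z / 2 + - z = - (z / 2)); last by field.
  have zz : 0 < 2 * z by rewrite pmulr_rgt0.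
  have ez : 0 < expR (z / 2) * 2 by rewrite pmulr_lgt0 ?expR_gt0.
  rewrite expRN -invfM lef_pV2 ?posrE// mulrC ler_pM2r//.
  by have := expR_ge_double (z / 2); rewrite mulrC divfK.
(* Off C one has z f <= f ln f, and on C the negative values of f ln f are at least -1/2: z times
   the mass off C is at most D + 1/2. *)
have b2 : `|\int[mu]_y (P h q y * (\1_(~` C) y * f y))| <= (D + 2^-1) / z.
  apply: (@le_trans _ _ (\int[mu]_y (\1_(~` C) y * f y))).
    apply: le_trans (le_normr_Rintegral measurableT lla) _.
    apply: ae_le_Rintegral => //; first exact: L1_norm.
    apply: filterS f0 => y fy0; rewrite normrM.
    have g0 : 0 <= (\1_(~` C) y : R) * f y by rewrite mulr_ge0// ltW.
    by rewrite [X in _ * X]ger0_norm// ler_piMl.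
  rewrite ler_pdivlMr// mulrC -(RintegralZl _ measurableT ll).
  apply: (@le_trans _ _ (entropy mu f + 2^-1)); last by rewrite lerD2r.
  rewrite /entropy -[X in _ + X](prob_Rintegral_cst mu1) -(RintegralD measurableT ei (L1_cst mu _)).
  apply: ae_le_Rintegral; [exact: L1Z|by apply: L1D => //; exact: L1_cst|].
  apply: filterS f0 => y fy0; rewrite indicE in_setC.
  have ml := mul_ln_ge fy0.
  have [/set_mem Cy|Cy] := boolP (y \in C); first by rewrite /= mul0r mulr0; lra.
  rewrite /= mul1r mulrC.
  have zl : z <= ln (f y).
    by rewrite leNgt; apply/negP => lz; move: Cy; rewrite notin_setE; apply; exact: ltW.
  have : f y * z <= f y * ln (f y) by rewrite ler_pM2l.
  lra.
apply: le_trans (ler_normD _ _) _; apply: le_trans (lerD b1 b2) _.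
have -> : (2 * z)^-1 + (D + 2^-1) / z = (1 + D) / z by field; rewrite gt_eqF.
by rewrite ler_pdivrMr// mulrC /z divfK// gt_eqF.
Qed.

End total_variation_semigroup.

(** * The differential inequality and the optimization *)

Section differential_inequality.
Variable R : realType.

(** A backward step for y' <= - k y^2. The inverse drops by h r / (y (y + h r)); of the slack e y^2,
    half is given up in r and half pays for the second-order term, which the bound on h controls. *)
Let inv_increment (y r k e h : R) : 0 < y -> 0 < k -> 0 < e -> e < k -> 0 < h ->
  h <= e / (2 * k ^+ 2 * y) -> r = k * y ^+ 2 - e * y ^+ 2 / 2 ->
  (y + h * r)^-1 <= y^-1 - k * h + e * h.
Proof.
move=> y0 k0 e0 ek h0 hle rE.
have y20 : 0 < y ^+ 2 by rewrite exprn_gt0.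
have ey : e * y ^+ 2 < k * y ^+ 2 by rewrite ltr_pM2r.
have ey0 : 0 < e * y ^+ 2 by rewrite mulr_gt0.
have r0 : 0 < r by rewrite rE; lra.
have rk : r <= k * y ^+ 2 by rewrite rE; lra.
have yr : 0 < y + h * r by rewrite ltr_wpDr// mulr_ge0// ltW.
have hle' : h * (2 * k ^+ 2 * y) <= e.
  by rewrite -ler_pdivlMr// !mulr_gt0// exprn_gt0.
have H : (k - e) * (y * (y + h * r)) <= r.
  have h1 : (k - e) * (y * (h * r)) <= k * (y * (h * (k * y ^+ 2))).
    apply: ler_pM; [lra| |lra|].
      by rewrite !mulr_ge0// ltW.
    by rewrite ler_pM2l// ler_pM2l.
  have h2 : k * (y * (h * (k * y ^+ 2))) = h * (2 * k ^+ 2 * y) * (y ^+ 2 / 2) by field.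
  have h3 : h * (2 * k ^+ 2 * y) * (y ^+ 2 / 2) <= e * (y ^+ 2 / 2).
    by rewrite ler_wpM2r// divr_ge0// ltW.
  rewrite mulrDr mulrDr; rewrite h2 in h1.
  have h4 := le_trans h1 h3; rewrite [leRHS]rE.
  have -> : (k - e) * (y * y) = k * y ^+ 2 - e * y ^+ 2 by ring.
  move: h4; rewrite [e * (_ / 2)]mulrA.
  move: ((k - e) * (y * (h * r))) (k * y ^+ 2) (e * y ^+ 2) => u v w; lra.
have E1 : (y + h * r)^-1 = y^-1 - h * (r / (y * (y + h * r))).
  by field; rewrite !gt_eqF.
rewrite E1 -addrA lerD2l.
have -> : - (k * h) + e * h = - (h * (k - e)) by ring.
by rewrite lerN2 ler_pM2l// ler_pdivlMr// mulr_gt0.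
Qed.

(* 1 / (eps D - 1) grows at rate at least eps / (2 t1) on [t0, t1]. *)
Lemma differential_inequality (D F : R -> R) (eps t0 s : R) :
  0 < eps -> 0 < t0 -> 0 < s ->
  (forall t h, 0 < t -> 0 <= h -> D (t + h) <= D t) ->
  (forall t e, 0 < t -> 0 < e ->
    \forall h \near 0^'+, D t + h * (F t - e) <= D (t - h)) ->
  (forall t, t0 <= t -> 0 < eps * D t - 1 -> (eps * D t - 1) ^+ 2 <= 2 * t * F t) ->
  D (t0 + s) <= eps^-1 + 2 * (t0 + s) / (eps ^+ 2 * s).
Proof.
move=> eps0 t00 s0 mono dini FD.
set t1 := t0 + s; have t10 : 0 < t1 by rewrite addr_gt0.
pose y t := eps * D t - 1.
have yE t : D t = eps^-1 + y t / eps by rewrite /y; field; rewrite gt_eqF.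
(* If y is nonpositive at the final time, then D is already at most 1/eps there. Otherwise y is
   positive at all earlier times, by monotonicity, and can be inverted. *)
have [y1|y1] := leP (y t1) 0.
  rewrite yE lerD2l; apply: (@le_trans _ _ 0).
    by rewrite pmulr_lle0 ?invr_gt0.
  by rewrite divr_ge0 ?mulr_ge0 ?exprn_ge0// ltW.
pose k := eps / (2 * t1).
have k0 : 0 < k by rewrite divr_gt0// mulr_gt0.
have y_anti t t' : 0 < t -> t <= t' -> y t' <= y t.
  move=> t'0 tt'; rewrite lerD2r ler_pM2l// -(subrKC t t').
  by apply: mono => //; rewrite subr_ge0.
have y_gt0 t : 0 < t -> t <= t1 -> 0 < y t.
  by move=> t'0 tt1; apply: lt_le_trans y1 _; exact: y_anti.
(* The left estimate comes from dissipation; on the right it is enough that 1/y is nondecreasing. *)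
have key : k * t1 - (y t1)^-1 <= k * t0 - (y t0)^-1.
  apply: (@dini_le _ t0 t1 (fun t => k * t - (y t)^-1)).
  - by rewrite lerDl ltW.
  - move=> t /andP[t0t tt1] e e0.
    have t'0 : 0 < t := lt_trans t00 t0t.
    have yt := y_gt0 t t'0 tt1.
    (* Capped at k / 2 so that the increment [r] is positive. *)
    pose e1 := Num.min e (k / 2).
    have e10 : 0 < e1 by rewrite lt_min e0 divr_gt0.
    have e1k : e1 < k.
      by rewrite /e1 gt_min; apply/orP; right; rewrite ltr_pdivrMr// ltr_pMr// ltr1n.
    have e1e : e1 <= e by rewrite ge_min lexx.
    have y20 : 0 < y t ^+ 2 by rewrite exprn_gt0.
    (* The tolerance on D that becomes e1 y^2 / 2 after multiplication by eps. *)
    pose dlt := e1 * y t ^+ 2 / 2 / eps.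
    have dlt0 : 0 < dlt by rewrite !divr_gt0// mulr_gt0.
    have b0 : 0 < e1 / (2 * k ^+ 2 * y t).
      by apply: divr_gt0 => //; apply: mulr_gt0 => //; apply: mulr_gt0 => //; exact: exprn_gt0.
    have n1 : \forall h \near (0 : R)^'+, 0 < h by exact: nbhs_right_gt.
    have n2 := nbhs_right_lt b0; have n3 := nbhs_right_lt t0t.
    have n4 : \forall h \near (0 : R)^'+, h < t - t0 by apply: nbhs_right_lt; rewrite subr_gt0.
    have n12 : \forall h \near (0 : R)^'+, 0 < h /\ h < t - t0.
      by apply: filterS2 n1 n4 => h.
    apply: filterS3 n12 n2 (dini t dlt t'0 dlt0) => h [h0 ht] hb H.
    set r := k * y t ^+ 2 - e1 * y t ^+ 2 / 2.
    have Fk : k * y t ^+ 2 <= eps * F t.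
      have FDt := FD t (ltW t0t) yt.
      have F0 : 0 <= F t.
        rewrite -(@pmulr_rge0 _ (2 * t)) ?mulr_gt0//.
        exact: le_trans (ltW y20) FDt.
      have : y t ^+ 2 <= 2 * t1 * F t.
        by apply: le_trans FDt _; rewrite ler_wpM2r// ler_pM2l.
      rewrite -(@ler_pM2l _ k)// => /le_trans; apply.
      rewrite le_eqVlt; apply/orP; left; apply/eqP; rewrite /k; field.
      by rewrite gt_eqF.
    have yh : y t + h * r <= y (t - h).
      have : eps * (D t + h * (F t - dlt)) <= eps * D (t - h) by rewrite ler_pM2l.
      rewrite mulrDr mulrCA mulrBr => H1.
      have -> : y (t - h) = eps * D (t - h) - 1 by [].
      rewrite lerBrDr; apply: le_trans H1.
      have -> : y t + h * r + 1 = eps * D t + h * r by rewrite /y; ring.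
      rewrite lerD2l ler_pM2l// /r lerB//.
      by rewrite /dlt mulrCA divff ?gt_eqF// mulr1.
    have r0 : 0 < r.
      rewrite /r subr_gt0 ltr_pdivrMr// mulrAC ltr_pM2r//.
      by apply: lt_trans e1k _; rewrite ltr_pMr// ltr1n.
    have yhr : 0 < y t + h * r by rewrite ltr_wpDr// mulr_ge0// ltW.
    have Z : (y (t - h))^-1 <= (y t + h * r)^-1.
      by rewrite lef_pV2 ?posrE//; exact: lt_le_trans yh.
    have Z2 := le_trans Z (inv_increment yt k0 e10 e1k h0 (ltW hb) erefl).
    have eh : e1 * h <= e * h by rewrite ler_pM2r.
    rewrite mulrBr; move: Z2 eh.
    move: (y (t - h))^-1 (y t)^-1 (k * h) (k * t) (e1 * h) (e * h) => a1 a2 a3 a4 a5 a6.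
    lra.
  - move=> t /andP[t0t tt1] e e0.
    have t'0 : 0 < t := lt_le_trans t00 t0t.
    have n1 : \forall h \near (0 : R)^'+, h < t1 - t by apply: nbhs_right_lt; rewrite subr_gt0.
    have n2 : \forall h \near (0 : R)^'+, h < e / k by apply: nbhs_right_lt; rewrite divr_gt0.
    have n3 : \forall h \near (0 : R)^'+, 0 < h by exact: nbhs_right_gt.
    apply: filterS3 n1 n2 n3 => h h1 h2 h3.
    have th : t + h <= t1 by rewrite -lerBrDl ltW.
    have th0 : 0 < t + h by rewrite addr_gt0.
    have Z : (y t)^-1 <= (y (t + h))^-1.
      rewrite lef_pV2 ?posrE; [|exact: (y_gt0 _ t'0 (ltW tt1))|exact: y_gt0].
      by apply: y_anti => //; rewrite lerDl ltW.
    have kh : k * h <= e by rewrite mulrC -ler_pdivlMr// ltW.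
    rewrite mulrDr; move: Z kh.
    move: (y (t + h))^-1 (y t)^-1 (k * h) (k * t) => a1 a2 a3 a4; lra.
have yt0 := y_gt0 t0 t00 (_ : t0 <= t1); rewrite lerDl (ltW s0) in yt0.
have {}yt0 := yt0 isT.
(* The positive term 1/y(t0) is dropped, so the bound does not depend on the entropy at the initial
   time. *)
have ks : k * s <= (y t1)^-1.
  have : 0 < (y t0)^-1 by rewrite invr_gt0.
  move: key; rewrite /t1 mulrDr; move: (y (t0 + s))^-1 (y t0)^-1 (k * t0) (k * s).
  by move=> a1 a2 a3 a4; lra.
have ks0 : 0 < k * s by rewrite mulr_gt0.
have : y t1 <= (k * s)^-1 by rewrite -(invrK (y t1)) lef_pV2 ?posrE ?invr_gt0.
rewrite yE lerD2l ler_pdivrMr// => /le_trans; apply.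
rewrite le_eqVlt; apply/orP; left; apply/eqP; rewrite /k; field.
by rewrite !gt_eqF.
Qed.

(* The two halves of the bound are balanced at s = sqrt(r K), where K is the
   inverse of lam * eps ^+ 3. *)
Lemma window_optimization (r K eps : R) : 0 <= r -> 0 < K -> 0 < eps < 2^-1 ->
  exists2 s, 0 < s & exists2 delta, 0 < delta &
    delta + s + K * (eps ^+ 2 + eps + 2) + 2 * (r + delta) * K / s
    <= 3 * K + 3 * Num.sqrt (r * K).
Proof.
move=> r0 K0 /andP[e0 e2].
have eE : K * (eps ^+ 2 + eps + 2) <= K * (11 / 4).
  rewrite ler_pM2l//; have : eps ^+ 2 <= 4^-1.
    have -> : 4^-1 = 2^-1 ^+ 2 :> R by rewrite exprVn; congr (_^-1); ring.
    by rewrite ler_pXn2r ?nnegrE// ltW.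
  lra.
have [rz|rn] := eqVneq r 0.
  (* With r = 0 the square root is lost and s must be of order K. Here delta and the last term add
     up to K/8, s is K/8, and 11/4 K completes 3 K exactly. *)
  exists (K / 8); first by rewrite divr_gt0.
  exists (K / 136); first by rewrite divr_gt0.
  rewrite rz add0r mul0r sqrtr0 mulr0 addr0.
  have -> : 2 * (K / 136) * K / (K / 8) = 16 / 136 * K.
    by field; rewrite gt_eqF.
  move: eE; move: (K * (eps ^+ 2 + _ + _)) => u; lra.
have rK : 0 < r * K by rewrite mulr_gt0// lt_neqAle eq_sym rn.
set s := Num.sqrt (r * K).
have s0 : 0 < s by rewrite sqrtr_gt0.
have sE : s * s = r * K by rewrite -expr2 sqr_sqrtr// ltW.
exists s => //.
(* The total coefficient of delta; the choice below makes its contribution K/4, which completes 11/4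
   K to 3 K. *)
pose B := 1 + 2 * K / s.
have B0 : 0 < B by rewrite /B ltr_wpDr// divr_ge0 ?mulr_ge0 ?ltW.
exists (K / 4 / B); first by rewrite !divr_gt0.
have -> : K / 4 / B + s + K * (eps ^+ 2 + eps + 2) + 2 * (r + K / 4 / B) * K / s =
    K / 4 / B * B + s + K * (eps ^+ 2 + eps + 2) + 2 * (r * K / s).
  by rewrite /B; field; rewrite gt_eqF//=; rewrite gt_eqF// addr_gt0// mulr_gt0.
rewrite mulfVK ?gt_eqF// -sE mulfK ?gt_eqF//.
move: eE; move: (K * (eps ^+ 2 + _ + _)) => u; lra.
Qed.

End differential_inequality.

(** * Mixing times and the width of the window *)

Section mixing.
Context d d' (R : realType) (E : measurableType d) (Omega : measurableType d').
Variables (mu : probability E R) (Pr : probability Omega R).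
Variables (kappa : R -> R.-pker E ~> E) (X : R -> {mfun Omega >-> E}) (x : E).
Hypothesis hX : nonneg_curved_diffusion mu Pr kappa X x.

Local Notation law t := (distribution Pr (X t)).

Lemma diffusion_densities : exists f : R -> E -> R,
  forall t, 0 < t -> smooth_density mu Pr kappa X t (f t).
Proof.
have [_ _ H] := hX.
have : forall t, exists f, 0 < t -> smooth_density mu Pr kappa X t f.
  move=> t; have [t0|t0] := ltP 0 t; last by exists (cst 0).
  by have [f ft] := H t t0; exists f => _.
by move=> /choice[f fP]; exists f.
Qed.

Variables (lam eps : R).
Hypothesis decay : l2_decay mu kappa lam.
Hypotheses (lam_gt0 : 0 < lam) (heps : 0 < eps < 2^-1).

Let eps0 : 0 < eps. Proof. by case/andP: heps. Qed.

Let mixing_time_spectral_gap (f : R -> E -> R) t D :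
  (forall t, 0 < t -> smooth_density mu Pr kappa X t (f t)) ->
  0 < t -> 0 <= D -> entropy mu (f t) <= D ->
  (mixing_time mu Pr X eps <= (t + (1 + D) / eps / lam)%:E)%E.
Proof.
move=> fP t0 D0 fD; have [kappaS XM _] := hX.
set h := (1 + D) / eps / lam.
have h0 : 0 <= h by rewrite !divr_ge0 ?addr_ge0// ltW.
have th0 : 0 < t + h by rewrite ltr_wpDr.
have L2f s : 0 < s -> L2 mu (f s) by case/fP => _ _ [/in_dom_L2].
apply: ereal_inf_lbound; exists (t + h) => //; split => //.
have [fd fp _ _ _] := fP t t0; have [fd' fp' _ _ _] := fP _ th0.
exact: (tv_spectral_gap kappaS (L2f t t0) (L2f _ th0) fp fp' fd fd' h0
  (density_semigroup kappaS XM fP t0 h0) eps0 lam_gt0 decay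
  (smooth_density_L1 (fP t t0)) fD D0).
Qed.

Let mixing_time_after (t s : R) : 0 < t -> 0 < s ->
  (tv_to_equilibrium mu (law t) <= (1 - eps)%:E)%E ->
  (mixing_time mu Pr X eps <=
   (t + s + (1 + (eps^-1 + 2 * (t + s) / (eps ^+ 2 * s))) / eps / lam)%:E)%E.
Proof.
move=> t0 s0 tvt; have [kappaS XM _] := hX.
have [f fP] := diffusion_densities.
have L2f r : 0 < r -> L2 mu (f r) by case/fP => _ _ [/in_dom_L2].
have ts0 : 0 < t + s by rewrite addr_gt0.
apply: (@mixing_time_spectral_gap f) => //.
  by rewrite addr_ge0 ?invr_ge0 ?divr_ge0 ?mulr_ge0 ?exprn_ge0 ?ltW.
apply: (@differential_inequality _ (fun r => entropy mu (f r))
  (fun r => entropy_flux mu kappa (f r))) => //.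
- by move=> r h; exact: (entropy_nonincreasing kappaS XM fP).
- by move=> r e; exact: (entropy_left_dini kappaS XM fP).
move=> r tr; have r0 : 0 < r := lt_le_trans t0 tr.
have lawd u : 0 < u -> exists fs, [/\ mu.-L1 fs, \forall y \ae mu, 0 < fs y
    & is_density mu (law u) fs].
  by move=> u0; have [fd fp _ _ _] := fP u u0; exists (f u); split => //; exact: L2_L1 (L2f u u0).
have rt0 : 0 <= r - t by rewrite subr_ge0.
have [fd fp _ _ _] := fP t t0; have [fd' fp' _ _ _] := fP _ r0.
have ev := density_semigroup kappaS XM fP t0 rt0; rewrite subrKC in ev.
(* The distance is bounded at time t alone; monotonicity keeps the bound, and hence the varentropy
   estimate, at every later time r. *)
have tvr := tv_nonincreasing kappaS (L2f t t0) (L2f r r0) fp fp' fd fd' rt0 ev tvt.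
rewrite (entropy_law (fP r r0)) => H.
apply: le_trans (varentropy_le kappaS XM lawd r0 (fP r r0)).
exact: (reverse_pinsker (L2f r r0) fp' fd' heps tvr (smooth_density_L2_law (fP r r0)) H).
Qed.

Lemma mixing_window_le : (mixing_window mu Pr X eps
   <= (3 / (lam * eps ^+ 3))%:E
      + 3%:E * sqrte (mixing_time mu Pr X (1 - eps)
                      * ((lam * eps ^+ 3)^-1)%:E))%E.
Proof.
have [f fP] := diffusion_densities.
have [e0 e2] := andP heps.
have mono a b : a <= b -> (mixing_time mu Pr X b <= mixing_time mu Pr X a)%E.
  move=> ab; apply: le_ereal_inf => _ [t [t0 tva] <-]; exists t => //; split => //.
  by apply: le_trans tva _; rewrite lee_fin.
have mt0 a : (0 <= mixing_time mu Pr X a)%E.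
  by apply: le_ereal_inf_tmp => _ [t [t0 _] <-]; rewrite lee_fin ltW.
have fin1 : (mixing_time mu Pr X (1 - eps) < +oo)%E.
  have e12 : eps <= 1 - eps by lra.
  apply: le_lt_trans (mono _ _ e12) _.
  (* Finiteness of the mixing time follows from the spectral gap started at time 1; the maximum with
     0 supplies a nonnegative entropy bound. *)
  have D0 : 0 <= Num.max 0 (entropy mu (f 1)) by rewrite le_max lexx.
  apply: le_lt_trans (mixing_time_spectral_gap fP ltr01 D0 _) (ltry _).
  by rewrite le_max lexx orbT.
have fin : mixing_time mu Pr X (1 - eps) \is a fin_num by rewrite ge0_fin_numE.
pose K := (lam * eps ^+ 3)^-1.
have K0 : 0 < K by rewrite invr_gt0 mulr_gt0// exprn_gt0.
rewrite /mixing_window -(fineK fin); set r := fine _.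
have r0 : 0 <= r by rewrite fine_ge0.
have [s s0 [delta d0 H]] := window_optimization r0 K0 heps.
(* A time within delta of the infimum, which need not be attained. *)
have [_ [t [t0 tvt] <-] tr] := lb_ereal_inf_adherent d0 fin.
have {}tr : (t%:E < mixing_time mu Pr X (1 - eps) + delta%:E)%E := tr.
rewrite -(fineK fin) -/r -EFinD lte_fin in tr.
have M := mixing_time_after t0 s0 tvt.
have -> : (r%:E * ((lam * eps ^+ 3)^-1)%:E)%E = (r * K)%:E by [].
have -> : (3%:E * sqrte (r * K)%:E)%E = (3 * Num.sqrt (r * K))%:E by [].
rewrite -EFinD leeBlDr//.
apply: le_trans M _; rewrite -EFinD lee_fin.
(* In terms of K, 1/(eps lam) is K eps^2, 1/(eps^2 lam) is K eps, and the quotient (t + s)/s yields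
   2 K and the term in t/s. *)
have KE : (1 + (eps^-1 + 2 * (t + s) / (eps ^+ 2 * s))) / eps / lam =
    K * (eps ^+ 2 + eps + 2) + 2 * t * K / s.
  by rewrite /K; field; rewrite !gt_eqF.
rewrite KE.
have tK : 2 * t * K / s <= 2 * (r + delta) * K / s.
  by rewrite ler_pM2r ?invr_gt0// ler_pM2r// ler_pM2l// ltW.
have -> : 3 / (lam * eps ^+ 3) = 3 * K by [].
move: H tK; move: (2 * t * K / s) (2 * (r + delta) * K / s) (K * _) (Num.sqrt _) => a b c q.
lra.
Qed.

End mixing.

Unset Implicit Arguments.

Theorem theorem1 (d d' : measure_display) (R : realType)
  (E : measurableType d) (Omega : measurableType d')
  (mu : probability E R) (Pr : probability Omega R)
  (kappa : R -> R.-pker E ~> E) (X : R -> {mfun Omega >-> E}) (x : E)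
  (hX : nonneg_curved_diffusion mu Pr kappa X x)
  (lam : R) (hlam : is_spectral_gap mu kappa lam) (lam_gt0 : 0 < lam)
  (eps : R) (heps : 0 < eps < 2^-1) :
  (mixing_window mu Pr X eps
   <= (3 / (lam * eps ^+ 3))%:E
      + 3%:E * sqrte (mixing_time mu Pr X (1 - eps)
                      * ((lam * eps ^+ 3)^-1)%:E))%E.
Proof. exact: (mixing_window_le hX hlam.1 lam_gt0 heps). Qed.
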